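(* Suppose that $\{\widetilde U_{i,j}^n \mid (i,j)\in\omega,\ 1\le n\le N\}$ is the solution of the formally second-order ADI compact difference scheme: for $(i,j)\in\omega$, $1\le n\le N$, $$c_0\delta_t\mathcal A_h\widetilde U_{i,j}^{n-\frac12}+\sum_{k=1}^{n-1}\tilde w_{n-k}\,\delta_t\mathcal A_h\widetilde U_{i,j}^{k-\frac12}-\tau^{\bar\alpha}\Big(\sum_{p=0}^n\chi_p^{(\bar\alpha)}\Lambda_h\widetilde U_{i,j}^{n-p-\frac12}+\hat\rho_n^{(\bar\alpha)}\Lambda_h\widetilde U_{i,j}^0\Big)+\frac{(\tau^{\bar\alpha+1}\chi_0^{(\bar\alpha)})^2}{4c_0}\delta_x^2\delta_y^2\delta_t\widetilde U_{i,j}^{n-\frac12}=\mathcal A_h\mathcal F_{i,j}^{n-\frac12},$$ with $\widetilde U_{i,j}^0=0$ for $(i,j)\in\omega$ and $\widetilde U_{i,j}^n=0$ for $(i,j)\in\partial\omega$, $0\le n\le N$. Then $$\|\widetilde U^N\|\le Q\sum_{n=1}^N\tau\|\mathcal F^{n-\frac12}\|\le Q\Big(\|\Delta u_0\|+\|\bar u_0\|+\max_{0\le t\le t_N}\|f(t)\|\Big).$$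
   Context: Exponent: $T>0$; $\alpha:[0,T]\to(1,2)$ is three times differentiable with $|\alpha'|+|\alpha''|+|\alpha'''|$ bounded, and $\alpha'(0)=0$. Put $\alpha_0=\alpha(0)$, $\bar\alpha=\alpha_0-1\in(0,1)$, $\beta_\mu(t)=t^{\mu-1}/\Gamma(\mu)$, $(v*w)(t)=\int_0^t v(t-s)w(s)ds$, and $$g(t)=\int_0^1\frac{(tz)^{\alpha(0)-\alpha(tz)}}{\Gamma(\alpha(0)-1)\Gamma(2-\alpha(tz))}(1-z)^{\alpha(0)-2}z^{1-\alpha(0)}dz,\qquad g(0)=1.$$ Data: $\Omega=(l_1,r_1)\times(l_2,r_2)$; $u_0,\bar u_0$ are functions on $\overline\Omega$ and $f$ is a function on $\overline\Omega\times[0,T]$, regular enough that all expressions make sense; $\mathcal F(t)=(\beta_{\bar\alpha}*(\Delta u_0+f))(t)+g(t)\bar u_0$, and $\mathcal F_{i,j}^n=\mathcal F(x_i,y_j,t_n)$. Time grid: $N$ is a positive integer, $\tau=T/N$, $t_n=n\tau$, $v^{n-\frac12}=\frac12(v^n+v^{n-1})$, $\delta_tv^{n-\frac12}=(v^n-v^{n-1})/\tau$; convention $\widetilde U^{-1}=0$. Coefficients: $w_k=g(t_{k+1})-g(t_k)$, $\tilde w_0=w_0/2$, $\tilde w_k=\frac12(w_k+w_{k-1})$ for $k\ge1$, $c_0=1+\frac{w_0}{2}$; $\chi_p^{(\bar\alpha)}$ are defined by $\big(\frac{2(1-z)}{1+z}\big)^{-\bar\alpha}=\sum_{p\ge0}\chi_p^{(\bar\alpha)}z^p$;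 $\rho_n^{(\bar\alpha)}=\frac{n^{\bar\alpha}}{\Gamma(\bar\alpha+1)}-\sum_{p=0}^n\chi_p^{(\bar\alpha)}$, $\hat\rho_n^{(\bar\alpha)}=\frac12(\rho_n^{(\bar\alpha)}+\rho_{n-1}^{(\bar\alpha)})$. Space grid: $M_1,M_2$ are positive integers, $h_1=(r_1-l_1)/M_1$, $h_2=(r_2-l_2)/M_2$, $x_i=l_1+ih_1$, $y_j=l_2+jh_2$, with $Q_1h_1\le h_2\le Q_2h_1$ for fixed positive constants $Q_1,Q_2$ independent of $h_1,h_2,\tau$. $\omega=\{(i,j):1\le i\le M_1-1,1\le j\le M_2-1\}$, $\bar\omega=\{(i,j):0\le i\le M_1,0\le j\le M_2\}$, $\partial\omega=\bar\omega\setminus\omega$. Operators: $\delta_x^2u_{i,j}=(u_{i+1,j}-2u_{i,j}+u_{i-1,j})/h_1^2$, $\delta_y^2u_{i,j}=(u_{i,j+1}-2u_{i,j}+u_{i,j-1})/h_2^2$; $\mathcal A_1u_{i,j}=\frac1{12}(u_{i-1,j}+10u_{i,j}+u_{i+1,j})$ for $1\le i\le M_1-1$ and $\mathcal A_1u_{i,j}=u_{i,j}$ for $i\in\{0,M_1\}$; $\mathcal A_2u_{i,j}=\frac1{12}(u_{i,j-1}+10u_{i,j}+u_{i,j+1})$ for $1\le j\le M_2-1$ and $\mathcal A_2u_{i,j}=u_{i,j}$ for $j\in\{0,M_2\}$; $\mathcal A_h=\mathcal A_1\mathcal A_2$, $\Lambda_h=\mathcal A_2\delta_x^2+\mathcal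 A_1\delta_y^2$. Norm: $\|u\|^2=h_1h_2\sum_{i=1}^{M_1-1}\sum_{j=1}^{M_2-1}|u_{i,j}|^2$; a function of $(x,y)$ inside $\|\cdot\|$ is identified with its values at the nodes $(x_i,y_j)$. $Q$ denotes a generic positive constant, possibly different at each occurrence, independent of $\tau,h_1,h_2$ and of the data $u_0,\bar u_0,f$ (it may depend on $T$ and $\alpha$).
   Formalization: It is additionally assumed that F^{n-1/2} vanishes at all boundary nodes for 1≤n≤N; otherwise the first inequality fails, since the norm sums only interior nodes while A_h F uses boundary values (e.g. α=3/2, N=1, M1=M2=2, u0=f=0, ū0 nonzero at one boundary node only). *)

(* Defs.v *)
From HB Require Import structures.
From mathcomp Require Import all_boot all_order all_algebra.
From mathcomp Require Import all_classical all_reals all_analysis.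

Set Implicit Arguments.
Unset Strict Implicit.
Unset Printing Implicit Defensive.

Import Order.TTheory GRing.Theory Num.Theory.
Import numFieldNormedType.Exports.

Local Open Scope classical_set_scope.
Local Open Scope ring_scope.

(* Derivatives within a segment [D]: one-sided at the end points, so that the
   values of [phi] outside [D] are irrelevant. *)
Definition diff_quotient (R : realType) (phi : R -> R) (x s : R) : R :=
  (phi s - phi x) / (s - x).

Definition derivable_on (R : realType) (D : set R) (phi : R -> R) : Prop :=
  forall x, D x ->
    cvg (diff_quotient phi x s @[s --> within (D `\ x) (nbhs x)]).

Definition derive_on (R : realType) (D : set R) (phi : R -> R) (x : R) : R :=
  lim (diff_quotient phi x s @[s --> within (D `\ x) (nbhs x)]).

Definition nderive_on (R : realType) (D : set R) (k : nat) (phi : R -> R) :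
  R -> R := iter k (derive_on D) phi.

Definition nderivable_on (R : realType) (D : set R) (k : nat) (phi : R -> R) :
  Prop := forall m, (m < k)%N -> derivable_on D (nderive_on D m phi).

Definition admissible_exponent (R : realType) (T : R) (alpha : R -> R) : Prop :=
  [/\ forall t, 0 <= t <= T -> 1 < alpha t < 2,
      nderivable_on `[0, T] 3 alpha,
      exists K : R, forall t, 0 <= t <= T ->
        `|nderive_on `[0, T] 1 alpha t| + `|nderive_on `[0, T] 2 alpha t|
          + `|nderive_on `[0, T] 3 alpha t| <= K &
      nderive_on `[0, T] 1 alpha 0 = 0].

(* Euler's integral, used for positive [a] only. *)
Definition euler_gamma (R : realType) (a : R) : R :=
  \int[@lebesgue_measure R]_(s in `]0, +oo[) (s `^ (a - 1) * expR (- s)).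

Definition beta_kernel (R : realType) (m t : R) : R :=
  t `^ (m - 1) / euler_gamma m.

Definition convolution (R : realType) (v w : R -> R) (t : R) : R :=
  \int[@lebesgue_measure R]_(s in `[0, t]) (v (t - s) * w s).

Definition g_kernel (R : realType) (alpha : R -> R) (t : R) : R :=
  if t == 0 then 1 else
  \int[@lebesgue_measure R]_(z in `]0, 1[)
    ((t * z) `^ (alpha 0 - alpha (t * z))
       / (euler_gamma (alpha 0 - 1) * euler_gamma (2 - alpha (t * z)))
     * (1 - z) `^ (alpha 0 - 2) * z `^ (1 - alpha 0)).

Definition laplacian (R : realType) (l1 r1 l2 r2 : R) (u : R -> R -> R)
    (x y : R) : R :=
  nderive_on `[l1, r1] 2 (fun s => u s y) x
  + nderive_on `[l2, r2] 2 (fun s => u x s) y.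

Definition twice_partially_derivable (R : realType) (l1 r1 l2 r2 : R)
    (u : R -> R -> R) : Prop :=
  (forall y, l2 <= y <= r2 -> nderivable_on `[l1, r1] 2 (fun s => u s y)) /\
  (forall x, l1 <= x <= r1 -> nderivable_on `[l2, r2] 2 (fun s => u x s)).

Definition calF (R : realType) (alpha : R -> R) (l1 r1 l2 r2 : R)
    (u0 ubar0 : R -> R -> R) (f : R -> R -> R -> R) (x y t : R) : R :=
  convolution (beta_kernel (alpha 0 - 1))
       (fun s => laplacian l1 r1 l2 r2 u0 x y + f x y s) t
  + g_kernel alpha t * ubar0 x y.

(* For grid functions, [v n i j] is the value at time level n and node (i, j) *)

Definition interior_node (M1 M2 i j : nat) : bool :=
  (0 < i < M1)%N && (0 < j < M2)%N.

Definition boundary_node (M1 M2 i j : nat) : bool :=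
  [&& (i <= M1)%N, (j <= M2)%N & ~~ interior_node M1 M2 i j].

(* [thalf v n] is v^{n-1/2}; the level -1 of a grid function is 0. *)
Definition thalf (R : realType) (v : nat -> nat -> nat -> R) (n i j : nat) : R :=
  (v n i j + (if n is m.+1 then v m i j else 0)) / 2.

(* [delta_t tau v n] is \delta_t v^{n-1/2}, for n >= 1. *)
Definition delta_t (R : realType) (tau : R) (v : nat -> nat -> nat -> R)
    (n i j : nat) : R :=
  (v n i j - v n.-1 i j) / tau.

Definition delta_x2 (R : realType) (h1 : R) (u : nat -> nat -> R) (i j : nat) : R :=
  (u i.+1 j - 2 * u i j + u i.-1 j) / h1 ^+ 2.

Definition delta_y2 (R : realType) (h2 : R) (u : nat -> nat -> R) (i j : nat) : R :=
  (u i j.+1 - 2 * u i j + u i j.-1) / h2 ^+ 2.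

Definition A1 (R : realType) (M1 : nat) (u : nat -> nat -> R) (i j : nat) : R :=
  if (0 < i < M1)%N then (u i.-1 j + 10 * u i j + u i.+1 j) / 12 else u i j.

Definition A2 (R : realType) (M2 : nat) (u : nat -> nat -> R) (i j : nat) : R :=
  if (0 < j < M2)%N then (u i j.-1 + 10 * u i j + u i j.+1) / 12 else u i j.

Definition Ah (R : realType) (M1 M2 : nat) (u : nat -> nat -> R) :
  nat -> nat -> R := A1 M1 (A2 M2 u).

Definition Lambdah (R : realType) (h1 h2 : R) (M1 M2 : nat)
    (u : nat -> nat -> R) (i j : nat) : R :=
  A2 M2 (delta_x2 h1 u) i j + A1 M1 (delta_y2 h2 u) i j.

(* Only the interior nodes contribute. *)
Definition grid_norm (R : realType) (h1 h2 : R) (M1 M2 : nat)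
    (u : nat -> nat -> R) : R :=
  Num.sqrt (h1 * h2 *
    \sum_(1 <= i < M1) \sum_(1 <= j < M2) `|u i j| ^+ 2).

Definition wcoef (R : realType) (alpha : R -> R) (tau : R) (k : nat) : R :=
  g_kernel alpha (k.+1%:R * tau) - g_kernel alpha (k%:R * tau).

Definition wtilde (R : realType) (alpha : R -> R) (tau : R) (k : nat) : R :=
  if k is m.+1 then (wcoef alpha tau m.+1 + wcoef alpha tau m) / 2
  else wcoef alpha tau 0 / 2.

Definition c0coef (R : realType) (alpha : R -> R) (tau : R) : R :=
  1 + wcoef alpha tau 0 / 2.

(* A power series identity on the real interval (-1, 1) determines [chi]. *)
Definition is_chi (R : realType) (a : R) (chi : nat -> R) : Prop :=
  forall z : R, `|z| < 1 ->
    series (fun p => chi p * z ^+ p) @ \oo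
      --> (2 * (1 - z) / (1 + z)) `^ (- a).

Definition rho_coef (R : realType) (a : R) (chi : nat -> R) (n : nat) : R :=
  n%:R `^ a / euler_gamma (a + 1) - \sum_(0 <= p < n.+1) chi p.

(* Meaningful for n >= 1. *)
Definition rhohat_coef (R : realType) (a : R) (chi : nat -> R) (n : nat) : R :=
  (rho_coef a chi n + rho_coef a chi n.-1) / 2.

Definition adi_equation (R : realType) (alpha : R -> R) (chi : nat -> R)
    (tau h1 h2 : R) (M1 M2 : nat) (F U : nat -> nat -> nat -> R)
    (n i j : nat) : Prop :=
  let a := alpha 0 - 1 in
  let c0 := c0coef alpha tau in
  let AU := fun m => Ah M1 M2 (U m) in
  c0 * delta_t tau AU n i j
  + \sum_(1 <= k < n) wtilde alpha tau (n - k) * delta_t tau AU k i j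
  - tau `^ a *
      (\sum_(0 <= p < n.+1) chi p * Lambdah h1 h2 M1 M2 (thalf U (n - p)) i j
       + rhohat_coef a chi n * Lambdah h1 h2 M1 M2 (U 0%N) i j)
  + (tau `^ (a + 1) * chi 0%N) ^+ 2 / (4 * c0)
      * delta_x2 h1 (delta_y2 h2 (delta_t tau U n)) i j
  = Ah M1 M2 (thalf F n) i j.

Definition adi_solution (R : realType) (alpha : R -> R) (chi : nat -> R)
    (tau h1 h2 : R) (N M1 M2 : nat) (F U : nat -> nat -> nat -> R) : Prop :=
  [/\ forall n i j, (1 <= n <= N)%N -> interior_node M1 M2 i j ->
        adi_equation alpha chi tau h1 h2 M1 M2 F U n i j,
      forall i j, interior_node M1 M2 i j -> U 0%N i j = 0 &
      forall n i j, (n <= N)%N -> boundary_node M1 M2 i j -> U n i j = 0].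

(* Main.v *)
(** Testing the scheme at level [n] with the average [U^{n-1/2}] and summing, the
    leading term and the splitting term telescope.  The convolution with [chi] is
    nonnegative: [(2 (1 - z) / (1 + z)) `^ (- a)] is a mixture, with the positive
    weight [(1 - s) `^ (a - 1) * s `^ (- a)], of the functions
    [(1 + z) / (1 - q z)] with [q = 1 - 2 s], each of which has a nonnegative
    real part on the unit disc.  Summation by parts turns the memory term into a
    perturbation of relative size [O(tau)], provided that the second differences
    of [g] sum up to [O(tau)]; a discrete Gronwall argument concludes.

    Since [alpha'(0) = 0], the second derivative of
    [s |-> s `^ (alpha 0 - alpha s)] is [O(1 + |ln s|)], hence its second
    differences are dominated by those of the convex function [modulus].  This
    property is stable under products, smooth composition, scaling and
    integration, and so passes to [1 / Gamma (2 - alpha)] and to [g].  Euler's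
    integral for [Gamma a * Gamma (1 - a)] shows that [g] is continuous at [0]. *)

Require Import Defs.
From HB Require Import structures.
From mathcomp Require Import all_boot all_order all_algebra.
From mathcomp Require Import all_classical all_reals all_analysis.
From mathcomp Require Import measurable_realfun ring lra.

Set Implicit Arguments.
Unset Strict Implicit.
Unset Printing Implicit Defensive.

Import Order.TTheory GRing.Theory Num.Theory.
Import numFieldNormedType.Exports.

Local Open Scope classical_set_scope.
Local Open Scope ring_scope.

(** * Positive semidefinite forms and the energy inequality *)

(** The estimate holds for every step size. Since [g 0 = 1] and [g >= 0], the leading coefficient
    satisfies [c0 >= 1 / 2]; and the memory term at level [n] couples the current maximum only with
    maxima up to level [n.-1], so that the Gronwall recursion is explicit. As [N * tau = T], the
    growth factor [(1 + 4 W tau)^N] is at most [exp (4 W T)].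

    The regularity of [g] is expressed by second differences because [g] is an integral against a
    weight singular at both ends, of a function whose second derivative may be unbounded at 0.
    Second differences are linear, so a pointwise bound is simply integrated, and the comparison
    function records the singularity.

    The coefficients [chi] are given only by a series on a real interval. Uniqueness of real power
    series identifies them with moments of an explicit family, for which positivity is an algebraic
    telescoping identity valid for any semidefinite form. This abstraction also lets the grid
    functions be all functions on [nat]: a form that sees only the grid is semidefinite, and
    definiteness enters only through the comparison of the mass form with the discrete norm. *)

Definition psd_form (R : realType) (V : lmodType R) (B : V -> V -> R) : Prop :=
  [/\ forall c u u' v, B (c *: u + u') v = c * B u v + B u' v,
      forall u v, B u v = B v u & forall u, 0 <= B u u].

Lemma psd_formC (R : realType) (V : lmodType R) (B : V -> V -> R)
  (Bp : psd_form B) u v : B u v = B v u.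
Proof. by case: Bp. Qed.

Lemma psd_form_ge0 (R : realType) (V : lmodType R) (B : V -> V -> R)
  (Bp : psd_form B) u : 0 <= B u u.
Proof. by case: Bp. Qed.

Lemma psd_formD (R : realType) (V : lmodType R) (B : V -> V -> R)
  (Bp : psd_form B) u u' v : B (u + u') v = B u v + B u' v.
Proof. by case: Bp => lin _ _; rewrite -[u]scale1r lin scale1r mul1r. Qed.

Lemma psd_form0 (R : realType) (V : lmodType R) (B : V -> V -> R)
  (Bp : psd_form B) v : B 0 v = 0.
Proof.
have := psd_formD Bp 0 0 v; rewrite addr0 => /eqP.
by rewrite addrC -subr_eq subrr => /eqP.
Qed.

Lemma psd_formZ (R : realType) (V : lmodType R) (B : V -> V -> R)
  (Bp : psd_form B) c u v : B (c *: u) v = c * B u v.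
Proof. by rewrite -[c *: u]addr0; case: (Bp) => -> _ _; rewrite (psd_form0 Bp) addr0. Qed.

Lemma psd_formDr (R : realType) (V : lmodType R) (B : V -> V -> R)
  (Bp : psd_form B) u u' v : B v (u + u') = B v u + B v u'.
Proof. by rewrite !(psd_formC Bp v) (psd_formD Bp). Qed.

Lemma psd_formZr (R : realType) (V : lmodType R) (B : V -> V -> R)
  (Bp : psd_form B) c u v : B v (c *: u) = c * B v u.
Proof. by rewrite !(psd_formC Bp v) (psd_formZ Bp). Qed.

Lemma psd_formB (R : realType) (V : lmodType R) (B : V -> V -> R)
  (Bp : psd_form B) u u' v : B (u - u') v = B u v - B u' v.
Proof. by rewrite (psd_formD Bp) -scaleN1r (psd_formZ Bp) mulN1r. Qed.

(** By symmetry the cross terms cancel; a time difference tested with the time average therefore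
    telescopes. *)
Lemma psd_form_mean (R : realType) (V : lmodType R) (B : V -> V -> R)
    (Bp : psd_form B) u u' :
  B (u - u') (2^-1 *: (u + u')) = 2^-1 * (B u u - B u' u').
Proof.
rewrite (psd_formZr Bp) (psd_formDr Bp) !(psd_formB Bp) (psd_formC Bp u' u).
by congr (_ * _); ring.
Qed.

Definition seminorm (R : realType) (V : lmodType R) (B : V -> V -> R) (u : V) :=
  Num.sqrt (B u u).

Lemma seminorm_ge0 (R : realType) (V : lmodType R) (B : V -> V -> R) u :
  0 <= seminorm B u.
Proof. exact: sqrtr_ge0. Qed.

Lemma sqr_seminorm (R : realType) (V : lmodType R) (B : V -> V -> R)
  (Bp : psd_form B) u : seminorm B u ^+ 2 = B u u.
Proof. by rewrite sqr_sqrtr// psd_form_ge0. Qed.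

Lemma seminormZ (R : realType) (V : lmodType R) (B : V -> V -> R)
  (Bp : psd_form B) c u : seminorm B (c *: u) = `|c| * seminorm B u.
Proof.
rewrite /seminorm (psd_formZ Bp) (psd_formZr Bp) mulrA -expr2.
by rewrite sqrtrM ?sqr_ge0// sqrtr_sqr.
Qed.

Lemma psd_form_cauchy (R : realType) (V : lmodType R) (B : V -> V -> R)
  (Bp : psd_form B) u v : `|B u v| <= seminorm B u * seminorm B v.
Proof.
have E s t : s ^+ 2 * B u u + 2 * s * t * B u v + t ^+ 2 * B v v >= 0.
  have := psd_form_ge0 Bp (s *: u + t *: v).
  rewrite (psd_formD Bp) !(psd_formZ Bp) !(psd_formDr Bp) !(psd_formZr Bp).
  rewrite (psd_formC Bp v u) => h.
  by apply: le_trans h _; rewrite le_eqVlt; apply/orP; left; apply/eqP; ring.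
have uu := psd_form_ge0 Bp u; have vv := psd_form_ge0 Bp v.
have H : B u v ^+ 2 <= B u u * B v v.
  have [v0|v0] := eqVneq (B v v) 0.
    have [->|b0] := eqVneq (B u v) 0; first by rewrite v0 expr2 !mulr0.
    (* If [B v v = 0] but [B u v != 0], this choice of [t] makes the quadratic polynomial equal to
       [B u u - (B u u + 1) = -1]. *)
    have := E 1 (- (B u u + 1) / (2 * B u v)); rewrite v0 mulr0 addr0.
    have -> : 2 * 1 * (- (B u u + 1) / (2 * B u v)) * B u v = - (B u u + 1).
      by field.
    by move=> h; exfalso; lra.
  have vp : 0 < B v v by rewrite lt_def v0 vv.
  have := E (B v v) (- B u v).
  have -> : B v v ^+ 2 * B u u + 2 * B v v * - B u v * B u v + (- B u v) ^+ 2 * B v v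
    = B v v * (B u u * B v v - B u v ^+ 2) by ring.
  by rewrite pmulr_rge0// subr_ge0.
rewrite -sqrtrM// -[`|B u v|]sqrtr_sqr.
by rewrite ler_wsqrtr.
Qed.

Lemma seminormD (R : realType) (V : lmodType R) (B : V -> V -> R)
  (Bp : psd_form B) u v : seminorm B (u + v) <= seminorm B u + seminorm B v.
Proof.
rewrite -(@ler_pXn2r _ 2) ?nnegrE ?addr_ge0 ?seminorm_ge0//.
rewrite (sqr_seminorm Bp) (psd_formD Bp) !(psd_formDr Bp) (psd_formC Bp v u).
rewrite sqrrD !(sqr_seminorm Bp).
have := le_trans (ler_norm _) (psd_form_cauchy Bp u v); lra.
Qed.

(* The generating function [(1 + z) / (1 - q z)] has a nonnegative real part on
   the unit circle; with [s n = \sum_(p <= n) q ^+ p *: v (n - p)] this is the identity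
   [B (s n + s n.-1) (v n) = (1 - q) / 2 * B (s n + s n.-1) (s n + s n.-1)
      + (1 + q) / 2 * (B (s n) (s n) - B (s n.-1) (s n.-1))]. *)
Definition cayley_coef (R : realType) (q : R) (p : nat) : R :=
  if p is m.+1 then q ^+ m * (1 + q) else 1.

Lemma cayley_coef_psd (R : realType) (V : lmodType R) (B : V -> V -> R)
    (Bp : psd_form B) (q : R) (v : nat -> V) m :
  -1 <= q <= 1 ->
  0 <= \sum_(0 <= n < m) \sum_(0 <= p < n.+1) cayley_coef q p * B (v (n - p)%N) (v n).
Proof.
move=> /andP[q1 q2]; case: (Bp) => lin sym nng.
pose s := fix s n := if n is k.+1 then q *: s k + v k.+1 else v 0%N.
pose sp n := if n is k.+1 then s k else 0.
have sE n : s n = q *: sp n + v n by case: n => //=; rewrite scaler0 add0r.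
have BsE n w : B (s n) w = q * B (sp n) w + B (v n) w by rewrite sE lin.
have yE n w : \sum_(0 <= p < n.+1) cayley_coef q p * B (v (n - p)%N) w
    = B (s n) w + B (sp n) w.
  elim: n => [|n IH]; first by rewrite big_nat1 /= mul1r (psd_form0 Bp) ?addr0.
  rewrite big_nat_recl//= mul1r subn0 big_nat_recl//= expr0 mul1r subn1 /=.
  have -> : \sum_(0 <= i < n) (q ^+ i.+1 * (1 + q)) * B (v (n.+1 - i.+2)%N) w
      = q * (B (s n) w + B (sp n) w) - q * B (v n) w.
    rewrite -IH big_nat_recl//= mul1r subn0 mulrDr addrAC subrr add0r mulr_sumr.
    by apply: eq_bigr => i _; rewrite exprS !mulrA subSS.
  by rewrite [B (q *: _ + _) _](BsE n.+1) /= (BsE n); ring.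
(* The identity summed over [n]: the differences telescope to [B (sp m) (sp m)], and both factors
   are nonnegative because [|q| <= 1]. *)
suff -> : \sum_(0 <= n < m) \sum_(0 <= p < n.+1) cayley_coef q p * B (v (n - p)%N) (v n)
    = (1 - q) / 2 * (\sum_(0 <= n < m) B (s n + sp n) (s n + sp n))
      + (1 + q) / 2 * B (sp m) (sp m).
  apply: addr_ge0; apply: mulr_ge0 => //; try lra.
  by apply: sumr_ge0.
elim: m => [|m IH]; first by rewrite !big_nil /= (psd_form0 Bp); ring.
rewrite big_nat_recr//= [in RHS]big_nat_recr//= IH yE.
rewrite !(psd_formD Bp) !(psd_formDr Bp).
have -> : v m = s m + (- q) *: sp m by rewrite sE scaleNr addrAC subrr add0r.
rewrite !(psd_formDr Bp) !(psd_formZr Bp) (sym (sp m) (s m)).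
by field.
Qed.

Lemma abel_sum (R : realType) (b x : nat -> R) m : x 0%N = 0 ->
  \sum_(1 <= k < m.+1) b k * (x k - x k.-1)
  = b m * x m + \sum_(1 <= k < m) (b k - b k.+1) * x k.
Proof.
move=> x0; elim: m => [|m IH]; first by rewrite !big_geq// x0 mulr0 addr0.
rewrite big_nat_recr//= IH; case: m {IH} => [|m]; first by rewrite !big_geq// x0; ring.
by rewrite [in RHS]big_nat_recr//=; ring.
Qed.

(** Summation by parts moves the differences onto the weights. As [x 0 = 0], the only boundary term
    carries [w 1]; the rest is controlled by the total variation of [w]. *)
Lemma abel_sum_le (R : realType) (w x : nat -> R) (W X : R) m N :
  x 0%N = 0 -> (forall k, (k <= m)%N -> `|x k| <= X) -> (m <= N)%N ->
  `|w 1%N| + \sum_(1 <= j < N) `|w j.+1 - w j| <= W ->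
  `|\sum_(1 <= k < m.+1) w (m.+1 - k)%N * (x k - x k.-1)| <= W * X.
Proof.
move=> x0 xX mN wW.
have X0 : 0 <= X by apply: le_trans (xX 0%N _).
rewrite (abel_sum (fun k => w (m.+1 - k)%N))// subSn// subnn.
apply: le_trans (ler_normD _ _) _.
apply: le_trans (ler_wpM2r X0 wW); rewrite mulrDl; apply: lerD.
  by rewrite normrM ler_wpM2l// xX.
apply: (@le_trans _ _ (\sum_(1 <= j < m) `|w j.+1 - w j| * X)); last first.
  rewrite -mulr_suml ler_wpM2r//.
  case: m mN {xX} => [|m] mN; first by rewrite big_geq// sumr_ge0.
  by rewrite (big_cat_nat _ _ (n := m.+1) (p := N))//= lerDl sumr_ge0.
apply: le_trans (ler_norm_sum _ _ _) _.
rewrite big_nat_rev /= big_nat_cond [leRHS]big_nat_cond; apply: ler_sum => k.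
rewrite andbT => /andP[k1 km]; rewrite normrM add1n subSS.
have -> : (m.+1 - (m - k) = k.+1)%N by rewrite subSn ?leq_subr// subKn// ltnW.
have -> : (m.+1 - (m - k).+1 = k)%N by rewrite subSS subKn// ltnW.
by rewrite ler_wpM2l// xX// leq_subr.
Qed.

(* Testing the scheme with the half-level average [v n] makes the first and the
   last terms telescope; the convolution with [chi] has a sign, and the memory
   term, after summation by parts, is of the order of the past maxima of [u]. *)
Lemma energy_bound (R : realType) (V : lmodType R) (A L D : V -> V -> R)
    (Ap : psd_form A) (Lp : psd_form L) (Dp : psd_form D)
    (N : nat) (tau c0 theta kappa W : R) (w chi : nat -> R) (u F : nat -> V) :
  let v n := 2^-1 *: (u n + u n.-1) in
  0 < tau -> 2^-1 <= c0 -> 0 <= theta -> 0 <= kappa -> 0 <= W ->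
  (forall m, 0 <= \sum_(0 <= n < m) \sum_(0 <= p < n.+1)
       chi p * L (v (n - p)%N) (v n)) ->
  ((1 < N)%N ->
    `|w 1%N| + \sum_(1 <= j < N.-1) `|w j.+1 - w j| <= W * tau) ->
  u 0%N = 0 ->
  (forall n, (1 <= n <= N)%N ->
    c0 / tau * A (u n - u n.-1) (v n)
    + \sum_(1 <= k < n) w (n - k)%N / tau * A (u k - u k.-1) (v n)
    + theta * \sum_(0 <= p < n.+1) chi p * L (v (n - p)%N) (v n)
    + kappa * D (u n - u n.-1) (v n) = A (F n) (v n)) ->
  seminorm A (u N)
    <= 4 * (\sum_(1 <= n < N.+1) tau * seminorm A (F n)) * (1 + 4 * W * tau) ^+ N.
Proof.
move=> v tau0 c0p theta0 kappa0 W0 chip wW u0 eqn.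
have v0 : v 0%N = 0 by rewrite /v /= u0 addr0 scaler0.
pose nu k := seminorm A (u k).
(* Running maximum of the seminorms, with value 0 at level 0. *)
pose M := fix M n := if n is k.+1 then Num.max (M k) (nu k.+1) else 0.
have nu0 : nu 0%N = 0 by rewrite /nu /seminorm u0 (psd_form0 Ap) sqrtr0.
have MS n : M n <= M n.+1 by rewrite /= le_max lexx.
have Mle k n : (k <= n)%N -> M k <= M n.
  by move=> /subnK <-; elim: (n - k)%N => // d IH; rewrite addSn (le_trans IH).
have nuM k : nu k <= M k by case: k => [|k] /=; rewrite ?nu0// le_max lexx orbT.
have M0 n : 0 <= M n by apply: (Mle 0%N).
have vM n : (0 < n)%N -> seminorm A (v n) <= M n.
  move=> n0; rewrite /v (seminormZ Ap) ger0_norm//.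
  have := seminormD Ap (u n) (u n.-1); have := nuM n; have := nuM n.-1.
  have := Mle n.-1 n (leq_pred n); rewrite /nu; lra.
(* Summation by parts for [x k = A (u k) (v n)], which is at most [M n.-1 * M n] in absolute value
   for [k < n]; the factor [tau] in the bound on the variation of [w] absorbs the division by
   [tau]. *)
have mem n : (1 <= n <= N)%N ->
    `|\sum_(1 <= k < n) w (n - k)%N / tau * A (u k - u k.-1) (v n)|
      <= W * M n.-1 * M n.
  case: n => // -[|m] /andP[_ mN]; first by rewrite big_geq// normr0 !mulr_ge0.
  have N1 : (1 < N)%N by exact: leq_ltn_trans mN.
  under eq_bigr => k _ do rewrite mulrAC (psd_formB Ap) mulrC.
  rewrite -mulr_sumr normrM gtr0_norm ?invr_gt0// ler_pdivrMl//.
  rewrite (_ : tau * _ = W * tau * (M m.+1 * M m.+2)); last by rewrite /=; ring.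
  apply: (@abel_sum_le _ w (fun k => A (u k) (v m.+2)) _ _ _ N.-1) => //.
  - by rewrite u0 (psd_form0 Ap).
  - move=> k km; apply: le_trans (psd_form_cauchy Ap _ _) _.
    by apply: ler_pM; rewrite ?seminorm_ge0// ?vM// (le_trans (nuM k))// Mle.
  - by rewrite -ltnS prednK// ltnW.
  - exact: wW.
pose S := \sum_(1 <= n < N.+1) tau * seminorm A (F n).
(* The tested equations are summed up to level [m] and the nonnegative [chi] and splitting terms are
   dropped. *)
have energy m : (m <= N)%N ->
    c0 / tau / 2 * nu m ^+ 2 <= M m * \sum_(1 <= n < m.+1) (W * M n.-1 + seminorm A (F n)).
  move=> mN.
  have tele (B : V -> V -> R) (Bp : psd_form B) : forall m, \sum_(1 <= n < m.+1) B (u n - u n.-1) (v n) = 2^-1 * B (u m) (u m).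
    elim=> [|k IH]; first by rewrite big_geq// u0 (psd_form0 Bp) mulr0.
    by rewrite big_nat_recr//= IH (psd_form_mean Bp); ring.
  rewrite (sqr_seminorm Ap) -mulrA -(tele A Ap) mulr_sumr.
  have E : \sum_(1 <= n < m.+1) (c0 / tau * A (u n - u n.-1) (v n))
     + \sum_(1 <= n < m.+1) \sum_(1 <= k < n) w (n - k)%N / tau * A (u k - u k.-1) (v n)
     + theta * \sum_(1 <= n < m.+1) \sum_(0 <= p < n.+1) chi p * L (v (n - p)%N) (v n)
     + kappa * (\sum_(1 <= n < m.+1) D (u n - u n.-1) (v n))
     = \sum_(1 <= n < m.+1) A (F n) (v n).
    rewrite !mulr_sumr -!big_split /=.
    rewrite big_nat_cond [RHS]big_nat_cond; apply: eq_bigr => n.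
    rewrite andbT ltnS => /andP[n1 nm]; apply: eqn.
    by rewrite n1 (leq_trans nm).
  (* Positivity of the convolution is stated for sums starting at [n = 0]; the additional term is 0
     because [v 0 = 0]. *)
  have H1 : 0 <= theta * \sum_(1 <= n < m.+1) \sum_(0 <= p < n.+1) chi p * L (v (n - p)%N) (v n).
    apply: mulr_ge0 => //; have := chip m.+1.
    by rewrite big_nat_recl// big_nat1 v0 (psd_form0 Lp) mulr0 add0r big_add1.
  have H2 : 0 <= kappa * (\sum_(1 <= n < m.+1) D (u n - u n.-1) (v n)).
    rewrite (tele D Dp); apply: mulr_ge0 => //.
    by apply: mulr_ge0; rewrite ?invr_ge0// (psd_form_ge0 Dp).
  have H3 : - \sum_(1 <= n < m.+1) \sum_(1 <= k < n) w (n - k)%N / tau * A (u k - u k.-1) (v n)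
      + \sum_(1 <= n < m.+1) A (F n) (v n)
      <= M m * \sum_(1 <= n < m.+1) (W * M n.-1 + seminorm A (F n)).
    rewrite -sumrN -big_split mulr_sumr /= big_nat_cond [leRHS]big_nat_cond.
    apply: ler_sum => n; rewrite andbT ltnS => /andP[n1 nm].
    rewrite mulrDr; apply: lerD.
      rewrite (le_trans (ler_norm _))// normrN (le_trans (mem n _))//.
        by rewrite n1 (leq_trans nm).
      by rewrite mulrC ler_wpM2r ?mulr_ge0// Mle.
    rewrite (le_trans (ler_norm _))// (le_trans (psd_form_cauchy Ap _ _))//.
    rewrite mulrC ler_wpM2r ?seminorm_ge0// (le_trans (vM n _))// Mle//.
  by lra.
have S0 : 0 <= S by apply: sumr_ge0 => n _; rewrite mulr_ge0 ?seminorm_ge0// ltW.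
pose q := 1 + 4 * W * tau.
have q1 : 1 <= q by rewrite lerDl !mulr_ge0// ltW.
(* [G] solves with equality the recursion that [M] satisfies as an inequality, namely [G m = 4 S + 4
   W tau * (G 0 + ... + G m.-1)]. *)
pose G n := 4 * S * q ^+ n.
have GS n : G n <= G n.+1.
  by rewrite /G exprS mulrCA ler_peMl// !mulr_ge0// exprn_ge0// (le_trans _ q1).
have sumG m : 4 * W * tau * (\sum_(1 <= n < m.+1) G n.-1) = G m - 4 * S.
  elim: m => [|m IH]; first by rewrite big_geq// /G expr0; ring.
  by rewrite big_nat_recr//= mulrDr IH /G exprS /q; ring.
suff MG : forall m, (m <= N)%N -> M m <= G m.
  by apply: le_trans (nuM N) _; exact: MG.
move=> m; have [n] := ubnP m; elim: n m => // n IH m /ltnSE mn mN.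
case: m mn mN => [|m] mn mN; first by rewrite /= /G !mulr_ge0.
have Mm : M m <= G m by apply: IH => //; exact: ltnW.
(* If level [m.+1] sets no new maximum, the bound is inherited. Otherwise [M m.+1 = nu m.+1], and
   one factor cancels in the energy inequality. *)
have [lt|ge] := ltP (M m) (nu m.+1); last first.
  by rewrite /= (max_l ge) (le_trans Mm).
have Mnu : M m.+1 = nu m.+1 by rewrite /= (max_r (ltW lt)).
have nup : 0 < nu m.+1 by apply: le_lt_trans lt.
have := energy m.+1 mN; rewrite Mnu expr2 mulrCA ler_pM2l// => H.
(* The factor 4 comes from [c0 >= 1 / 2], which gives [c0 / tau / 2 >= 1 / (4 tau)]. *)
have H' : nu m.+1 <= 4 * tau * \sum_(1 <= n0 < m.+2) (W * M n0.-1 + seminorm A (F n0)).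
  have K : nu m.+1 / (4 * tau) <= c0 / tau / 2 * nu m.+1.
    rewrite mulrC ler_wpM2r ?(ltW nup)// invfM.
    have ti : 0 <= tau^-1 by rewrite invr_ge0 ltW.
    have h := ler_wpM2r ti c0p.
    by lra.
  by have := le_trans K H; rewrite ler_pdivrMr ?mulr_gt0// [leRHS]mulrC.
apply: le_trans H' _; rewrite big_split /= mulrDr.
have -> : G m.+1 = 4 * tau * (W * \sum_(1 <= n0 < m.+2) G n0.-1) + 4 * S.
  by have := sumG m.+1; lra.
apply: lerD.
  rewrite ler_wpM2l ?(mulr_ge0 _ (ltW tau0))// -mulr_sumr ler_wpM2l//.
  rewrite big_nat_cond [leRHS]big_nat_cond; apply: ler_sum => k.
  rewrite andbT => /andP[k1 km]; apply: IH.
    by rewrite prednK//; apply: leq_trans mn.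
  by rewrite (leq_trans (leq_pred k))// (leq_trans _ mN).
rewrite -mulrA ler_wpM2l// /S mulr_sumr (big_cat_nat _ _ (n := m.+2) (p := N.+1))//=.
by rewrite lerDl sumr_ge0// => n0 _; rewrite mulr_ge0 ?seminorm_ge0// ltW.
Qed.

(** * The forms of the compact difference operators *)

Lemma psd_form_add (R : realType) (V : lmodType R) (B B' : V -> V -> R) :
  psd_form B -> psd_form B' -> psd_form (fun u v => B u v + B' u v).
Proof.
move=> Bp Bp'; split=> [c u u' v|u v|u]; last by rewrite addr_ge0// psd_form_ge0.
- by rewrite !(psd_formD Bp) !(psd_formD Bp') !(psd_formZ Bp) !(psd_formZ Bp'); ring.
- by rewrite (psd_formC Bp) (psd_formC Bp').
Qed.

Lemma psd_form_scale (R : realType) (V : lmodType R) (c : R) (B : V -> V -> R) :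
  0 <= c -> psd_form B -> psd_form (fun u v => c * B u v).
Proof.
move=> c0 Bp; split=> [d u u' v|u v|u]; last by rewrite mulr_ge0// psd_form_ge0.
- by rewrite (psd_formD Bp) (psd_formZ Bp); ring.
- by rewrite (psd_formC Bp).
Qed.

(** The operator [a E + b] with [E] the shift; [stencil1] is its composition with the transpose. All
    difference operators are built from three cases: [stencil1 0 1] is the identity,
    [stencil1 1 (-1)] is [- h ^+ 2] times the second difference quotient, and [8 + stencil1 1 1] is
    12 times the compact average. Working with the factors makes symmetry and semidefiniteness
    evident. *)
Definition step1 (R : realType) (a b : R) (u : nat -> R) (i : nat) : R :=
  a * u i.+1 + b * u i.

Definition stencil1 (R : realType) (a b : R) (u : nat -> R) (i : nat) : R :=
  (a ^+ 2 + b ^+ 2) * u i + a * b * (u i.-1 + u i.+1).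

(** Only the test function [v] has to vanish at the ends, so [u] can also be a source term. *)
Lemma step1_by_parts (R : realType) (a b : R) (u v : nat -> R) M :
  v 0%N = 0 -> v M = 0 ->
  \sum_(0 <= i < M) step1 a b u i * step1 a b v i
  = \sum_(1 <= i < M) stencil1 a b u i * v i.
Proof.
move=> v0 vM; case: M vM => [|M] vM; first by rewrite !big_geq.
have -> : \sum_(0 <= i < M.+1) step1 a b u i * step1 a b v i
    = \sum_(0 <= i < M.+1) (a ^+ 2 * u i.+1 + a * b * u i) * v i.+1
      + \sum_(0 <= i < M.+1) (b ^+ 2 * u i + a * b * u i.+1) * v i.
  by rewrite -big_split /=; apply: eq_bigr => i _; rewrite /step1; ring.
rewrite big_nat_recr//= vM mulr0 addr0 [X in _ + X]big_nat_recl//= v0 mulr0 add0r.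
rewrite -big_split [in RHS]big_add1 /=; apply: eq_bigr => i _.
by rewrite /stencil1 /=; ring.
Qed.

(** The square of a sum is at most twice the sum of the squares, and shifting the index preserves
    the sum of squares because both end values are 0. *)
Lemma step1_sqr_le (R : realType) (u : nat -> R) M : u 0%N = 0 -> u M = 0 ->
  \sum_(0 <= i < M) step1 1 1 u i ^+ 2 <= 4 * (\sum_(0 <= i < M) u i ^+ 2).
Proof.
move=> u0 uM.
have E : \sum_(0 <= i < M) u i.+1 ^+ 2 = \sum_(0 <= i < M) u i ^+ 2.
  case: M uM => [|M] uM; first by rewrite !big_geq.
  rewrite big_nat_recr//= uM [in RHS]big_nat_recl//= u0.
  by rewrite expr0n /= addr0 add0r.
rewrite (_ : 4 * _ = 2 * (\sum_(0 <= i < M) u i.+1 ^+ 2) + 2 * (\sum_(0 <= i < M) u i ^+ 2)).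
  rewrite !mulr_sumr -big_split /=; apply: ler_sum => i _.
  rewrite -subr_ge0 (_ : _ - _ = (u i.+1 - u i) ^+ 2) ?sqr_ge0//.
  by rewrite /step1; ring.
by rewrite E; ring.
Qed.

Definition step2 (R : realType) (a b c d : R) (u : nat -> nat -> R) (i j : nat) : R :=
  a * (c * u i.+1 j.+1 + d * u i.+1 j) + b * (c * u i j.+1 + d * u i j).

(** The codomain [R^o] turns grid functions into a module over [R]; only values at grid nodes
    enter. *)
Definition step_form (R : realType) (M1 M2 : nat) (a b c d : R)
    (u v : nat -> nat -> R^o) : R :=
  \sum_(0 <= i < M1) \sum_(0 <= j < M2) step2 a b c d u i j * step2 a b c d v i j.

Lemma step_form_psd (R : realType) M1 M2 (a b c d : R) :
  psd_form (@step_form R M1 M2 a b c d).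
Proof.
split=> [k u u' v|u v|u].
- rewrite mulr_sumr -big_split; apply: eq_bigr => i _ /=.
  rewrite mulr_sumr -big_split; apply: eq_bigr => j _ /=.
  have fE p q : (k *: u + u') p q = k * (u p q : R) + (u' p q : R) :> R by [].
  by rewrite /step2 !fE; ring.
- by apply: eq_bigr => i _; apply: eq_bigr => j _; rewrite mulrC.
- by apply: sumr_ge0 => i _; apply: sumr_ge0 => j _; rewrite -expr2 sqr_ge0.
Qed.

Definition stencil2 (R : realType) (a b c d : R) (u : nat -> nat -> R) (i j : nat) : R :=
  stencil1 c d (fun j => stencil1 a b (fun i => u i j) i) j.

Definition zero_boundary (R : realType) (M1 M2 : nat) (v : nat -> nat -> R) : Prop :=
  forall i j, boundary_node M1 M2 i j -> v i j = 0.

Lemma zero_boundaryP (R : realType) (M1 M2 : nat) (v : nat -> nat -> R) :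
  zero_boundary M1 M2 v ->
  [/\ forall j, (j <= M2)%N -> v 0%N j = 0, forall j, (j <= M2)%N -> v M1 j = 0,
      forall i, (i <= M1)%N -> v i 0%N = 0 & forall i, (i <= M1)%N -> v i M2 = 0].
Proof.
move=> h; split=> k kM; apply: h;
  by rewrite /boundary_node /interior_node ?kM ?leqnn ?ltnn ?leq0n ?andbF.
Qed.

Lemma step_form_by_parts (R : realType) M1 M2 (a b c d : R) (u v : nat -> nat -> R) :
  zero_boundary M1 M2 v ->
  step_form M1 M2 a b c d u v
  = \sum_(1 <= i < M1) \sum_(1 <= j < M2) stencil2 a b c d u i j * v i j.
Proof.
move=> /zero_boundaryP[v1 v2 v3 v4]; rewrite /step_form exchange_big /=.
pose y (u : nat -> nat -> R) i j := c * u i j.+1 + d * u i j.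
transitivity (\sum_(0 <= j < M2) \sum_(1 <= i < M1)
    stencil1 a b (fun i => y u i j) i * y v i j).
  rewrite big_nat_cond [RHS]big_nat_cond; apply: eq_bigr => j; rewrite andbT => /andP[_ jM].
  rewrite -step1_by_parts /y ?v1 ?v2 ?mulr0 ?addr0//; exact: ltnW.
rewrite exchange_big big_nat_cond [RHS]big_nat_cond; apply: eq_bigr => i.
rewrite andbT => /andP[i1 iM] /=.
rewrite /stencil2 -step1_by_parts ?v3 ?v4 ?(ltnW iM)//; apply: eq_bigr => j _.
by rewrite /step1 /y /stencil1; ring.
Qed.

Definition interior_sum (R : realType) (M1 M2 : nat) (u v : nat -> nat -> R) : R :=
  \sum_(1 <= i < M1) \sum_(1 <= j < M2) u i j * v i j.

Lemma eq_interior_sum (R : realType) (M1 M2 : nat) (u u' v : nat -> nat -> R) :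
  (forall i j, interior_node M1 M2 i j -> u i j = u' i j) ->
  interior_sum M1 M2 u v = interior_sum M1 M2 u' v.
Proof.
move=> uu; rewrite /interior_sum big_nat_cond [RHS]big_nat_cond.
apply: eq_bigr => i /andP[iM _]; rewrite big_nat_cond [RHS]big_nat_cond.
by apply: eq_bigr => j /andP[jM _]; rewrite uu// /interior_node iM.
Qed.

Lemma interior_sumD (R : realType) (M1 M2 : nat) (c : R) (u u' v : nat -> nat -> R) :
  interior_sum M1 M2 (fun i j => c * u i j + u' i j) v
  = c * interior_sum M1 M2 u v + interior_sum M1 M2 u' v.
Proof.
rewrite /interior_sum mulr_sumr -big_split; apply: eq_bigr => i _ /=.
by rewrite mulr_sumr -big_split; apply: eq_bigr => j _ /=; ring.
Qed.

(** The tensor square of [(8 + stencil1 1 1) / 12], whence the weights 64, 8, 8, 1 over 144. In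
    [stiff_form] one direction carries this average and the other the negated second difference; in
    [mixed_form] both carry a second difference and the two signs cancel. *)
Definition mass_form (R : realType) (M1 M2 : nat) (u v : nat -> nat -> R^o) : R :=
  144^-1 * (64 * step_form M1 M2 0 1 0 1 u v + 8 * step_form M1 M2 1 1 0 1 u v
    + 8 * step_form M1 M2 0 1 1 1 u v + step_form M1 M2 1 1 1 1 u v).

Definition stiff_form (R : realType) (h1 h2 : R) (M1 M2 : nat)
    (u v : nat -> nat -> R^o) : R :=
  (12 * h1 ^+ 2)^-1 * (8 * step_form M1 M2 1 (-1) 0 1 u v + step_form M1 M2 1 (-1) 1 1 u v)
  + (12 * h2 ^+ 2)^-1 * (8 * step_form M1 M2 0 1 1 (-1) u v + step_form M1 M2 1 1 1 (-1) u v).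

Definition mixed_form (R : realType) (h1 h2 : R) (M1 M2 : nat)
    (u v : nat -> nat -> R^o) : R :=
  (h1 ^+ 2 * h2 ^+ 2)^-1 * step_form M1 M2 1 (-1) 1 (-1) u v.

Lemma mass_form_psd (R : realType) M1 M2 : psd_form (@mass_form R M1 M2).
Proof.
apply: psd_form_scale; first by rewrite invr_ge0.
by do ?[apply: psd_form_add|apply: psd_form_scale|exact: step_form_psd].
Qed.

Lemma stiff_form_psd (R : realType) (h1 h2 : R) M1 M2 :
  psd_form (@stiff_form R h1 h2 M1 M2).
Proof.
have h0 (h : R) : 0 <= (12 * h ^+ 2)^-1 by rewrite invr_ge0 mulr_ge0 ?sqr_ge0.
by do ?[apply: psd_form_add|apply: psd_form_scale|exact: step_form_psd].
Qed.

Lemma mixed_form_psd (R : realType) (h1 h2 : R) M1 M2 :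
  psd_form (@mixed_form R h1 h2 M1 M2).
Proof.
apply: psd_form_scale; last exact: step_form_psd.
by rewrite invr_ge0 mulr_ge0 ?sqr_ge0.
Qed.

Lemma mass_formE (R : realType) M1 M2 (u v : nat -> nat -> R) :
  zero_boundary M1 M2 v -> mass_form M1 M2 u v = interior_sum M1 M2 (Ah M1 M2 u) v.
Proof.
move=> vb; rewrite /mass_form !step_form_by_parts// !mulr_sumr -!big_split mulr_sumr /=.
rewrite /interior_sum big_nat_cond [RHS]big_nat_cond.
apply: eq_bigr => i /andP[iM _]; rewrite !mulr_sumr -!big_split mulr_sumr /=.
rewrite big_nat_cond [RHS]big_nat_cond; apply: eq_bigr => j /andP[jM _].
by rewrite /Ah /A1 /A2 iM jM /stencil2 /stencil1; field.
Qed.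

Lemma stiff_formE (R : realType) (h1 h2 : R) M1 M2 (u v : nat -> nat -> R) :
  h1 != 0 -> h2 != 0 -> zero_boundary M1 M2 v ->
  stiff_form h1 h2 M1 M2 u v = - interior_sum M1 M2 (Lambdah h1 h2 M1 M2 u) v.
Proof.
move=> h10 h20 vb; rewrite /stiff_form !step_form_by_parts// !mulr_sumr -!big_split !mulr_sumr /=.
rewrite -!big_split /= /interior_sum -sumrN big_nat_cond [RHS]big_nat_cond.
apply: eq_bigr => i /andP[iM _]; rewrite !mulr_sumr -!big_split !mulr_sumr -!big_split -sumrN /=.
rewrite big_nat_cond [RHS]big_nat_cond; apply: eq_bigr => j /andP[jM _].
rewrite /Lambdah /A1 /A2 iM jM /delta_x2 /delta_y2 /stencil2 /stencil1; by field; rewrite h10 h20.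
Qed.

Lemma mixed_formE (R : realType) (h1 h2 : R) M1 M2 (u v : nat -> nat -> R) :
  h1 != 0 -> h2 != 0 -> zero_boundary M1 M2 v ->
  mixed_form h1 h2 M1 M2 u v = interior_sum M1 M2 (delta_x2 h1 (delta_y2 h2 u)) v.
Proof.
move=> h10 h20 vb; rewrite /mixed_form !step_form_by_parts// !mulr_sumr /=.
apply: eq_bigr => i _; rewrite mulr_sumr; apply: eq_bigr => j _.
rewrite /delta_x2 /delta_y2 /stencil2 /stencil1; by field; rewrite h10 h20.
Qed.

Lemma grid_normE (R : realType) (h1 h2 : R) M1 M2 (u : nat -> nat -> R) :
  grid_norm h1 h2 M1 M2 u = Num.sqrt (h1 * h2 * interior_sum M1 M2 u u).
Proof.
rewrite /grid_norm /interior_sum; congr (Num.sqrt (_ * _)).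
by apply: eq_bigr => i _; apply: eq_bigr => j _; rewrite real_normK ?num_real.
Qed.

(** Dropping the three nonnegative forms with a factor [step1 1 1] leaves 64 / 144 = 4 / 9.
    Conversely each such factor costs at most 4, and 64 + 32 + 32 + 16 = 144. *)
Lemma interior_sum_mass (R : realType) M1 M2 (u : nat -> nat -> R) :
  zero_boundary M1 M2 u ->
  4 * interior_sum M1 M2 u u <= 9 * mass_form M1 M2 u u
  /\ mass_form M1 M2 u u <= interior_sum M1 M2 u u.
Proof.
move=> ub; have [u1 u2 u3 u4] := zero_boundaryP ub.
have E : step_form M1 M2 0 1 0 1 u u = interior_sum M1 M2 u u.
  rewrite step_form_by_parts//; apply: eq_bigr => i _; apply: eq_bigr => j _.
  by rewrite /stencil2 /stencil1; ring.
have S0 (a b c d : R) : 0 <= step_form M1 M2 a b c d u u.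
  exact: (psd_form_ge0 (step_form_psd _ _ _ _ _ _)).
have X (c d : R) : step_form M1 M2 1 1 c d u u <= 4 * step_form M1 M2 0 1 c d u u.
  rewrite /step_form exchange_big [X in _ <= 4 * X]exchange_big mulr_sumr /=.
  rewrite big_nat_cond [leRHS]big_nat_cond; apply: ler_sum => j /andP[/andP[_ jM] _].
  have := @step1_sqr_le _ (fun i => c * u i j.+1 + d * u i j) M1.
  rewrite !u1 ?(ltnW jM)// !u2 ?(ltnW jM)// !mulr0 addr0 => /(_ erefl erefl).
  have e (x y : R) : x = y -> x <= y by move->.
  move=> H; apply: le_trans (le_trans _ H) _.
    by apply: e; apply: eq_bigr => i _; rewrite /step1 /step2; ring.
  by apply: e; congr (_ * _); apply: eq_bigr => i _; rewrite /step2; ring.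
have Y : step_form M1 M2 0 1 1 1 u u <= 4 * step_form M1 M2 0 1 0 1 u u.
  rewrite /step_form mulr_sumr /=.
  rewrite big_nat_cond [leRHS]big_nat_cond; apply: ler_sum => i /andP[/andP[_ iM] _].
  have := @step1_sqr_le _ (u i) M2.
  rewrite !u3 ?(ltnW iM)// !u4 ?(ltnW iM)// => /(_ erefl erefl).
  have e (x y : R) : x = y -> x <= y by move->.
  move=> H; apply: le_trans (le_trans _ H) _.
    by apply: e; apply: eq_bigr => j _; rewrite /step1 /step2; ring.
  by apply: e; congr (_ * _); apply: eq_bigr => j _; rewrite /step2; ring.
rewrite /mass_form -E; have := X 0 1; have := X 1 1.
have := S0 1 1 0 1; have := S0 0 1 1 1; have := S0 1 1 1 1; split; lra.
Qed.

(** * The scheme as an identity between forms *)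

Definition eq_on_grid (R : realType) (M1 M2 : nat) (u u' : nat -> nat -> R) : Prop :=
  forall i j, (i <= M1)%N -> (j <= M2)%N -> u i j = u' i j.

(** The scheme does not constrain [U] off the grid, and at interior nodes the stencils never look
    there. Hence [U] may be replaced by a sequence whose level 0 is the zero function, as
    [energy_bound] requires. *)
Lemma eq_on_grid_stencils (R : realType) (h1 h2 : R) (M1 M2 : nat)
    (u u' : nat -> nat -> R) i j :
  eq_on_grid M1 M2 u u' -> interior_node M1 M2 i j ->
  [/\ Ah M1 M2 u i j = Ah M1 M2 u' i j,
      Lambdah h1 h2 M1 M2 u i j = Lambdah h1 h2 M1 M2 u' i j &
      delta_x2 h1 (delta_y2 h2 u) i j = delta_x2 h1 (delta_y2 h2 u') i j].
Proof.
move=> uu /andP[iM jM]; have /andP[_ i2] := iM; have /andP[_ j2] := jM.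
have [i1 j1] : (i <= M1)%N /\ (j <= M2)%N by split; exact: ltnW.
have [i0 j0] : (i.-1 <= M1)%N /\ (j.-1 <= M2)%N.
  by split; exact: leq_trans (leq_pred _) _.
by split; rewrite /Ah /Lambdah /A1 /A2 ?iM ?jM /delta_x2 /delta_y2 !uu.
Qed.

Lemma interior_sum_adi (R : realType) (M1 M2 : nat) (v : nat -> nat -> R)
    (a c r d : R) (b chi : nat -> R) (m n : nat)
    (f1 f4 f5 : nat -> nat -> R) (f2 f3 : nat -> nat -> nat -> R) :
  interior_sum M1 M2 (fun i j => a * f1 i j + \sum_(1 <= k < m) b k * f2 k i j
    - c * (\sum_(0 <= p < n) chi p * f3 p i j + r * f4 i j) + d * f5 i j) v
  = a * interior_sum M1 M2 f1 v + \sum_(1 <= k < m) b k * interior_sum M1 M2 (f2 k) v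
    - c * (\sum_(0 <= p < n) chi p * interior_sum M1 M2 (f3 p) v
           + r * interior_sum M1 M2 f4 v) + d * interior_sum M1 M2 f5 v.
Proof.
have S (s : seq nat) (e : nat -> R) (f : nat -> nat -> nat -> R) :
    interior_sum M1 M2 (fun i j => \sum_(k <- s) e k * f k i j) v
    = \sum_(k <- s) e k * interior_sum M1 M2 (f k) v.
  elim: s => [|k s IH].
    rewrite big_nil /interior_sum; apply: big1 => i _; apply: big1 => j _.
    by rewrite big_nil mul0r.
  rewrite big_cons -IH -interior_sumD; apply: eq_interior_sum => i j _.
  by rewrite big_cons.
rewrite -!S addrC -interior_sumD; transitivity (interior_sum M1 M2 (fun i j => d * f5 i j +
  (a * f1 i j + ((- c) * (r * f4 i j + \sum_(0 <= p < n) chi p * f3 p i j) +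
   \sum_(1 <= k < m) b k * f2 k i j))) v).
  by apply: eq_interior_sum => i j _; ring.
rewrite !interior_sumD; ring.
Qed.

(** [energy_bound] for the mass, stiffness and mixed forms; the splitting coefficient is divided by
    [tau] once more on account of [delta_t]. The constant 6 is 4 times the factor 3 / 2 by which the
    discrete norm exceeds the mass seminorm. *)
Lemma adi_stability (R : realType) (alpha : R -> R) (chi : nat -> R)
    (tau h1 h2 W : R) (N M1 M2 : nat) (F U : nat -> nat -> nat -> R) :
  0 < tau -> 0 < h1 -> 0 < h2 -> (0 < N)%N -> 0 <= W ->
  2^-1 <= c0coef alpha tau ->
  (forall (V : lmodType R) (B : V -> V -> R) (v : nat -> V) m, psd_form B ->
     0 <= \sum_(0 <= n < m) \sum_(0 <= p < n.+1) chi p * B (v (n - p)%N) (v n)) ->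
  ((1 < N)%N -> `|wtilde alpha tau 1|
    + \sum_(1 <= j < N.-1) `|wtilde alpha tau j.+1 - wtilde alpha tau j| <= W * tau) ->
  (forall n, (1 <= n <= N)%N -> zero_boundary M1 M2 (thalf F n)) ->
  adi_solution alpha chi tau h1 h2 N M1 M2 F U ->
  grid_norm h1 h2 M1 M2 (U N)
    <= 6 * (1 + 4 * W * tau) ^+ N
       * (\sum_(1 <= n < N.+1) tau * grid_norm h1 h2 M1 M2 (thalf F n)).
Proof.
move=> tau0 h10 h20 N0 W0 c0p chip wW Fb [eqn U0 Ub].
have h1n : h1 != 0 by rewrite gt_eqF.
have h2n : h2 != 0 by rewrite gt_eqF.
have h12 : 0 <= h1 * h2 by rewrite mulr_ge0 ?ltW.
pose u (n : nat) : nat -> nat -> R^o := if n is 0%N then 0 else U n.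
pose v n : nat -> nat -> R^o := 2^-1 *: (u n + u n.-1).
have uE n : (n <= N)%N -> eq_on_grid M1 M2 (U n) (u n).
  case: n => [|n] nN i j iM jM //; rewrite /u.
  have [ij|ij] := boolP (interior_node M1 M2 i j); first by rewrite U0.
  by rewrite Ub// /boundary_node iM jM.
have ub n : (n <= N)%N -> zero_boundary M1 M2 (u n).
  move=> nN i j ij; have /and3P[iM jM _] := ij.
  by rewrite -uE// Ub.
have vE n i j : v n i j = (u n i j + u n.-1 i j) / 2 :> R.
  by rewrite mulrC.
have vb n : (n <= N)%N -> zero_boundary M1 M2 (v n).
  move=> nN i j ij; rewrite vE !ub ?addr0 ?mul0r//.
  exact: leq_trans (leq_pred _) nN.
(* At level 0 the two conventions, value 0 at level -1 and [0.-1 = 0], agree because the initial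
   value vanishes. *)
have thalfE n : (n <= N)%N -> eq_on_grid M1 M2 (thalf U n) (v n).
  move=> nN i j iM jM; rewrite vE /thalf uE//; congr (_ / _); congr (_ + _).
  by case: n nN => [|n] nN //; rewrite uE// ltnW.
have main := @energy_bound R (nat -> nat -> R^o) (@mass_form R M1 M2)
  (@stiff_form R h1 h2 M1 M2) (@mixed_form R h1 h2 M1 M2)
  (mass_form_psd _ M1 M2) (stiff_form_psd h1 h2 M1 M2) (mixed_form_psd h1 h2 M1 M2)
  N tau (c0coef alpha tau) (tau `^ (alpha 0 - 1))
  ((tau `^ (alpha 0 - 1 + 1) * chi 0%N) ^+ 2 / (4 * c0coef alpha tau) / tau)
  W (wtilde alpha tau) chi u (thalf F) tau0 c0p (powR_ge0 _ _).
have {}main : seminorm (@mass_form R M1 M2) (u N)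
  <= 4 * (\sum_(1 <= n < N.+1) tau * seminorm (@mass_form R M1 M2) (thalf F n))
     * (1 + 4 * W * tau) ^+ N.
  apply: main => //.
  - have c0g : 0 < c0coef alpha tau by apply: lt_le_trans c0p; rewrite invr_gt0.
    apply: divr_ge0 (ltW tau0); apply: divr_ge0; first exact: sqr_ge0.
    by rewrite mulr_ge0// ltW.
  - by move=> m; apply: chip; exact: stiff_form_psd.
  move=> n /andP[n1 nN]; rewrite -!/(v _).
  have vbn := vb n nN.
  have H : interior_sum M1 M2 (Ah M1 M2 (thalf F n)) (v n) = mass_form M1 M2 (thalf F n) (v n).
    by rewrite mass_formE.
  rewrite -H; rewrite -(@eq_interior_sum _ _ _ _ _ (v n) (fun i j ij => eqn n i j _ ij)); last first.
    by rewrite n1.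
  rewrite /adi_equation interior_sum_adi.
  have dA k : (0 < k <= n)%N -> interior_sum M1 M2 (fun i j => delta_t tau
      (fun m => Ah M1 M2 (U m)) k i j) (v n)
      = tau^-1 * mass_form M1 M2 (u k - u k.-1) (v n).
    move=> /andP[k1 kn]; rewrite (psd_formB (mass_form_psd _ _ _)) !mass_formE// mulrBr.
    have kN := leq_trans kn nN; have kN' := leq_trans (leq_pred k) kN.
    rewrite -mulNr; transitivity (interior_sum M1 M2 (fun i j =>
      tau^-1 * Ah M1 M2 (u k) i j + ((- tau^-1) * Ah M1 M2 (u k.-1) i j + 0)) (v n)).
      apply: eq_interior_sum => i j ij; rewrite /delta_t.
      have [-> _ _] := eq_on_grid_stencils h1 h2 (uE k kN) ij.
      by have [-> _ _] := eq_on_grid_stencils h1 h2 (uE k.-1 kN') ij; ring.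
    rewrite !interior_sumD {3}/interior_sum; congr (_ + _).
    rewrite [X in _ + X]big1 ?addr0// => i _; rewrite big1// => j _.
    by rewrite mul0r.
  congr (_ + _); first congr (_ + _).
  - rewrite dA ?n1 ?leqnn// -mulrA; congr (_ + _).
    rewrite big_nat_cond [RHS]big_nat_cond; apply: eq_bigr => k.
    rewrite andbT => /andP[k1 kn]; rewrite dA ?mulrA// k1; exact: ltnW.
  (* The correction with [rhohat_coef] acts on the initial value, which is 0 on the grid. *)
  - rewrite [X in _ + _ * X](_ : _ = 0) ?mulr0 ?addr0; last first.
      apply: big1_seq => i; rewrite mem_index_iota => /andP[_ iM].
      apply: big1_seq => j; rewrite mem_index_iota => /andP[_ jM].
      have ij : interior_node M1 M2 i j by rewrite /interior_node iM.
      have z : eq_on_grid M1 M2 (U 0%N) (fun _ _ => 0) by exact: uE.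
      have [_ -> _] := eq_on_grid_stencils h1 h2 z ij.
      by rewrite /Lambdah /A1 /A2 iM jM /delta_x2 /delta_y2; ring.
    rewrite -mulrN -sumrN; congr (_ * _); apply: eq_bigr => p _.
    rewrite -mulrN stiff_formE//; congr (_ * - _); apply: eq_interior_sum => i j ij.
    have pN : (n - p <= N)%N by rewrite (leq_trans (leq_subr _ _)).
    by have [_ -> _] := eq_on_grid_stencils h1 h2 (thalfE _ pN) ij.
  - rewrite -mulrA; congr (_ * _); rewrite -(psd_formZ (mixed_form_psd _ _ _ _)).
    rewrite mixed_formE//; apply: eq_interior_sum => i j ij.
    have e : eq_on_grid M1 M2 (delta_t tau U n) (tau^-1 *: (u n - u n.-1)).
      move=> i' j' iM jM; rewrite /delta_t mulrC.
      rewrite (uE n nN i' j' iM jM) (uE n.-1 _ i' j' iM jM)//.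
      exact: leq_trans (leq_pred _) nN.
    by have [_ _ ->] := eq_on_grid_stencils h1 h2 e ij.
have [UA _] := interior_sum_mass (ub N (leqnn _)).
have -> : grid_norm h1 h2 M1 M2 (U N) = Num.sqrt (h1 * h2) * Num.sqrt (interior_sum M1 M2 (u N) (u N)).
  by rewrite grid_normE sqrtrM// /u; case: (N) N0.
apply: (@le_trans _ _ (Num.sqrt (h1 * h2) * (3 / 2 * seminorm (@mass_form R M1 M2) (u N)))).
  rewrite ler_wpM2l ?sqrtr_ge0//.
  have -> : 3 / 2 = Num.sqrt ((3 / 2) ^+ 2 : R) by rewrite sqrtr_sqr ger0_norm.
  rewrite -sqrtrM ?sqr_ge0// ler_wsqrtr//; lra.
have q0 : 0 <= (1 + 4 * W * tau) ^+ N by rewrite exprn_ge0// addr_ge0// !mulr_ge0// ltW.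
have H : Num.sqrt (h1 * h2) * (\sum_(1 <= n < N.+1) tau * seminorm (@mass_form R M1 M2) (thalf F n))
   <= \sum_(1 <= n < N.+1) tau * grid_norm h1 h2 M1 M2 (thalf F n).
  rewrite mulr_sumr big_nat_cond [leRHS]big_nat_cond; apply: ler_sum => n.
  rewrite andbT => /andP[n1 nN].
  rewrite mulrCA ler_wpM2l ?(ltW tau0)// grid_normE (sqrtrM _ h12) ler_wpM2l ?sqrtr_ge0//.
  apply: ler_wsqrtr.
  have nn : (1 <= n <= N)%N by rewrite n1.
  (* The boundary condition on the averaged source enters here: the mass form is at most the
     interior sum for functions that vanish on the boundary. *)
  by have [] := interior_sum_mass (Fb n nn).
apply: (@le_trans _ _ (6 * (1 + 4 * W * tau) ^+ N * (Num.sqrt (h1 * h2) *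
   (\sum_(1 <= n < N.+1) tau * seminorm (@mass_form R M1 M2) (thalf F n))))); last first.
  by rewrite ler_wpM2l ?mulr_ge0.
set s := Num.sqrt _; set q := _ ^+ _; set S := \sum_(_ <= _ < _) _ in main H *.
rewrite [leRHS](_ : _ = s * (3 / 2 * (4 * S * q))); last by field.
by rewrite ler_wpM2l ?sqrtr_ge0// ler_wpM2l.
Qed.

(** * Substitution and the Gamma integrals *)

(** The integrands may be singular at the end points and the image may be unbounded, so the rule for
    compact intervals is applied on an exhaustion of []a, b[], and monotone convergence is used on
    both sides. *)
Lemma ge0_substitution_oo (R : realType) (F f G : R -> R) (a b : R) (J : set R) :
  a < b -> is_interval J ->
  {in `]a, b[ &, {homo F : x y / x < y}} ->
  {in `]a, b[, forall x : R, is_derive x (1 : R) F (f x)} ->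
  {in `]a, b[, continuous f} ->
  {in `]a, b[, forall x, J (F x)} ->
  (forall y, J y -> exists2 x, x \in `]a, b[ & F x = y) ->
  (forall y, J y -> {for y, continuous G}) ->
  (forall y, J y -> 0 <= G y) ->
  (\int[lebesgue_measure]_(y in J) (G y)%:E
   = \int[lebesgue_measure]_(x in `]a, b[) (G (F x) * f x)%:E)%E.
Proof.
move=> ab itvJ incF dF cf FJ JF cG G0.
(* The denominator starts at 3 so that [d n] stays below half the length and every interval of the
   exhaustion is nondegenerate. *)
pose d (n : nat) : R := (b - a) / n.+3%:R.
pose An n := a + d n; pose Bn n := b - d n.
have d0 n : 0 < d n by rewrite divr_gt0// subr_gt0.
have dn n : d n.+1 <= d n.
  by rewrite ler_pM2l ?subr_gt0// lef_pV2 ?posrE// ler_nat.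
have AB n : An n < Bn n.
  have : d n < (b - a) / 2.
    by rewrite ltr_pM2l ?subr_gt0// ltf_pV2 ?posrE// ltr_nat.
  rewrite /An /Bn; lra.
have Ain n x : x \in `[An n, Bn n] -> x \in `]a, b[.
  rewrite !in_itv/= => /andP[Ax xB]; have := d0 n; rewrite /An /Bn in Ax xB; lra.
have inA x : x \in `]a, b[ -> exists n, x \in `[An n, Bn n].
  rewrite in_itv/= => /andP[ax xb].
  have m0 : 0 < Num.min (x - a) (b - x) by rewrite lt_min !subr_gt0 ax.
  set m := Num.min _ _ in m0.
  have q0 : 0 <= (b - a) / m by rewrite divr_ge0 ?subr_ge0// ltW.
  exists (Num.bound ((b - a) / m)).
  have : d (Num.bound ((b - a) / m)) < m.
    rewrite ltr_pdivrMr// -ltr_pdivrMl// mulrC (lt_trans (archi_boundP q0))//.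
    by rewrite ltr_nat ltnS ltnW.
  by rewrite /m lt_min in_itv /= /An /Bn => /andP[? ?]; apply/andP; split; lra.
have nd : nondecreasing_seq (fun n => `[An n, Bn n]%classic).
  apply/nondecreasing_seqP => n; apply/subsetPset => x /=.
  rewrite !in_itv /= /An /Bn => /andP[Ax xB]; have := dn n.
  by move=> ?; apply/andP; split; lra.
have Aab n : An n \in `]a, b[ by apply: (Ain n); rewrite in_itv/= lexx ltW.
have Bab n : Bn n \in `]a, b[ by apply: (Ain n); rewrite in_itv/= lexx ltW.
have leF x y : x \in `]a, b[ -> y \in `]a, b[ -> x <= y -> F x <= F y.
  move=> xab yab; rewrite le_eqVlt => /predU1P[->//|xy].
  by rewrite ltW// incF.
have UA : \bigcup_n `[An n, Bn n]%classic = `]a, b[%classic.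
  apply/seteqP; split=> [x [n _ /= /Ain]//|x /= /inA[n xn]].
  by exists n.
have ndF : nondecreasing_seq (fun n => `[F (An n), F (Bn n)]%classic).
  apply/nondecreasing_seqP => n; apply/subsetPset => x /=.
  rewrite !in_itv /= => /andP[Ax xB]; have := dn n => dnn; apply/andP; split.
    by apply: le_trans Ax; apply: leF => //; rewrite /An; lra.
  by apply: (le_trans xB); apply: leF => //; rewrite /Bn; lra.
have UF : \bigcup_n `[F (An n), F (Bn n)]%classic = J.
  apply/seteqP; split=> [y [n _ /=]|y /JF[x xab <-]].
    rewrite in_itv /= => yn; apply: (itvJ (F (An n)) (F (Bn n))) => //; exact: FJ.
  have [n xn] := inA x xab; exists n => //=.
  have xab' := Ain n x xn; move: xn; rewrite !in_itv /= => /andP[Ax xB].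
  by rewrite !leF.
have mJ : measurable J by exact: is_interval_measurable.
have mG : measurable_fun J G.
  apply: subspace_continuous_measurable_fun => //.
  by apply: continuous_in_subspaceT => y /set_mem; exact: cG.
have cF : {in `]a, b[, continuous F}.
  move=> x xab; apply/differentiable_continuous/derivable1_diffP.
  by case: (dF x xab).
have cGF : {in `]a, b[, continuous (fun x => G (F x) * f x)}.
  move=> x xab; apply: cvgM; last exact: cf.
  by apply: (@continuous_comp _ _ _ F G); [exact: cF|apply: cG; exact: FJ].
have mGF : measurable_fun `]a, b[ (fun x => G (F x) * f x).
  apply: open_continuous_measurable_fun; first exact: interval_open.
  by move=> x /set_mem; exact: cGF.
have f0 : {in `]a, b[, forall x, 0 <= f x}.
  move=> x xab; have dFx := dF x xab.
  have <- : derive1 F x = f x by rewrite derive1E derive_val.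
  apply: (@incr_derive1_ge0 _ F `]a, b[%classic) => //.
  - by move=> y; rewrite interior_itv => /set_mem yab; case: (dF y yab).
  - by move=> y z /set_mem yab /set_mem zab; exact: incF.
  - by rewrite interior_itv.
have closed n : (\int[lebesgue_measure]_(y in `[F (An n), F (Bn n)]) (G y)%:E
   = \int[lebesgue_measure]_(x in `[An n, Bn n]) (G (F x) * f x)%:E)%E.
  have sub x : x \in `]An n, Bn n[ -> x \in `]a, b[.
    by move=> xi; apply: (Ain n); exact: subset_itv_oo_cc xi.
  have e x : x \in `]a, b[ -> derive1 F x = f x.
    by move=> xab; have := dF x xab => ?; rewrite derive1E derive_val.
  have e' x : x \in `]a, b[ -> \forall y \near x, derive1 F y = f y.
    move=> xab; near=> y; apply: e; near: y.
    exact: near_in_itvoo.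
  have cF' x : x \in `]a, b[ -> derive1 F y @[y --> x] --> f x.
    move=> xab; apply: (@cvg_trans _ (f y @[y --> x])); last exact: cf.
    by apply: near_eq_cvg; near do apply/esym; exact: e'.
  rewrite (@integration_by_substitution_increasing R F G (An n) (Bn n)) ?ltW//.
  - apply: eq_integral => x /set_mem /= /Ain xab.
    by rewrite fctE /= e.
  - by move=> x y /Ain xab /Ain yab; exact: incF.
  - by move=> x /sub xab; rewrite /continuous_at e//; exact: cF'.
  - by apply/cvg_ex; exists (f (An n)); apply: cvg_at_right_filter; exact: cF'.
  - by apply/cvg_ex; exists (f (Bn n)); apply: cvg_at_left_filter; exact: cF'.
  - split; first by move=> x /sub xab; case: (dF x xab).
      by apply: cvg_at_right_filter; exact: cF.
    by apply: cvg_at_left_filter; exact: cF.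
  - apply: continuous_in_subspaceT => y /set_mem yn; apply: cG.
    by rewrite -UF; exists n.
have lhs := @ge0_nondecreasing_set_cvg_integral _ (measurableTypeR R) R _ (EFin \o G) lebesgue_measure ndF.
have rhs := @ge0_nondecreasing_set_cvg_integral _ (measurableTypeR R) R _ (EFin \o (fun x => G (F x) * f x)) lebesgue_measure nd.
rewrite UF in lhs; rewrite UA in rhs.
have subJ n : `[F (An n), F (Bn n)]%classic `<=` J.
  by rewrite -UF => y yn; exists n.
have subab n : `[An n, Bn n]%classic `<=` `]a, b[%classic.
  by rewrite -UA => y yn; exists n.
have {}lhs := cvg_lim (@ereal_hausdorff R) (lhs _ _ _).
have {}rhs := cvg_lim (@ereal_hausdorff R) (rhs _ _ _).
rewrite -lhs -?rhs.
- by under eq_fun do rewrite closed.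
- by move=> n; exact: measurable_itv.
- move=> n; apply/measurable_EFinP; exact: (measurable_funS (measurable_itv _) (subab n) mGF).
- by move=> n x /subab xab; rewrite lee_fin mulr_ge0 ?G0 ?f0//; exact: FJ.
- by move=> n; exact: measurable_itv.
- move=> n; apply/measurable_EFinP; exact: (measurable_funS mJ (subJ n) mG).
- by move=> n x /subJ yJ; rewrite lee_fin G0.
Unshelve. all: by end_near. Qed.

Lemma measurable_expRM (R : realType) (D : set R) (c : R) :
  measurable_fun D (fun t : R => expR (c * t)).
Proof.
apply: measurable_funTS; apply: measurableT_comp; first exact: measurable_expR.
exact: measurable_funM.
Qed.

Lemma mule_eq1 (R : realType) (c : R) (x : \bar R) :
  0 < c -> (0 <= x)%E -> (c%:E * x = 1)%E -> x = (c^-1)%:E.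
Proof.
move=> c0; case: x => [r _|_|]//; last by rewrite mulry gtr0_sg// mul1e.
rewrite -EFinM => -[] cr; congr EFin; have cn : c != 0 by rewrite gt_eqF.
by apply: (mulfI cn); rewrite cr divff.
Qed.

Lemma integral_expR_oy (R : realType) (c : R) : 0 < c ->
  (\int[lebesgue_measure]_(t in `]0%R, +oo[) (expR (- c * t))%:E = (c^-1)%:E)%E.
Proof.
move=> c0; have H := integral_exponential_pdf c0.
have E : (\int[lebesgue_measure]_(t in `[0%R, +oo[) (c%:E * (expR (- c * t))%:E) = 1)%E.
  rewrite -[RHS]H integral_mkcond; apply: eq_integral => t _.
  by rewrite /exponential_pdf !patchE; case: ifP.
rewrite integral_itv_obnd_cbnd; last by apply/measurable_EFinP; exact: measurable_expRM.
have m : measurable_fun (`[0%R, +oo[%classic : set R) (fun t : R => (expR (- c * t))%:E).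
  by apply/measurable_EFinP; exact: measurable_expRM.
have {}E : (c%:E * \int[lebesgue_measure]_(t in `[0%R, +oo[) (expR (- c * t))%:E = 1)%E.
  by rewrite -ge0_integralZl_EFin// ltW.
by apply: mule_eq1 E => //; apply: integral_ge0 => t _; rewrite lee_fin expR_ge0.
Qed.

(** The substitution [y = t^(c + 1)] turns the integral of the constant 1 over []0, 1[] into [c + 1]
    times this one. *)
Lemma integral_powR01 (R : realType) (c : R) : -1 < c ->
  (\int[lebesgue_measure]_(t in `]0%R, 1%R[) (t `^ c)%:E = ((c + 1)^-1)%:E)%E.
Proof.
move=> c1; have b0 : 0 < c + 1 by lra.
have bn : c + 1 != 0 by rewrite gt_eqF.
have dP (x : R) : 0 < x -> is_derive x (1 : R) (fun t : R => t `^ (c + 1)) ((c + 1) * x `^ c).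
  move=> x0; apply: is_derive_eq; first exact: is_derive1_powR.
  by rewrite addrK.
have inc (x y : R) : 0 <= x -> 0 <= y -> x < y -> x `^ (c + 1) < y `^ (c + 1).
  by move=> x0 y0; apply: gt0_ltr_powR => //; rewrite nnegrE.
have P1 : (1 : R) `^ (c + 1) = 1 by rewrite powR1.
have cP (x : R) : 0 < x -> {for x, continuous (fun t : R => t `^ c)}.
  move=> x0; apply/differentiable_continuous/derivable1_diffP.
  by have [] := is_derive1_powR c x0.
have E : (\int[lebesgue_measure]_(t in `]0%R, 1%R[) 1%:E =
    \int[lebesgue_measure]_(t in `]0%R, 1%R[) (1 * ((c + 1) * t `^ c))%:E)%E.
  apply: (@ge0_substitution_oo R (fun t => t `^ (c + 1)) _ (cst 1)) => //.
  - exact: interval_is_interval.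
  - move=> x y; rewrite !in_itv/= => /andP[x0 _] /andP[y0 _].
    by apply: inc; exact: ltW.
  - by move=> x; rewrite in_itv/= => /andP[x0 _]; exact: dP.
  - move=> x; rewrite in_itv/= => /andP[x0 _]; apply: cvgM; first exact: cvg_cst.
    exact: cP.
  - move=> x; rewrite /= !in_itv/= => /andP[x0 x1].
    by rewrite powR_gt0//= -[ltRHS]P1 inc// ltW.
  - move=> y; rewrite /= in_itv/= => /andP[y0 y1]; exists (y `^ (c + 1)^-1).
      rewrite in_itv/= powR_gt0//=.
      have P1' : (1 : R) `^ (c + 1)^-1 = 1 by rewrite powR1.
      rewrite -[ltRHS]P1'; apply: gt0_ltr_powR; rewrite ?nnegrE ?invr_gt0//.
      exact: ltW.
    by rewrite -powRrM mulVf// powRr1// ltW.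
  - by move=> y _; exact: cvg_cst.
have m : measurable_fun (`]0%R, 1%R[%classic : set R) (fun t : R => (t `^ c)%:E).
  by apply/measurable_EFinP; apply: measurable_funTS; exact: measurable_powR.
have {}E : ((c + 1)%:E * \int[lebesgue_measure]_(t in `]0%R, 1%R[) (t `^ c)%:E = 1)%E.
  rewrite -ge0_integralZl_EFin//; last 2 first.
  - by move=> t _; rewrite lee_fin powR_ge0.
  - exact: ltW.
  under eq_integral do rewrite -EFinM -[((c + 1) * _)%R]mul1r.
  rewrite -E integral_cst//= lebesgue_measure_itv /= lte_fin ltr01.
  by rewrite oppr0 adde0 mul1e.
apply: (mule_eq1 b0); last exact: E.
by apply: integral_ge0 => t _; rewrite lee_fin powR_ge0.
Qed.

Lemma powR_expR_le (R : realType) (c s : R) : c <= 1 -> 1 <= s ->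
  s `^ c * expR (- s) <= 2 * expR (- 2^-1 * s).
Proof.
move=> c1 s1; have s0 : 0 <= s by lra.
have -> : expR (- s) = expR (- 2^-1 * s) * expR (- 2^-1 * s).
  by rewrite -expRD; congr expR; field.
rewrite mulrA ler_wpM2r ?expR_ge0//.
apply: (@le_trans _ _ (s * expR (- 2^-1 * s))).
  by rewrite ler_wpM2r ?expR_ge0// ler1_powR.
have -> : - 2^-1 * s = - (s / 2) by field.
rewrite expRN ler_pdivrMr ?expR_gt0//; have := expR_ge1Dx (s / 2); lra.
Qed.

Lemma measurable_powR_expR (R : realType) (c : R) (D : set R) :
  measurable_fun D (fun s : R => s `^ c * expR (- s)).
Proof.
apply: measurable_funM; first by apply: measurable_funTS; exact: measurable_powR.
under eq_fun do rewrite -mulN1r; exact: measurable_expRM.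
Qed.

Lemma integrable_gamma (R : realType) (c : R) : -1 < c -> c <= 1 ->
  (@lebesgue_measure R).-integrable `]0, +oo[ (EFin \o (fun s => s `^ c * expR (- s))).
Proof.
move=> c1 c2.
have m (D : set R) := @measurable_powR_expR R c D.
have nn (s : R) : 0 <= s `^ c * expR (- s) by rewrite mulr_ge0 ?powR_ge0 ?expR_ge0.
apply/integrableP; split; first by apply/measurable_EFinP; exact: m.
under eq_integral do rewrite /= ger0_norm//.
have -> : `]0, +oo[%classic = `]0, 1[ `|` `[1, +oo[ :> set R.
  apply/seteqP; split=> x /=; rewrite !in_itv/= !andbT.
    by move=> x0; have [x1|x1] := ltP x 1; [left; rewrite x0|right].
  by case=> [/andP[]//|x1]; lra.
rewrite ge0_integral_setU//=; last 3 first.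
- by apply/measurable_EFinP; exact: m.
- by move=> x _ /=; rewrite lee_fin.
- rewrite disj_set2E; apply/eqP; rewrite -subset0 => x []/=.
  by rewrite !in_itv/= andbT => /andP[_ x1] x2; lra.
apply: lte_add_pinfty.
  apply: (@le_lt_trans _ _ (\int[lebesgue_measure]_(t in `]0%R, 1%R[) (t `^ c)%:E)%E).
    apply: ge0_le_integral => //.
    - by move=> x _ /=; rewrite lee_fin.
    - by apply/measurable_EFinP; exact: m.
    - by apply/measurable_EFinP; apply: measurable_funTS; exact: measurable_powR.
    - move=> x; rewrite /= in_itv/= => /andP[x0 _]; rewrite lee_fin ler_piMr ?powR_ge0//.
      by rewrite -expR0 ler_expR oppr_le0 ltW.
  by rewrite integral_powR01// ltry.
apply: (@le_lt_trans _ _ (\int[lebesgue_measure]_(t in `[1%R, +oo[) (2%:E * (expR (- 2^-1 * t))%:E))%E).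
  apply: ge0_le_integral => //.
  - by move=> x _ /=; rewrite lee_fin.
  - by apply/measurable_EFinP; exact: m.
  - by apply/measurable_EFinP; apply: measurable_funM => //; exact: measurable_expRM.
  - by move=> x; rewrite /= in_itv/= andbT => x1; rewrite -EFinM lee_fin powR_expR_le.
apply: (@le_lt_trans _ _ (\int[lebesgue_measure]_(t in `]0%R, +oo[) (2%:E * (expR (- 2^-1 * t))%:E))%E).
  apply: ge0_subset_integral => //.
  - by apply/measurable_EFinP; apply: measurable_funM => //; exact: measurable_expRM.
  - by move=> x; rewrite /= !in_itv/= !andbT; lra.
rewrite ge0_integralZl_EFin// ?integral_expR_oy ?ltry//.
by apply/measurable_EFinP; exact: measurable_expRM.
Qed.

(** On []0, 1[] the integrand is at least [exp (-1) * s], since [b - 1 <= 1]. The bound is uniform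
    in [b], which keeps [1 / Gamma] under control along [2 - alpha]. *)
Lemma euler_gamma_ge (R : realType) (b : R) : 0 < b -> b <= 2 ->
  expR (-1) / 2 <= euler_gamma b.
Proof.
move=> b0 b2.
have c1 : -1 < b - 1 by lra.
have c2 : b - 1 <= 1 by lra.
have int := integrable_gamma c1 c2.
rewrite /euler_gamma -lee_fin /Rintegral fineK; last exact: integrable_fin_num int.
apply: (@le_trans _ _ (\int[lebesgue_measure]_(t in `]0%R, 1%R[) ((expR (-1))%:E * (t `^ 1)%:E))%E).
  rewrite integralZl//; last first.
    apply/integrableP; split.
      by apply/measurable_EFinP; apply: measurable_funTS; exact: measurable_powR.
    under eq_integral do rewrite /= ger0_norm ?powR_ge0//.
    by rewrite integral_powR01 ?ltry//; lra.
  rewrite integral_powR01; last by lra.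
  by rewrite -EFinM lee_fin -natr1.
apply: (@le_trans _ _ (\int[lebesgue_measure]_(t in `]0%R, 1%R[) (t `^ (b - 1) * expR (- t))%:E)%E).
  have /integrableP[m _] := int.
  apply: ge0_le_integral => //.
  - by move=> x _ /=; rewrite lee_fin mulr_ge0 ?powR_ge0 ?expR_ge0.
  - apply/measurable_EFinP; apply: measurable_funM => //.
    by apply: measurable_funTS; exact: measurable_powR.
  - apply: measurable_funS m => //.
    by move=> x; rewrite /= !in_itv/= andbT => /andP[].
  - move=> x; rewrite /= in_itv/= => /andP[x0 x1]; rewrite -EFinM lee_fin mulrC.
    apply: ler_pM; rewrite ?powR_ge0 ?expR_ge0//.
      by apply: ger_powR => //; rewrite x0 ltW.
    by rewrite ler_expR lerN2 ltW.
have /integrableP[m _] := int.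
apply: ge0_subset_integral => //.
- by move=> x _ /=; rewrite lee_fin mulr_ge0 ?powR_ge0 ?expR_ge0.
- by move=> x; rewrite /= !in_itv/= !andbT => /andP[].
Qed.

Lemma euler_gamma_gt0 (R : realType) (b : R) : 0 < b -> b <= 2 -> 0 < euler_gamma b.
Proof.
move=> b0 b2; apply: lt_le_trans (euler_gamma_ge b0 b2).
by rewrite divr_gt0 ?expR_gt0.
Qed.

Lemma is_derive_mull (R : realType) (p z : R) :
  is_derive z (1 : R) (fun z => p * z) p.
Proof.
have h := is_deriveZ p (is_derive_id z (1 : R)).
by apply: (is_derive_eq h); rewrite /GRing.scale/= mulr1.
Qed.

Lemma is_derive_moebius (R : realType) (p r z : R) : 1 + r * z != 0 ->
  is_derive z (1 : R) (fun z => p * z / (1 + r * z)) (p / (1 + r * z) ^+ 2).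
Proof.
move=> d0.
have h2 : is_derive z (1 : R) (fun z => 1 + r * z) r.
  have h := is_deriveD (is_derive_cst (1 : R) z (1 : R)) (is_derive_mull r z).
  by apply: (is_derive_eq h); rewrite add0r.
have h := is_deriveM (is_derive_mull p z) (@is_deriveV R (fun z => 1 + r * z) z r 1 d0 h2).
by apply: (is_derive_eq h); rewrite /GRing.scale/=; field.
Qed.

(** Covers both substitutions that occur: [r = -1] maps []0, 1[] onto the half line and [r = p - 1]
    maps it onto itself. The condition [-1 <= r] keeps the denominator positive on []0, 1[]. *)
Lemma ge0_moebius_substitution (R : realType) (p r : R) (G : R -> R) (J : set R) :
  0 < p -> -1 <= r -> is_interval J ->
  (forall z, 0 < z < 1 -> J (p * z / (1 + r * z))) ->
  (forall y, J y -> exists2 z, 0 < z < 1 & p * z / (1 + r * z) = y) ->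
  (forall y, J y -> {for y, continuous G}) -> (forall y, J y -> 0 <= G y) ->
  (\int[lebesgue_measure]_(y in J) (G y)%:E
   = \int[lebesgue_measure]_(z in `]0%R, 1%R[)
       (G (p * z / (1 + r * z)) * (p / (1 + r * z) ^+ 2))%:E)%E.
Proof.
move=> p0 r1 itvJ FJ JF cG G0.
have d0 z : 0 < z < 1 -> 0 < 1 + r * z.
  by move=> /andP[z0 z1]; nra.
apply: (@ge0_substitution_oo R (fun z => p * z / (1 + r * z))
  (fun z => p / (1 + r * z) ^+ 2)) => //.
- move=> x y; rewrite !in_itv/= => x01 y01 xy.
  rewrite ltr_pdivrMr ?d0// mulrAC ltr_pdivlMr ?d0//.
  by rewrite -!mulrA ltr_pM2l//; lra.
- move=> x; rewrite in_itv/= => x01; by apply: is_derive_moebius; rewrite gt_eqF// d0.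
- move=> x; rewrite in_itv/= => x01; apply: cvgM; first exact: cvg_cst.
  apply: cvgV; first by rewrite expf_eq0/= gt_eqF// d0.
  have c1 : 1 + r * z @[z --> x] --> 1 + r * x.
    by apply: cvgD; [exact: cvg_cst|exact: mulrl_continuous].
  by rewrite expr2; under eq_fun do rewrite expr2; exact: cvgM.
Qed.

Lemma fubini_tonelli_set (R : realType) (A B : set R) (f : R * R -> R) :
  measurable A -> measurable B -> measurable_fun setT f ->
  (forall x y, A x -> B y -> 0 <= f (x, y)) ->
  (\int[lebesgue_measure]_(x in A) \int[lebesgue_measure]_(y in B) (f (x, y))%:E
   = \int[lebesgue_measure]_(y in B) \int[lebesgue_measure]_(x in A) (f (x, y))%:E)%E.
Proof.
move=> mA mB mf f0.
pose h (p : R * R) : \bar R := ((EFin \o f) \_ (A `*` B)) p.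
have mh : measurable_fun setT h.
  apply/(measurable_restrictT _ _).1 => //; first exact: measurableX.
  by apply: measurable_funTS; exact/measurable_EFinP.
have h0 p : (0 <= h p)%E.
  rewrite /h patchE; case: ifP => // /set_mem[/= Ap Bp].
  by rewrite lee_fin; case: p Ap Bp => x y /= ? ?; exact: f0.
have hE x y : h (x, y) = if (x \in A) && (y \in B) then (f (x, y))%:E else 0%E.
  rewrite /h patchE; congr (if _ then _ else _).
  by apply/idP/andP => [/set_mem[/= ? ?]|[/set_mem ? /set_mem ?]]; [split; exact/mem_set|exact/mem_set].
have := @fubini_tonelli _ _ (measurableTypeR R) (measurableTypeR R) R lebesgue_measure lebesgue_measure h mh h0.
move=> E; rewrite integral_mkcond [RHS]integral_mkcond.
transitivity (\int[lebesgue_measure]_x \int[lebesgue_measure]_y h (x, y))%E.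
  apply: eq_integral => x _; rewrite patchE; case: ifP => xA.
    rewrite integral_mkcond; apply: eq_integral => y _.
    by rewrite hE xA patchE.
  by rewrite integral0_eq// => y _; rewrite hE xA.
rewrite E; apply: eq_integral => y _; rewrite patchE; case: ifP => yB.
  rewrite [RHS]integral_mkcond; apply: eq_integral => x _.
  by rewrite hE yB andbT patchE.
by rewrite integral0_eq// => x _; rewrite hE yB andbF.
Qed.

Lemma powR_expR (R : realType) (x c : R) : 0 < x -> x `^ c = expR (c * ln x).
Proof. by move=> x0; rewrite /powR gt_eqF. Qed.

Lemma powR_continuous (R : realType) (c x : R) : 0 < x ->
  {for x, continuous (fun t : R => t `^ c)}.
Proof.
move=> x0; apply/differentiable_continuous/derivable1_diffP.
by have [] := is_derive1_powR c x0.
Qed.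

Lemma integral_euler_gamma (R : realType) (b : R) : 0 < b -> b <= 2 ->
  (\int[lebesgue_measure]_(s in `]0%R, +oo[) (s `^ (b - 1) * expR (- s))%:E
   = (euler_gamma b)%:E)%E.
Proof.
move=> b0 b2; have c1 : -1 < b - 1 by lra.
have c2 : b - 1 <= 1 by lra.
have int := integrable_gamma c1 c2.
by rewrite /euler_gamma /Rintegral fineK//; exact: integrable_fin_num int.
Qed.

(** With [a = alpha 0 - 1] the same weight occurs in the integral defining [g] and in the mixture
    that represents [chi]. *)
Definition beta_weight (R : realType) (a z : R) : R :=
  (1 - z) `^ (a - 1) * z `^ (- a).

Lemma measurable_beta_weight (R : realType) (a : R) (D : set R) :
  measurable_fun D (beta_weight a).
Proof.
apply: measurable_funTS; apply: measurable_funM; last exact: measurable_powR.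
have m : measurable_fun [set: R] (fun z : R => 1 - z) by exact: measurable_funB.
exact: (measurableT_comp (measurable_powR (a - 1)) m).
Qed.

Lemma beta_weight_ge0 (R : realType) (a z : R) : 0 <= beta_weight a z.
Proof. by rewrite mulr_ge0 ?powR_ge0. Qed.

(* Euler's reflection integral: substitute [s = t z / (1 - z)] in the inner
   integral of [Gamma a * Gamma (1 - a)], then integrate in [t] first. *)
Lemma integral_beta_weight (R : realType) (a : R) : 0 < a < 1 ->
  (\int[lebesgue_measure]_(z in `]0%R, 1%R[) (beta_weight a z)%:E
   = (euler_gamma a * euler_gamma (1 - a))%:E)%E.
Proof.
move=> /andP[a0 a1].
(* The inner integrand after substitution, at the point [(t, z)]. The powers of [t] cancel, leaving
   an exponential in [t] of rate [1 / (1 - z)]; the rate is written as a power -1 so that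
   measurability comes from that of [powR]. *)
pose h (p : R * R) : R := p.2 `^ (- a) * (1 - p.2) `^ (a - 2)
  * expR (- ((1 - p.2) `^ (- 1)) * p.1).
have mh : measurable_fun [set: R * R] h.
  have m2 : measurable_fun [set: R * R] (snd : R * R -> R) by exact: measurable_snd.
  have m1 : measurable_fun [set: R * R] (fst : R * R -> R) by exact: measurable_fst.
  have mB : measurable_fun [set: R * R] (fun p : R * R => 1 - p.2).
    exact: measurable_funB.
  have mP c : measurable_fun [set: R * R] (fun p : R * R => (1 - p.2) `^ c).
    exact: (measurableT_comp (measurable_powR c) mB).
  apply: measurable_funM.
    apply: measurable_funM => //.
    exact: (measurableT_comp (measurable_powR (- a)) m2).
  have m : measurable_fun [set: R * R] (fun p : R * R => - ((1 - p.2) `^ (- 1)) * p.1).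
    by apply: measurable_funM => //; exact: measurable_funN.
  exact: (measurableT_comp (@measurable_expR R) m).
have h0 x y : 0 <= h (x, y) by rewrite /h !mulr_ge0 ?powR_ge0 ?expR_ge0.
have g1 : 0 <= euler_gamma (1 - a) by apply/ltW/euler_gamma_gt0; lra.
rewrite mulrC EFinM -(@integral_euler_gamma _ a)//; last by lra.
rewrite -ge0_integralZl_EFin//; last 2 first.
- by move=> x _; rewrite lee_fin mulr_ge0 ?powR_ge0 ?expR_ge0.
- by apply/measurable_EFinP; exact: measurable_powR_expR.
transitivity (\int[lebesgue_measure]_(t in `]0%R, +oo[)
    \int[lebesgue_measure]_(z in `]0%R, 1%R[) (h (t, z))%:E)%E; last first.
  apply: eq_integral => t; rewrite inE /= in_itv/= andbT => t0.
  rewrite -(@integral_euler_gamma _ (1 - a)); [|lra|lra].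
  rewrite (@ge0_moebius_substitution R t (-1)
    (fun s => s `^ (1 - a - 1) * expR (- s)) `]0, +oo[%classic) //; last first.
  - by move=> y _; rewrite mulr_ge0 ?powR_ge0 ?expR_ge0.
  - move=> y; rewrite /= in_itv/= andbT => y0; apply: cvgM.
      exact: powR_continuous.
    apply: (@continuous_comp _ _ _ (-%R) expR).
      exact: continuousN.
    exact: continuous_expR.
  - move=> y; rewrite /= in_itv/= andbT => y0; exists (y / (t + y)).
      by rewrite divr_gt0 ?addr_gt0//= ltr_pdivrMr ?addr_gt0//; lra.
    have ty : t + y != 0 by rewrite gt_eqF// addr_gt0.
    by field; rewrite ty/=; have := t0; lra.
  - move=> z /andP[z0 z1]; rewrite /= in_itv/= andbT.
    by rewrite divr_gt0 ?mulr_gt0//; lra.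
  - exact: interval_is_interval.
  set c := t `^ (a - 1) * expR (- t).
  have c0 : 0 < c by rewrite mulr_gt0 ?powR_gt0 ?expR_gt0.
  have cV0 : 0 <= c^-1 by rewrite invr_ge0 ltW.
  have mht : measurable_fun (`]0%R, 1%R[%classic : set R) (fun z : R => (h (t, z))%:E).
    apply/measurable_EFinP; apply: measurable_funTS.
    exact: (measurableT_comp mh (measurable_pair1 t)).
  transitivity (c%:E * (c^-1%:E * \int[lebesgue_measure]_(z in `]0%R, 1%R[) (h (t, z))%:E))%E.
    by rewrite muleA -EFinM divff ?gt_eqF// mul1e.
  rewrite muleC; congr (_ * _)%E; rewrite -ge0_integralZl_EFin//; last first.
    by move=> z _; rewrite lee_fin.
  apply: eq_integral => z; rewrite inE /= in_itv/= => /andP[z0 z1].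
  rewrite -EFinM; congr EFin; rewrite /h /= mulN1r.
  have z1' : 0 < 1 - z by rewrite subr_gt0.
  rewrite powR_inv1 ?(ltW z1')// /c.
  (* All factors are positive; written as exponentials of logarithms, both sides have the same
     exponent. *)
  rewrite !powR_expR ?divr_gt0 ?mulr_gt0// lnM ?posrE ?mulr_gt0 ?invr_gt0//.
  rewrite lnM ?posrE// lnV ?posrE//.
  have -> : t / (1 - z) ^+ 2 = expR (ln t - 2 * ln (1 - z)).
    by rewrite expRB lnK ?posrE// expRM_natl lnK ?posrE.
  rewrite -!expRD -expRN -!expRD; congr expR.
  by field; rewrite gt_eqF.
rewrite fubini_tonelli_set//.
apply: eq_integral => z; rewrite inE /= in_itv/= => /andP[z0 z1].
have z1' : 0 < 1 - z by rewrite subr_gt0.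
rewrite /h /=; under eq_integral do rewrite EFinM.
rewrite ge0_integralZl_EFin//; last 2 first.
- by apply/measurable_EFinP; exact: measurable_expRM.
- by rewrite mulr_ge0 ?powR_ge0.
rewrite integral_expR_oy ?powR_gt0// -EFinM; congr EFin.
rewrite /beta_weight -mulrA mulrC; congr (_ * _).
rewrite powR_inv1 ?(ltW z1')// invrK (_ : a - 1 = a - 2 + 1); last by ring.
by rewrite powRD ?powRr1 ?(ltW z1')// (gt_eqF z1') implybT.
Qed.

(* The substitution [z -> x z / (1 - z + x z)] turns the Moebius factor into the
   constant [x `^ (- a)]. *)
Lemma integral_beta_weight_moebius (R : realType) (a x : R) : 0 < a < 1 -> 0 < x ->
  (\int[lebesgue_measure]_(z in `]0%R, 1%R[)
      (beta_weight a z / (x * (1 - z) + z))%:E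
   = (x `^ (- a) * (euler_gamma a * euler_gamma (1 - a)))%:E)%E.
Proof.
move=> a01 x0.
have d0 z : 0 < z < 1 -> 0 < x * (1 - z) + z.
  by move=> /andP[z0 z1]; rewrite addr_gt0// mulr_gt0// subr_gt0.
rewrite (@ge0_moebius_substitution R x (x - 1)
    (fun z => beta_weight a z / (x * (1 - z) + z)) `]0, 1[%classic) //; last first.
- move=> z; rewrite /= in_itv/= => z01.
  by rewrite divr_ge0 ?beta_weight_ge0 ?ltW ?d0.
- move=> z; rewrite /= in_itv/= => z01; have /andP[z0 z1] := z01.
  have c1 : 1 - y @[y --> z] --> 1 - z by apply: cvgB; [exact: cvg_cst|exact: cvg_id].
  apply: cvgM; last first.
    apply: cvgV; first by rewrite gt_eqF// d0.
    apply: cvgD; last exact: cvg_id.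
    by apply: cvgM => //; exact: cvg_cst.
  apply: cvgM; last exact: powR_continuous.
  apply: (@cvg_comp _ _ _ (fun y : R => 1 - y) (fun y : R => y `^ (a - 1)) _ _ _ c1).
  by apply: powR_continuous; rewrite subr_gt0.
- move=> y; rewrite /= in_itv/= => y01; have /andP[y0 y1] := y01.
  exists (y / (x * (1 - y) + y)); have dy := d0 y y01.
    by rewrite divr_gt0//= ltr_pdivrMr// mul1r ltrDr mulr_gt0// subr_gt0.
  by field; rewrite !gt_eqF//; nra.
- move=> z z01; have /andP[z0 z1] := z01; rewrite /= in_itv/=.
  have dz : 0 < 1 + (x - 1) * z by nra.
  by rewrite divr_gt0 ?mulr_gt0//= ltr_pdivrMr//; lra.
- exact: interval_is_interval.
- by lra.
rewrite EFinM -integral_beta_weight// -ge0_integralZl_EFin//; last 3 first.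
- by move=> z _; rewrite lee_fin beta_weight_ge0.
- by apply/measurable_EFinP; exact: measurable_beta_weight.
- exact: powR_ge0.
apply: eq_integral => z; rewrite inE /= in_itv/= => z01; have /andP[z0 z1] := z01.
rewrite -EFinM; congr EFin.
have z1' : 0 < 1 - z by rewrite subr_gt0.
have dz : 0 < 1 + (x - 1) * z by nra.
set d := 1 + (x - 1) * z in dz *.
have dn : d != 0 by rewrite gt_eqF.
have e1 : 1 - x * z / d = (1 - z) / d by rewrite /d; field; rewrite -/d.
have e2 : x * (1 - x * z / d) + x * z / d = x / d.
  by rewrite e1 /d; field; rewrite -/d.
have e3 : d / x * (x / d ^+ 2) = d^-1 by field; rewrite dn gt_eqF.
rewrite e2 /beta_weight e1 invf_div -mulrA e3.
rewrite !powR_expR ?divr_gt0 ?mulr_gt0// !lnM ?posrE ?mulr_gt0 ?invr_gt0// lnV ?posrE//.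
have -> : d^-1 = expR (- ln d) by rewrite expRN lnK.
by rewrite -!expRD; congr expR; ring.
Qed.

(** * Positivity of the quadrature weights [chi] *)

(** Against an integrable weight, bounded measurable functions form a class on which the integral is
    linear. It serves the beta weight on []0, 1[] and the Abel kernel on [[0, t]]. *)
Definition bounded_measurable (R : realType) (D : set (measurableTypeR R))
    (f : R -> R) : Prop :=
  measurable_fun D f /\ exists M, forall s, D s -> `|f s| <= M.

Definition is_weight (R : realType) (D : set (measurableTypeR R)) (W : R -> R) : Prop :=
  [/\ measurable D, (@lebesgue_measure R).-integrable D (EFin \o W) &
      forall s, D s -> 0 <= W s].

Definition weighted_integral (R : realType) (D : set (measurableTypeR R))
    (W f : R -> R) : R := \int[@lebesgue_measure R]_(s in D) (f s * W s).

Lemma bounded_measurable_cst (R : realType) (D : set (measurableTypeR R)) (c : R) :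
  bounded_measurable D (fun=> c).
Proof. by split=> //; exists `|c|. Qed.

Lemma bounded_measurable_lin (R : realType) (D : set (measurableTypeR R)) (c : R)
    (f g : R -> R) :
  bounded_measurable D f -> bounded_measurable D g ->
  bounded_measurable D (fun z => c * f z + g z).
Proof.
move=> [mf [M fM]] [mg [M' gM]]; split.
  by apply: measurable_funD => //; exact: measurable_funM.
exists (`|c| * M + M') => z Dz; apply: le_trans (ler_normD _ _) _.
by rewrite lerD ?gM// normrM ler_wpM2l// fM.
Qed.

Lemma bounded_measurable_sum (R : realType) (D : set (measurableTypeR R))
    (c : nat -> R) (f : nat -> R -> R) (s : seq nat) :
  (forall p, p \in s -> bounded_measurable D (f p)) ->
  bounded_measurable D (fun z => \sum_(p <- s) c p * f p z).
Proof.
elim: s => [|p s IH] bf.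
  by under eq_fun do rewrite big_nil; exact: bounded_measurable_cst.
under eq_fun do rewrite big_cons; apply: bounded_measurable_lin.
  by apply: bf; rewrite mem_head.
by apply: IH => q qs; apply: bf; rewrite in_cons qs orbT.
Qed.

Lemma integrable_weighted (R : realType) (D : set (measurableTypeR R)) (W f : R -> R) :
  is_weight D W -> bounded_measurable D f ->
  (@lebesgue_measure R).-integrable D (EFin \o (fun z => f z * W z)).
Proof.
move=> [mD iW W0] [mf [M fM]].
have iM := (fun mD => integrableZl mD M iW) mD.
apply: le_integrable iM => //.
- apply/measurable_EFinP; apply: measurable_funM => //.
  by case/integrableP : iW => /measurable_EFinP.
- move=> z Dz; rewrite lee_fin !normrM.
  by rewrite ler_wpM2r// (le_trans (fM z Dz))// ler_norm.
Qed.

Lemma eq_weighted_integral (R : realType) (D : set (measurableTypeR R)) (W f g : R -> R) :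
  (forall z, D z -> f z = g z) -> weighted_integral D W f = weighted_integral D W g.
Proof. by move=> fg; apply: eq_Rintegral => z /set_mem Dz; rewrite fg. Qed.

Lemma weighted_integral_lin (R : realType) (D : set (measurableTypeR R)) (W : R -> R)
    (c : R) (f g : R -> R) : is_weight D W ->
  bounded_measurable D f -> bounded_measurable D g ->
  weighted_integral D W (fun z => c * f z + g z)
  = c * weighted_integral D W f + weighted_integral D W g.
Proof.
move=> wW bf bg; have intf := integrable_weighted wW bf.
have intg := integrable_weighted wW bg; have [mD _ _] := wW.
rewrite /weighted_integral -RintegralZl// -RintegralD//.
  by apply: eq_Rintegral => z _; ring.
exact: ((fun mD => integrableZl mD c intf) mD).
Qed.

Lemma weighted_integral_sum (R : realType) (D : set (measurableTypeR R)) (W : R -> R)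
    (c : nat -> R) (f : nat -> R -> R) (s : seq nat) : is_weight D W ->
  (forall p, p \in s -> bounded_measurable D (f p)) ->
  weighted_integral D W (fun z => \sum_(p <- s) c p * f p z)
  = \sum_(p <- s) c p * weighted_integral D W (f p).
Proof.
move=> wW; elim: s => [|p s IH] bf.
  rewrite big_nil /weighted_integral /Rintegral integral0_eq// => z _.
  by rewrite big_nil mul0r.
have bf' q : q \in s -> bounded_measurable D (f q).
  by move=> qs; apply: bf; rewrite in_cons qs orbT.
have bp : bounded_measurable D (f p) by apply: bf; rewrite mem_head.
rewrite big_cons -(IH bf') -weighted_integral_lin//; last exact: bounded_measurable_sum.
by apply: eq_weighted_integral => z _; rewrite big_cons.
Qed.

Lemma weighted_integral_ge0 (R : realType) (D : set (measurableTypeR R)) (W f : R -> R) :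
  is_weight D W -> (forall z, D z -> 0 <= f z) -> 0 <= weighted_integral D W f.
Proof.
by move=> [_ _ W0] f0; apply: Rintegral_ge0 => z Dz; rewrite mulr_ge0 ?W0 ?f0.
Qed.

Lemma weighted_integral_abs_le (R : realType) (D : set (measurableTypeR R)) (W : R -> R)
    (M : R) (f : R -> R) : is_weight D W ->
  measurable_fun D f -> (forall z, D z -> `|f z| <= M) ->
  `|weighted_integral D W f| <= M * \int[@lebesgue_measure R]_(s in D) W s.
Proof.
move=> wW mf fM; have bf : bounded_measurable D f by split=> //; exists M.
have intf := integrable_weighted wW bf; have [mD iW W0] := wW.
have intM := integrable_weighted wW (bounded_measurable_cst D M).
apply: le_trans (le_normr_Rintegral mD intf) _.
rewrite -RintegralZl//; apply: le_Rintegral => //; first exact: integrable_norm.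
move=> z Dz; rewrite normrM (ger0_norm (W0 z Dz)).
by rewrite ler_wpM2r ?W0 ?fM.
Qed.

Lemma is_weight_beta (R : realType) (a : R) : 0 < a < 1 ->
  is_weight `]0, 1[ (beta_weight a).
Proof.
move=> a01; split; first exact: measurable_itv; last by move=> s _; exact: beta_weight_ge0.
apply/integrableP; split.
  by apply/measurable_EFinP; exact: measurable_beta_weight.
under eq_integral do rewrite /= ger0_norm ?beta_weight_ge0//.
by rewrite integral_beta_weight// ltry.
Qed.

Definition beta_integral (R : realType) (a : R) (f : R -> R) : R :=
  weighted_integral `]0, 1[ (beta_weight a) f.

Lemma Rintegral_beta_weight (R : realType) (a : R) : 0 < a < 1 ->
  \int[@lebesgue_measure R]_(z in `]0, 1[) beta_weight a z
  = euler_gamma a * euler_gamma (1 - a).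
Proof. by move=> a01; rewrite /Rintegral integral_beta_weight. Qed.

Lemma eq_beta_integral (R : realType) (a : R) (f g : R -> R) :
  (forall z, 0 < z < 1 -> f z = g z) -> beta_integral a f = beta_integral a g.
Proof.
by move=> fg; apply: eq_weighted_integral => z; rewrite /= in_itv/=; exact: fg.
Qed.

(** Convergence at 1 / 2 gives [|d p| <= M 2^p]. If the coefficients below [n] vanish, the terms
    beyond [n] are dominated by a geometric series for [z <= 1 / 4], and the zero sum forces [|d n|]
    to be [O(z)]. *)
Lemma power_series_eq0 (R : realType) (d : nat -> R) :
  (forall z : R, `|z| < 1 -> series (fun p => d p * z ^+ p) @ \oo --> (0 : R)) ->
  forall p, d p = 0.
Proof.
move=> d0 n; have [m] := ubnP n; elim: m n => // m IH n /ltnSE nm.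
have [M M0 dM] : exists2 M, 0 <= M & forall p, `|d p| <= M * 2 ^+ p.
  have h : `|2^-1 : R| < 1 by rewrite ger0_norm// invf_lt1// ltr1n.
  have c : cvgn (series (fun p => d p * 2^-1 ^+ p)) by apply/cvg_ex; exists 0; exact: d0.
  have /cvg_seq_bounded [M [Mr Mb]] := cvgP _ (cvg_series_cvg_0 c).
  have MM : M < `|M| + 1 by rewrite (le_lt_trans (ler_norm M))// ltrDl.
  exists (`|M| + 1) => // p; have := Mb _ MM p I.
  rewrite /= normrM normrX (ger0_norm (x := 2^-1))// exprVn.
  by rewrite ler_pdivrMr// exprn_gt0.
suff H z : 0 < z -> z <= 4^-1 -> `|d n| <= 4 * M * 2 ^+ n * z.
  apply/eqP; rewrite -normr_le0; apply/ler_addgt0Pl => e e0; rewrite addr0.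
  pose q := 4 * M * 2 ^+ n + 1.
  have q0 : 0 < q by rewrite ltr_wpDl// !mulr_ge0.
  pose z := Num.min 4^-1 (e / q).
  have z0 : 0 < z by rewrite lt_min invr_gt0 ltr0n/= divr_gt0.
  apply: le_trans (H z z0 _) _; first by rewrite ge_min lexx.
  apply: (@le_trans _ _ (q * z)); first by rewrite ler_wpM2r ?(ltW z0)// lerDl.
  by rewrite mulrC -ler_pdivlMr// ge_min lexx orbT.
move=> z0 z4; have zn : `|z| < 1 by rewrite ger0_norm ?ltW//; lra.
(* The last factor is the sum of [k] terms of the geometric series of ratio 1 / 2, which dominates
   [2 * z]. *)
have tail k : `|\sum_(n.+1 <= p < n.+1 + k) d p * z ^+ p| <= M * (2 * z) ^+ n.+1 * (2 - 2 * 2^-1 ^+ k).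
  elim: k => [|k IHk]; first by rewrite addn0 big_geq// normr0 expr0 mulr1 subrr mulr0.
  rewrite addnS big_nat_recr ?leq_addr//= (le_trans (ler_normD _ _))//.
  have : `|d (n.+1 + k)%N * z ^+ (n.+1 + k)| <= M * (2 * z) ^+ n.+1 * 2^-1 ^+ k.
    rewrite normrM normrX (ger0_norm (ltW z0)).
    apply: (@le_trans _ _ (M * 2 ^+ (n.+1 + k) * z ^+ (n.+1 + k))).
      by rewrite ler_wpM2r// exprn_ge0// ltW.
    have zz : 0 <= 2 * z by rewrite mulr_ge0// ltW.
    rewrite -mulrA -exprMn exprD mulrA; apply: ler_wpM2l.
      by rewrite mulr_ge0// exprn_ge0.
    by apply: lerXn2r; rewrite ?nnegrE//; lra.
  by move: IHk; rewrite (exprS 2^-1); set A := M * _; lra.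
have part k : series (fun p => d p * z ^+ p) (n.+1 + k)%N = d n * z ^+ n + \sum_(n.+1 <= p < n.+1 + k) d p * z ^+ p.
  rewrite /series /= (big_cat_nat _ (n := n.+1))//= ?leq_addr//; congr (_ + _).
  rewrite big_nat_recr//= big_nat_cond big1 ?add0r// => p /andP[/andP[_ pn] _].
  by rewrite IH ?mul0r// (leq_trans pn).
have L : `|d n * z ^+ n| <= M * (2 * z) ^+ n.+1 * 2.
  have c : (fun k => `|d n * z ^+ n - series (fun p => d p * z ^+ p) (k + n.+1)%N|) @ \oo
      --> `|d n * z ^+ n - 0|.
    apply: cvg_norm; apply: cvgB; first exact: cvg_cst.
    by rewrite (cvg_shiftn n.+1 (series (fun p => d p * z ^+ p))); exact: d0.
  rewrite subr0 in c.
  apply: (ler_cvg_to c (cvg_cst (M * (2 * z) ^+ n.+1 * 2))).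
  near=> k; rewrite addnC part opprD addNKr normrN (le_trans (tail k))//.
  rewrite ler_wpM2l ?mulr_ge0 ?exprn_ge0 ?mulr_ge0 ?(ltW z0)//.
  by rewrite gerBl mulr_ge0 ?exprn_ge0 ?invr_ge0.
have zn0 : 0 < z ^+ n by rewrite exprn_gt0.
rewrite -(ler_pM2r zn0); rewrite normrM (ger0_norm (ltW zn0)) in L.
rewrite (le_trans L)// le_eqVlt; apply/orP; left; apply/eqP.
by rewrite exprMn !exprS; ring.
Unshelve. all: by end_near. Qed.

(** The explicit remainder reduces the expansion of the mixture to integrals of finite sums. *)
Lemma cayley_coef_sum (R : realType) (q x : R) n : 1 - q * x != 0 ->
  \sum_(0 <= p < n.+1) cayley_coef q p * x ^+ p
  = (1 + x) / (1 - q * x) - (q * x) ^+ n * (x * (1 + q)) / (1 - q * x).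
Proof.
move=> qx; elim: n => [|n IH]; first by rewrite big_nat1 /= !expr0; field.
by rewrite big_nat_recr//= IH !exprMn !exprS; field.
Qed.

Lemma cayley_coef_le2 (R : realType) (q : R) p : -1 <= q <= 1 -> `|cayley_coef q p| <= 2.
Proof.
move=> /andP[q1 q2]; case: p => [|p] /=; first by rewrite normr1; lra.
have qn : `|q| <= 1 by rewrite ler_norml q1.
rewrite normrM normrX; apply: (@le_trans _ _ (1 * 2)); last by rewrite mul1r.
by apply: ler_pM; rewrite ?exprn_ge0 ?exprn_ile1// ger0_norm; lra.
Qed.

(** The coefficients of the mixture with [q = 1 - 2 z]. The constant normalises the value of
    [integral_beta_weight_moebius], and [2^(-a)] accounts for the factor 2 in the generating
    function. *)
Definition chi_moment (R : realType) (a : R) (p : nat) : R :=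
  2 `^ (- a) / (euler_gamma a * euler_gamma (1 - a))
  * beta_integral a (fun z => cayley_coef (1 - 2 * z) p).

Lemma bounded_measurable_cayley (R : realType) p :
  bounded_measurable `]0, 1[ (fun z : R => cayley_coef (1 - 2 * z) p).
Proof.
split.
  have m : measurable_fun [set: R] (fun z : R => 1 - 2 * z).
    by apply: measurable_funB => //; exact: measurable_funM.
  apply: measurable_funTS; case: p => [|p] /=; first exact: measurable_cst.
  apply: measurable_funM; last exact: measurable_funD.
  exact: measurable_funX.
by exists 2 => z; rewrite /= in_itv/= => /andP[z0 z1]; apply: cayley_coef_le2; lra.
Qed.

Lemma chi_moment_is_chi (R : realType) (a : R) : 0 < a < 1 -> is_chi a (chi_moment a).
Proof.
move=> a01 x x1; have /andP[a0 a1] := a01.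
have [xl xr] : -1 < x /\ x < 1 by move: x1; rewrite ltr_norml => /andP[].
pose C := euler_gamma a * euler_gamma (1 - a).
have C0 : 0 < C by rewrite mulr_gt0// euler_gamma_gt0//; lra.
have X0 : 0 < (1 - x) / (1 + x) by rewrite divr_gt0; lra.
have dz z : 0 < z < 1 -> 0 < 1 - (1 - 2 * z) * x by move=> /andP[z0 z1]; nra.
pose G z := (1 + x) / (1 - (1 - 2 * z) * x).
pose r n z := ((1 - 2 * z) * x) ^+ n * (x * (1 + (1 - 2 * z))) / (1 - (1 - 2 * z) * x).
have xn : 0 < 1 - `|x| by rewrite subr_gt0.
have dz' z : 0 < z < 1 -> 1 - `|x| <= 1 - (1 - 2 * z) * x.
  move=> /andP[z0 z1]; rewrite lerD2l lerN2 (le_trans (ler_norm _))// normrM.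
  by rewrite ler_piMl// ler_norml; lra.
(* With [X = (1 - x) / (1 + x)], the function [G z] equals [1 / (X (1 - z) + z)]. *)
have GE : beta_integral a G = C * ((1 - x) / (1 + x)) `^ (- a).
  rewrite /beta_integral /weighted_integral /Rintegral mulrC /C.
  have -> : (\int[lebesgue_measure]_(z in `]0%R, 1%R[) (G z * beta_weight a z)%:E
    = \int[lebesgue_measure]_(z in `]0%R, 1%R[)
      (beta_weight a z / ((1 - x) / (1 + x) * (1 - z) + z))%:E)%E.
    apply: eq_integral => z; rewrite inE/= in_itv/= => z01; congr EFin.
    rewrite mulrC /G; congr (_ * _); have := dz z z01.
    move=> d1; have d2 : 0 < 1 + x by lra.
    field; rewrite !gt_eqF//=; nra.
  by rewrite integral_beta_weight_moebius.
have mr n : measurable_fun (`]0%R, 1%R[%classic : set R) (r n).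
  have m : measurable_fun [set: R] (fun z : R => (1 - 2 * z) * x).
    apply: measurable_funM => //.
    by apply: measurable_funB => //; exact: measurable_funM.
  have m1 : measurable_fun [set: R] (fun z : R => 1 - (1 - 2 * z) * x).
    exact: measurable_funB.
  have m2 : measurable_fun [set: R] (fun z : R => x * (1 + (1 - 2 * z))).
    apply: measurable_funM => //; apply: measurable_funD => //.
    by apply: measurable_funB => //; exact: measurable_funM.
  have m3 : measurable_fun [set: R] (fun z : R => ((1 - 2 * z) * x) ^+ n * (x * (1 + (1 - 2 * z)))).
    by apply: measurable_funM => //; exact: measurable_funX.
  have mm : measurable_fun (`]0%R, 1%R[%classic : set R)
      (fun z : R => ((1 - 2 * z) * x) ^+ n * (x * (1 + (1 - 2 * z)))
        * (1 - (1 - 2 * z) * x) `^ (-1)).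
    apply: measurable_funTS; apply: measurable_funM => //.
    exact: (measurableT_comp (measurable_powR (-1)) m1).
  apply: eq_measurable_fun mm => z; rewrite inE/= in_itv/= => z01.
  by rewrite powR_inv1// ltW// dz.
have rM n z : 0 < z < 1 -> `|r n z| <= `|x| ^+ n * (2 / (1 - `|x|)).
  move=> z01; have /andP[z0 z1] := z01.
  have q1 : `|1 - 2 * z| <= 1 by rewrite ler_norml; lra.
  rewrite /r -mulrA normrM normrX; apply: ler_pM; rewrite ?exprn_ge0//.
    by apply: lerXn2r; rewrite ?nnegrE// normrM ler_piMl.
  rewrite !normrM normfV; apply: ler_pM; rewrite ?mulr_ge0 ?invr_ge0//.
    rewrite -[leRHS]mul1r; apply: ler_pM => //; first exact: ltW.
    by rewrite ger0_norm; lra.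
  rewrite gtr0_norm ?dz// lef_pV2 ?posrE ?dz//; exact: dz'.
pose c := 2 `^ (- a) / C.
have br n : bounded_measurable `]0, 1[ (r n).
  split; first exact: mr.
  by exists (`|x| ^+ n * (2 / (1 - `|x|))) => z; rewrite /= in_itv/=; exact: rM.
(* The partial sum of index [n.+1] contains the terms [p <= n]; the shift is undone when the limit
   is taken. *)
have partial n : series (fun p => chi_moment a p * x ^+ p) n.+1
   = (2 * (1 - x) / (1 + x)) `^ (- a) - c * beta_integral a (r n).
  have -> : (2 * (1 - x) / (1 + x)) `^ (- a) = c * beta_integral a G.
    by rewrite GE /c mulrA divfK ?gt_eqF// -powRM ?(ltW X0)// mulrA.
  have -> : beta_integral a G = beta_integral a (fun z => 1 * r n z +
      \sum_(0 <= p < n.+1) x ^+ p * cayley_coef (1 - 2 * z) p).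
    apply: eq_beta_integral => z z01.
    under eq_bigr do rewrite mulrC.
    by rewrite cayley_coef_sum ?gt_eqF ?dz// /r /G; ring.
  have bm := @bounded_measurable_cayley R.
  have wb := is_weight_beta a01.
  rewrite /beta_integral weighted_integral_lin//; last by apply: bounded_measurable_sum.
  rewrite weighted_integral_sum// mul1r mulrDr addrAC subrr add0r mulr_sumr.
  by apply: eq_bigr => p _; rewrite /chi_moment /beta_integral -/C -/c; ring.
have c0 : 0 <= c by rewrite divr_ge0 ?powR_ge0 ?ltW.
have lim0 : c * beta_integral a (r n) @[n --> \oo] --> (0 : R).
  have nx : `| `|x| | < 1 by rewrite normr_id.
  have g := cvg_geometric (c * (2 / (1 - `|x|) * C)) nx.
  apply: norm_cvg0; apply: (squeeze_cvgr _ (cvg_cst 0) g).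
  near=> n; rewrite normr_ge0 /= normrM (ger0_norm c0).
  apply: (@le_trans _ _ (c * (`|x| ^+ n * (2 / (1 - `|x|)) * C))).
    rewrite ler_wpM2l// /C -Rintegral_beta_weight//.
    apply: (weighted_integral_abs_le (is_weight_beta a01) (mr n)).
    by move=> z; rewrite /= in_itv/=; exact: rM.
  by rewrite le_eqVlt; apply/orP; left; apply/eqP; rewrite /geometric /=; ring.
rewrite -(cvg_shiftn 1); under eq_fun do rewrite addn1 partial.
set l := (2 * (1 - x) / (1 + x)) `^ (- a).
have L : l - c * beta_integral a (r n) @[n --> \oo] --> l - 0.
  by apply: cvgB; [exact: cvg_cst|exact: lim0].
by rewrite subr0 in L; exact: L.
Unshelve. all: by end_near. Qed.

(** Both [chi] and [chi_moment] have the same sum on []-1, 1[], hence they coincide. The double sum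
    is then the integral, against a nonnegative weight, of sums that are nonnegative by
    [cayley_coef_psd]. *)
Lemma chi_psd (R : realType) (a : R) (chi : nat -> R) (V : lmodType R)
    (B : V -> V -> R) (Bp : psd_form B) (v : nat -> V) m :
  0 < a < 1 -> is_chi a chi ->
  0 <= \sum_(0 <= n < m) \sum_(0 <= p < n.+1) chi p * B (v (n - p)%N) (v n).
Proof.
move=> a01 chiP; have /andP[a0 a1] := a01.
have chiE p : chi p = chi_moment a p.
  apply/eqP; rewrite -subr_eq0; apply/eqP; move: p.
  apply: power_series_eq0 => x x1; set l := (2 * (1 - x) / (1 + x)) `^ (- a).
  have L : series (fun p => chi p * x ^+ p) n - series (fun p => chi_moment a p * x ^+ p) n
      @[n --> \oo] --> l - l.
    by apply: cvgB; [exact: chiP|exact: chi_moment_is_chi].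
  rewrite subrr in L.
  have e : (fun n => series (fun p => chi p * x ^+ p) n
      - series (fun p => chi_moment a p * x ^+ p) n)
      = series (fun p => (chi p - chi_moment a p) * x ^+ p).
    apply/funext => n; rewrite /series /= -sumrB.
    by apply: eq_bigr => p _; rewrite mulrBl.
  by rewrite e in L; exact: L.
have bm := @bounded_measurable_cayley R.
pose c := 2 `^ (- a) / (euler_gamma a * euler_gamma (1 - a)).
have -> : \sum_(0 <= n < m) \sum_(0 <= p < n.+1) chi p * B (v (n - p)%N) (v n)
  = c * beta_integral a (fun z => \sum_(0 <= n < m) 1 * \sum_(0 <= p < n.+1)
       B (v (n - p)%N) (v n) * cayley_coef (1 - 2 * z) p).
  have wb := is_weight_beta a01; rewrite /beta_integral weighted_integral_sum//; last first.
    by move=> n _; apply: bounded_measurable_sum => p _; exact: bm.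
  rewrite mulr_sumr; apply: eq_bigr => n _; rewrite mul1r weighted_integral_sum//.
  rewrite mulr_sumr; apply: eq_bigr => p _; rewrite chiE /chi_moment /beta_integral -/c; ring.
apply: mulr_ge0.
  by rewrite divr_ge0 ?powR_ge0// mulr_ge0// ltW// euler_gamma_gt0//; lra.
apply: weighted_integral_ge0; first exact: is_weight_beta.
move=> z; rewrite /= in_itv/= => /andP[z0 z1].
have q1 : -1 <= 1 - 2 * z <= 1 by lra.
have := cayley_coef_psd Bp v m q1; congr (_ <= _).
by apply: eq_bigr => n _; rewrite mul1r; apply: eq_bigr => p _; rewrite mulrC.
Qed.

(** * Functions of bounded second differences *)

Definition second_diff (R : realType) (phi : R -> R) (t h : R) : R :=
  phi (t + 2 * h) - 2 * phi (t + h) + phi t.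

(* The second derivative of [modulus] is [1 + t `^ (- 2^-1)], which dominates
   that of [t |-> (alpha 0 - alpha t) * ln t]. *)
Definition modulus (R : realType) (t : R) : R := t ^+ 2 / 2 + 4 / 3 * t `^ (3 / 2).

(** One constant serves all three clauses, so that it can itself be integrated over a parameter. The
    Lipschitz clause is needed for products and compositions: products of first differences are
    [O(h^2)], and [h^2] is dominated by the second difference of [modulus] thanks to its quadratic
    part. *)
Definition regular (R : realType) (T K : R) (phi : R -> R) : Prop :=
  [/\ forall t, 0 <= t <= T -> `|phi t| <= K,
      forall s t, 0 <= s <= T -> 0 <= t <= T -> `|phi s - phi t| <= K * `|s - t| &
      forall t h, 0 <= t -> 0 <= h -> t + 2 * h <= T ->
        `|second_diff phi t h| <= K * second_diff (@modulus R) t h].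

(** The mean value theorem is used on [[t, t + h]], on [[t + h, t + 2 h]], and for [f'] between the
    two points found. These lie in the open interval, so at 0 continuity suffices and [f''] may blow
    up there. *)
Lemma convex_second_diff (R : realType) (T : R) (f f' f'' : R -> R) t h :
  {within `[0, T], continuous f} ->
  (forall x : R, 0 < x < T -> is_derive x (1 : R) f (f' x)) ->
  (forall x : R, 0 < x < T -> is_derive x (1 : R) f' (f'' x)) ->
  (forall x, 0 < x < T -> 0 <= f'' x) ->
  0 <= t -> 0 <= h -> t + 2 * h <= T -> 0 <= second_diff f t h.
Proof.
move=> cf df df' f''0 t0; rewrite le_eqVlt => /predU1P[<-|h0] tT.
  by rewrite /second_diff mulr0 addr0 le_eqVlt; apply/orP; left; apply/eqP; ring.
have sub a b : 0 <= a -> b <= T -> {within `[a, b], continuous f}.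
  move=> a0 bT; apply: continuous_subspaceW cf => x /=.
  by rewrite !in_itv/= => /andP[? ?]; apply/andP; split; lra.
have mvt a b : 0 <= a -> a < b -> b <= T ->
    exists2 c, c \in `]a, b[ & f b - f a = f' c * (b - a).
  move=> a0 ab bT; apply: MVT => //; last exact: sub.
  by move=> x; rewrite in_itv/= => /andP[? ?]; apply: df; apply/andP; split; lra.
have [l1 l2 l3 l4] : [/\ t < t + h, t + h <= T, 0 <= t + h & t + h < t + 2 * h].
  by split; lra.
have [c1 c1P e1] := mvt _ _ t0 l1 l2.
have [c2 c2P e2] := mvt _ _ l3 l4 tT.
move: c1P c2P; rewrite !in_itv/= => /andP[c1a c1b] /andP[c2a c2b].
have c12 : c1 < c2 by lra.
have [||c3 c3P e3] := @MVT R f' f'' c1 c2 c12.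
- move=> x; rewrite in_itv/= => /andP[? ?]; apply: df'; apply/andP; split; lra.
- apply: derivable_within_continuous => x; rewrite in_itv/= => /andP[? ?].
  by have [] : is_derive x (1 : R) f' (f'' x) by apply: df'; apply/andP; split; lra.
move: c3P; rewrite in_itv/= => /andP[c3a c3b].
have f3 : 0 <= f'' c3 by apply: f''0; apply/andP; split; lra.
have -> : second_diff f t h = h * (f' c2 - f' c1).
  rewrite /second_diff; have -> : f (t + 2 * h) = f (t + h) + f' c2 * (t + 2 * h - (t + h)).
    by rewrite -e2; ring.
  have -> : f t = f (t + h) - f' c1 * (t + h - t) by rewrite -e1; ring.
  by ring.
rewrite e3; apply: mulr_ge0; first exact: ltW.
by apply: mulr_ge0 => //; lra.
Qed.

Lemma powR32_continuous (R : realType) (T : R) : 0 < T ->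
  {within `[0, T], continuous (fun t : R => t `^ (3 / 2))}.
Proof.
move=> T0; apply/continuous_within_itvP => //; split.
- by move=> x; rewrite in_itv/= => /andP[x0 _]; exact: powR_continuous.
- by rewrite powR0//; apply: powR_cvg0.
- apply: cvg_at_left_filter; exact: powR_continuous.
Qed.

Lemma is_derive_powR32 (R : realType) (x : R) : 0 < x ->
  is_derive x (1 : R) (fun t : R => t `^ (3 / 2)) (3 / 2 * x `^ 2^-1).
Proof.
move=> x0; have h := is_derive1_powR (3 / 2) x0; apply: (is_derive_eq h).
by congr (_ * _ `^ _); field.
Qed.

Lemma is_derive_powR12 (R : realType) (x : R) : 0 < x ->
  is_derive x (1 : R) (fun t : R => 3 / 2 * t `^ 2^-1) (3 / 4 * x `^ (- 2^-1)).
Proof.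
move=> x0; have h := is_deriveZ (3 / 2) (is_derive1_powR 2^-1 x0).
apply: (is_derive_eq h); rewrite /GRing.scale/= mulrA.
by congr (_ * _ `^ _); field.
Qed.

Lemma second_diff_powR32_ge0 (R : realType) (t h : R) : 0 <= t -> 0 <= h ->
  0 <= second_diff (fun t : R => t `^ (3 / 2)) t h.
Proof.
move=> t0 h0; have T0 : 0 < t + 2 * h + 1 by lra.
have H := @convex_second_diff R _ _ (fun x => 3 / 2 * x `^ 2^-1)
  (fun x => 3 / 4 * x `^ (- 2^-1)) t h (powR32_continuous T0).
apply: H; [| | |exact: t0|exact: h0|by lra].
- by move=> x /andP[x0 _]; exact: is_derive_powR32.
- by move=> x /andP[x0 _]; exact: is_derive_powR12.
- by move=> x _; rewrite mulr_ge0 ?powR_ge0.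
Qed.

Lemma second_diff_modulus (R : realType) (t h : R) :
  second_diff (@modulus R) t h
  = h ^+ 2 + 4 / 3 * second_diff (fun t : R => t `^ (3 / 2)) t h.
Proof. by rewrite /second_diff /modulus; field. Qed.

Lemma sqr_le_second_diff_modulus (R : realType) (t h : R) : 0 <= t -> 0 <= h ->
  h ^+ 2 <= second_diff (@modulus R) t h.
Proof.
move=> t0 h0; rewrite second_diff_modulus lerDl mulr_ge0//.
exact: second_diff_powR32_ge0.
Qed.

(** Both terms of [modulus] are homogeneous of positive degree, so a contraction of the variable
    decreases its second differences. This makes [regular] stable under [t |-> t * z] with the same
    constant. *)
Lemma second_diff_modulus_scale (R : realType) (z t h : R) :
  0 <= z <= 1 -> 0 <= t -> 0 <= h ->
  second_diff (@modulus R) (z * t) (z * h) <= second_diff (@modulus R) t h.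
Proof.
move=> /andP[z0 z1] t0 h0; rewrite !second_diff_modulus; apply: lerD.
  by apply: lerXn2r; rewrite ?nnegrE ?mulr_ge0// ler_piMl.
rewrite ler_wpM2l//.
have -> : second_diff (fun t : R => t `^ (3 / 2)) (z * t) (z * h)
    = z `^ (3 / 2) * second_diff (fun t : R => t `^ (3 / 2)) t h.
  rewrite /second_diff mulrCA -!mulrDr !powRM ?addr_ge0 ?mulr_ge0//; ring.
rewrite ler_piMl ?second_diff_powR32_ge0//.
have P1 : (1 : R) `^ (3 / 2) = 1 by rewrite powR1.
by rewrite -[leRHS]P1; apply: ge0_ler_powR; rewrite ?nnegrE.
Qed.

Lemma modulus_lip (R : realType) (T s t : R) : 0 < T -> 0 <= s -> s <= t -> t <= T ->
  modulus t - modulus s <= (T + 2 * T `^ 2^-1) * (t - s)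
  /\ 0 <= modulus t - modulus s.
Proof.
move=> T0 s0; rewrite le_eqVlt => /predU1P[->|st] tT; first by rewrite !subrr mulr0.
have [||c cP e] := @MVT R (fun t : R => t `^ (3 / 2)) (fun x => 3 / 2 * x `^ 2^-1) s t st.
- by move=> x; rewrite in_itv/= => /andP[sx _]; apply: is_derive_powR32; lra.
- apply: continuous_subspaceW (powR32_continuous T0) => x /=.
  by rewrite !in_itv/= => /andP[? ?]; apply/andP; split; lra.
move: cP; rewrite in_itv/= => /andP[sc ct].
have -> : modulus t - modulus s = ((t + s) / 2 + 2 * c `^ 2^-1) * (t - s).
  rewrite /modulus (_ : t `^ (3 / 2) = s `^ (3 / 2) + 3 / 2 * c `^ 2^-1 * (t - s)).
    by field.
  by rewrite -e; ring.
have cT : c `^ 2^-1 <= T `^ 2^-1 by apply: ge0_ler_powR; rewrite ?nnegrE//; lra.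
have c0 : 0 <= c `^ 2^-1 by exact: powR_ge0.
by split; [apply: ler_wpM2r|apply: mulr_ge0]; lra.
Qed.

(** The sum telescopes to the last first difference minus the initial one. The latter is
    nonnegative, the former is at most the Lipschitz constant times [tau]: this is the [O(tau)] on
    which the memory estimate rests. *)
Lemma sum_second_diff_modulus (R : realType) (T tau : R) m :
  0 < T -> 0 <= tau -> m.+1%:R * tau <= T ->
  \sum_(0 <= k < m) second_diff (@modulus R) (k%:R * tau) tau
    <= (T + 2 * T `^ 2^-1) * tau.
Proof.
move=> T0 tau0 mT.
have -> : \sum_(0 <= k < m) second_diff (@modulus R) (k%:R * tau) tau
   = (modulus (m.+1%:R * tau) - modulus (m%:R * tau)) - (modulus (1 * tau) - modulus (0 * tau)).
  elim: {mT} m => [|m IH]; first by rewrite big_geq//; ring.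
  rewrite big_nat_recr//= IH /second_diff.
  have -> : m%:R * tau + 2 * tau = m.+2%:R * tau by rewrite -!natr1; ring.
  have -> : m%:R * tau + tau = m.+1%:R * tau by rewrite -!natr1; ring.
  by ring.
have e : m.+1%:R * tau = m%:R * tau + tau by rewrite -natr1; ring.
have mt0 : 0 <= m%:R * tau by rewrite mulr_ge0.
rewrite e in mT *.
have l1 : m%:R * tau <= m%:R * tau + tau by rewrite lerDl.
have [L _] := modulus_lip T0 mt0 l1 mT.
have l2 : tau <= T by lra.
have [_ L'] := modulus_lip T0 (lexx 0) tau0 l2.
by rewrite mul1r mul0r; lra.
Qed.

Lemma regular_ge0 (R : realType) (T K : R) (phi : R -> R) :
  0 <= T -> regular T K phi -> 0 <= K.
Proof. by move=> T0 [b _ _]; apply: le_trans (b 0 _); rewrite ?lexx. Qed.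

Lemma regular_cst (R : realType) (T c : R) : regular T `|c| (fun=> c).
Proof.
split=> [//|s t _ _|t h t0 h0 _]; first by rewrite subrr normr0 mulr_ge0.
rewrite /second_diff (_ : c - 2 * c + c = 0); last by ring.
rewrite normr0 mulr_ge0// (le_trans (sqr_ge0 h))// sqr_le_second_diff_modulus//.
Qed.

Lemma is_derive_modulus (R : realType) (x : R) : 0 < x ->
  is_derive x (1 : R) (@modulus R) (x + 2 * x `^ 2^-1).
Proof.
move=> x0; have h1 := is_deriveM (is_derive_id x (1 : R)) (is_derive_id x (1 : R)).
have h := is_deriveD (is_deriveZ 2^-1 h1) (is_deriveZ (4 / 3) (is_derive_powR32 x0)).
have e : (2^-1 \*: ((id : R -> R) * id) + 4 / 3 \*: (fun t : R => t `^ (3 / 2))) = @modulus R.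
  apply/funext => y; rewrite /modulus /= expr2 [y * y / 2]mulrC.
  by [].
rewrite e in h; apply: (is_derive_eq h); rewrite /GRing.scale/= mulr1.
by field.
Qed.

Lemma is_derive_modulus' (R : realType) (x : R) : 0 < x ->
  is_derive x (1 : R) (fun x : R => x + 2 * x `^ 2^-1) (1 + x `^ (- 2^-1)).
Proof.
move=> x0.
have h := is_deriveD (is_derive_id x (1 : R)) (is_deriveZ (4 / 3) (is_derive_powR12 x0)).
have e : (id : R -> R) + 4 / 3 \*: (fun t : R => 3 / 2 * t `^ 2^-1)
    = (fun x : R => x + 2 * x `^ 2^-1).
  apply/funext => y.
  change (y + 4 / 3 * (3 / 2 * y `^ 2^-1) = y + 2 * y `^ 2^-1).
  by congr (_ + _); rewrite mulrA; congr (_ * _); field.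
by rewrite e in h; apply: (is_derive_eq h); rewrite /GRing.scale/=; field.
Qed.

Lemma modulus_continuous (R : realType) (T : R) : 0 < T ->
  {within `[0, T], continuous (@modulus R)}.
Proof.
move=> T0; have c1 : {within `[0, T], continuous (fun x : R => x ^+ 2 / 2)}.
  apply: continuous_subspaceT => x; apply: cvgM; last exact: cvg_cst.
  exact: exprn_continuous.
move=> x; apply: cvgD; first exact: c1.
by apply: cvgM; [exact: cvg_cst|exact: powR32_continuous].
Qed.

(** The bound on [f''] is [K] times the second derivative of [modulus]. Hence [K * modulus + f] and
    [K * modulus - f] are convex, and nonnegativity of their second differences is the third
    clause. *)
Lemma regular_C2 (R : realType) (T K : R) (f f' f'' : R -> R) :
  {within `[0, T], continuous f} ->
  (forall x : R, 0 < x < T -> is_derive x (1 : R) f (f' x)) ->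
  (forall x : R, 0 < x < T -> is_derive x (1 : R) f' (f'' x)) ->
  (forall x, 0 <= x <= T -> `|f x| <= K) ->
  (forall x, 0 < x < T -> `|f' x| <= K) ->
  (forall x, 0 < x < T -> `|f'' x| <= K * (1 + x `^ (- 2^-1))) ->
  regular T K f.
Proof.
move=> cf df df' fK f'K f''K; split=> //.
- suff L s t : 0 <= s -> s <= t -> t <= T -> `|f t - f s| <= K * (t - s).
    move=> s t /andP[s0 sT] /andP[t0 tT]; have [st|ts] := leP s t.
      by rewrite distrC [`|s - t|]distrC (ger0_norm (x := t - s)) ?subr_ge0// L.
    by rewrite (ger0_norm (x := s - t)) ?subr_ge0 ?L// ltW.
  move=> s0; rewrite le_eqVlt => /predU1P[->|st] tT; first by rewrite !subrr normr0 mulr0.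
  have [||c cP ->] := @MVT R f f' s t st.
  + by move=> x; rewrite in_itv/= => /andP[? ?]; apply: df; apply/andP; split; lra.
  + apply: continuous_subspaceW cf => x /=.
    by rewrite !in_itv/= => /andP[? ?]; apply/andP; split; lra.
  have ts0 : 0 <= t - s by rewrite subr_ge0 ltW.
  rewrite normrM (ger0_norm ts0) ler_wpM2r// f'K//.
  by move: cP; rewrite in_itv/= => /andP[? ?]; apply/andP; split; lra.
- move=> t h t0 h0 tT.
  have [T0|T0] := leP T 0.
    have -> : t = 0 by lra.
    have -> : h = 0 by lra.
    rewrite /second_diff mulr0 !addr0.
    have z (u : R) : u - 2 * u + u = 0 by ring.
    by rewrite !z normr0 mulr0.
  pose G c x := K * @modulus R x + c * f x.
  pose G' c x := K * (x + 2 * x `^ 2^-1) + c * f' x.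
  pose G'' c x := K * (1 + x `^ (- 2^-1)) + c * f'' x.
  have key c : `|c| = 1 -> 0 <= second_diff (G c) t h.
    move=> c1; have H := @convex_second_diff R T (G c) (G' c) (G'' c) t h.
    apply: H; [| | | |exact: t0|exact: h0|exact: tT].
    + move=> x; apply: cvgD; apply: cvgM; [exact: cvg_cst| |exact: cvg_cst|exact: cf].
      exact: modulus_continuous.
    + move=> x xT; have /andP[x0 _] := xT.
      exact: (is_deriveD (is_deriveZ K (is_derive_modulus x0)) (is_deriveZ c (df x xT))).
    + move=> x xT; have /andP[x0 _] := xT.
      exact: (is_deriveD (is_deriveZ K (is_derive_modulus' x0)) (is_deriveZ c (df' x xT))).
    + move=> x xT; have := f''K x xT; rewrite ler_norml /G'' => /andP[lo hi].
      have := c1; move/eqP; rewrite eqr_norml ler01 andbT => /orP[]/eqP->; lra.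
  have e c : second_diff (G c) t h = K * second_diff (@modulus R) t h + c * second_diff f t h.
    by rewrite /G /second_diff; ring.
  have := key 1 (normr1 _); have := key (- 1); rewrite normrN1 => /(_ erefl).
  by rewrite !e ler_norml => ? ?; apply/andP; split; lra.
Qed.

Lemma regular_mul (R : realType) (T K K' : R) (f g : R -> R) : 0 <= T ->
  regular T K f -> regular T K' g -> regular T (4 * K * K') (fun t => f t * g t).
Proof.
move=> T0 rf rg; have K0 := regular_ge0 T0 rf; have K'0 := regular_ge0 T0 rg.
have KK : 0 <= K * K' by rewrite mulr_ge0.
case: rf => bf lf df; case: rg => bg lg dg; split.
- move=> t tT; rewrite normrM; apply: (@le_trans _ _ (K * K')); last by lra.
  by apply: ler_pM => //; [exact: bf|exact: bg].
- move=> s t sT tT.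
  have -> : f s * g s - f t * g t = f s * (g s - g t) + (f s - f t) * g t by ring.
  apply: le_trans (ler_normD _ _) _; rewrite !normrM.
  have h1 : `|f s| * `|g s - g t| <= K * (K' * `|s - t|) by apply: ler_pM; rewrite ?bf ?lg.
  have h2 : `|f s - f t| * `|g t| <= K * `|s - t| * K' by apply: ler_pM; rewrite ?bg ?lf.
  have : 0 <= K * K' * `|s - t| by rewrite mulr_ge0.
  lra.
- move=> t h t0 h0 tT.
  have [t1T t2T t3T] : [/\ 0 <= t <= T, 0 <= t + h <= T & 0 <= t + 2 * h <= T].
    by split; apply/andP; split; lra.
  have hh := sqr_le_second_diff_modulus t0 h0.
  (* Discrete Leibniz rule around the midpoint; each of the four terms is at most [K * K' * m],
     whence the factor 4. *)
  have -> : second_diff (fun t => f t * g t) t h =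
    f (t + h) * second_diff g t h + g (t + h) * second_diff f t h
    + (f (t + 2 * h) - f (t + h)) * (g (t + 2 * h) - g (t + h))
    + (f t - f (t + h)) * (g t - g (t + h)) by rewrite /second_diff; ring.
  set m := second_diff (@modulus R) t h in hh *.
  have m0 : 0 <= m by apply: le_trans hh; exact: sqr_ge0.
  have d1 : `|t + 2 * h - (t + h)| = h by rewrite (_ : _ - _ = h) ?ger0_norm//; ring.
  have d2 : `|t - (t + h)| = h by rewrite (_ : _ - _ = - h) ?normrN ?ger0_norm//; ring.
  have KKh : K * K' * h ^+ 2 <= K * K' * m by rewrite ler_wpM2l.
  have f1 := lf _ _ t3T t2T; have f2 := lf _ _ t1T t2T.
  have g1 := lg _ _ t3T t2T; have g2 := lg _ _ t1T t2T.
  rewrite d1 in f1 g1; rewrite d2 in f2 g2.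
  have h1 : `|f (t + h) * second_diff g t h| <= K * (K' * m).
    by rewrite normrM; apply: ler_pM; rewrite ?bf ?dg.
  have h2 : `|g (t + h) * second_diff f t h| <= K' * (K * m).
    by rewrite normrM; apply: ler_pM; rewrite ?bg ?df.
  have h3 : `|(f (t + 2 * h) - f (t + h)) * (g (t + 2 * h) - g (t + h))| <= K * h * (K' * h).
    by rewrite normrM; apply: ler_pM.
  have h4 : `|(f t - f (t + h)) * (g t - g (t + h))| <= K * h * (K' * h).
    by rewrite normrM; apply: ler_pM.
  have n1 := ler_normD (f (t + h) * second_diff g t h + g (t + h) * second_diff f t h
    + (f (t + 2 * h) - f (t + h)) * (g (t + 2 * h) - g (t + h)))
    ((f t - f (t + h)) * (g t - g (t + h))).
  have n2 := ler_normD (f (t + h) * second_diff g t h + g (t + h) * second_diff f t h)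
    ((f (t + 2 * h) - f (t + h)) * (g (t + 2 * h) - g (t + h))).
  have n3 := ler_normD (f (t + h) * second_diff g t h) (g (t + h) * second_diff f t h).
  rewrite expr2 in KKh; lra.
Qed.

(** The function [c] plays the part of the derivative of [F], through a Taylor estimate on the range
    [S] only. The constant collects [B] for the supremum, [B K] for the linear term and [B K^2] for
    each of the two Taylor remainders. *)
Lemma regular_comp (R : realType) (T K B : R) (S : set R) (F c phi : R -> R) :
  0 <= T -> 0 <= B ->
  (forall x, S x -> `|F x| <= B) -> (forall x, S x -> `|c x| <= B) ->
  (forall x y, S x -> S y -> `|F x - F y| <= B * `|x - y|) ->
  (forall x y, S x -> S y -> `|F x - F y - c y * (x - y)| <= B * (x - y) ^+ 2) ->
  (forall t, 0 <= t <= T -> S (phi t)) ->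
  regular T K phi -> regular T (B * (1 + K + 2 * K ^+ 2)) (F \o phi).
Proof.
move=> T0 B0 FB cB FL FT phiS rphi; have K0 := regular_ge0 T0 rphi.
have BK : 0 <= B * K by rewrite mulr_ge0.
have BK2 : 0 <= B * K ^+ 2 by rewrite mulr_ge0 ?sqr_ge0.
case: rphi => bp lp dp; split.
- by move=> t tT /=; apply: le_trans (FB _ (phiS t tT)) _; lra.
- move=> s t sT tT /=; apply: le_trans (FL _ _ (phiS s sT) (phiS t tT)) _.
  apply: (@le_trans _ _ (B * (K * `|s - t|))); first by rewrite ler_wpM2l// lp.
  by rewrite mulrA ler_wpM2r//; lra.
- move=> t h t0 h0 tT.
  have [t1T t2T t3T] : [/\ 0 <= t <= T, 0 <= t + h <= T & 0 <= t + 2 * h <= T].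
    by split; apply/andP; split; lra.
  have hh := sqr_le_second_diff_modulus t0 h0.
  set m := second_diff (@modulus R) t h in hh *.
  have m0 : 0 <= m by apply: le_trans hh; exact: sqr_ge0.
  have d1 : `|t + 2 * h - (t + h)| = h by rewrite (_ : _ - _ = h) ?ger0_norm//; ring.
  have d2 : `|t - (t + h)| = h by rewrite (_ : _ - _ = - h) ?normrN ?ger0_norm//; ring.
  have f1 := lp _ _ t3T t2T; have f2 := lp _ _ t1T t2T.
  rewrite d1 in f1; rewrite d2 in f2.
  set p2 := phi (t + 2 * h) in f1 *; set p1 := phi (t + h) in f1 f2 *; set p0 := phi t in f2 *.
  have -> : second_diff (F \o phi) t h = c p1 * second_diff phi t h
    + (F p2 - F p1 - c p1 * (p2 - p1)) + (F p0 - F p1 - c p1 * (p0 - p1)).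
    by rewrite /second_diff /= -/p2 -/p1 -/p0; ring.
  have sq x : `|x| <= K * h -> B * x ^+ 2 <= B * (K ^+ 2 * m).
    move=> xK; rewrite ler_wpM2l// -real_normK ?num_real//.
    apply: (@le_trans _ _ ((K * h) ^+ 2)).
      by apply: lerXn2r; rewrite ?nnegrE ?mulr_ge0.
    by rewrite exprMn ler_wpM2l ?sqr_ge0.
  have n1 := ler_normD (c p1 * second_diff phi t h + (F p2 - F p1 - c p1 * (p2 - p1)))
    (F p0 - F p1 - c p1 * (p0 - p1)).
  have n2 := ler_normD (c p1 * second_diff phi t h) (F p2 - F p1 - c p1 * (p2 - p1)).
  have h1 : `|c p1 * second_diff phi t h| <= B * (K * m).
    by rewrite normrM; apply: ler_pM; rewrite ?cB ?dp//; exact: phiS.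
  have h2 := le_trans (FT p2 p1 (phiS _ t3T) (phiS _ t2T)) (sq _ f1).
  have h3 := le_trans (FT p0 p1 (phiS _ t1T) (phiS _ t2T)) (sq _ f2).
  have Bm : 0 <= B * m by rewrite mulr_ge0.
  lra.
Qed.

Lemma regular_scale (R : realType) (T K z : R) (phi : R -> R) :
  0 <= z <= 1 -> 0 <= T -> regular T K phi -> regular T K (fun t => phi (t * z)).
Proof.
move=> z01 T0 rphi; have K0 := regular_ge0 T0 rphi; have /andP[z0 z1] := z01.
case: rphi => b l d.
have zT t : 0 <= t <= T -> 0 <= t * z <= T.
  move=> /andP[t0 tT]; rewrite mulr_ge0//= (le_trans _ tT)// ler_piMr//.
split.
- by move=> t tT; apply: b; exact: zT.
- move=> s t sT tT; apply: le_trans (l _ _ (zT s sT) (zT t tT)) _.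
  by rewrite ler_wpM2l// -mulrBl normrM (ger0_norm z0) ler_piMr.
- move=> t h t0 h0 tT.
  have -> : second_diff (fun t => phi (t * z)) t h = second_diff phi (z * t) (z * h).
    by rewrite /second_diff; congr (phi _ - 2 * phi _ + phi _); ring.
  have := second_diff_modulus_scale z01 t0 h0 => H.
  apply: le_trans (ler_wpM2l K0 H); apply: d; rewrite ?mulr_ge0//.
  have : z * (t + 2 * h) <= t + 2 * h by rewrite ler_piMl// addr_ge0// mulr_ge0.
  lra.
Qed.

(** Each clause bounds a linear expression in [phi s] by a multiple of [W s], so it passes under the
    integral. *)
Lemma regular_integral (R : realType) (T : R) (D : set (measurableTypeR R)) (W : R -> R)
    (phi : R -> R -> R) : measurable D -> 0 <= T ->
  (@lebesgue_measure R).-integrable D (EFin \o W) ->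
  (forall t, 0 <= t <= T -> measurable_fun D (phi^~ t)) ->
  (forall s, D s -> regular T (W s) (phi s)) ->
  regular T (\int[lebesgue_measure]_(s in D) W s)
    (fun t => \int[lebesgue_measure]_(s in D) phi s t).
Proof.
move=> mD T0 iW mphi rphi.
have W0 s : D s -> 0 <= W s by move=> Ds; exact: regular_ge0 (rphi s Ds).
have iphi t : 0 <= t <= T -> (@lebesgue_measure R).-integrable D (EFin \o phi^~ t).
  move=> tT; apply: le_integrable iW => //; first by apply/measurable_EFinP; exact: mphi.
  move=> s Ds; rewrite lee_fin (ger0_norm (W0 s Ds)).
  by case: (rphi s Ds) => + _ _; apply.
have bound (f : R -> R) c : (@lebesgue_measure R).-integrable D (EFin \o f) ->
    (forall s, D s -> `|f s| <= W s * c) ->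
    `|\int[lebesgue_measure]_(s in D) f s| <= (\int[lebesgue_measure]_(s in D) W s) * c.
  move=> int fW; apply: le_trans (le_normr_Rintegral mD int) _.
  rewrite -RintegralZr//; apply: le_Rintegral => //; first exact: integrable_norm.
  by have := (fun m => integrableZr m c iW) mD.
split.
- move=> t tT; rewrite -[leRHS]mulr1; apply: bound; first exact: iphi.
  by move=> s Ds; rewrite mulr1; case: (rphi s Ds) => + _ _; apply.
- move=> s t sT tT; rewrite -RintegralB//; [|exact: iphi..].
  apply: bound; last by move=> r Dr; case: (rphi r Dr) => _ + _; apply.
  by have := (fun m => integrableB m (iphi s sT) (iphi t tT)) mD.
- move=> t h t0 h0 tT.
  have [t1T t2T t3T] : [/\ 0 <= t <= T, 0 <= t + h <= T & 0 <= t + 2 * h <= T].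
    by split; apply/andP; split; lra.
  have i1 := (fun m => integrableZl m 2 (iphi _ t2T)) mD.
  have i2 := (fun m => integrableB m (iphi _ t3T) i1) mD.
  have i3 := (fun m => integrableD m i2 (iphi _ t1T)) mD.
  have -> : second_diff (fun t => \int[lebesgue_measure]_(s in D) phi s t) t h
     = \int[lebesgue_measure]_(s in D) second_diff (phi s) t h.
    rewrite /second_diff RintegralD//; last exact: iphi.
    rewrite RintegralB//; last exact: iphi.
    by rewrite RintegralZl//; exact: iphi.
  apply: bound; first exact: i3.
  by move=> s Ds; case: (rphi s Ds) => _ _; apply.
Qed.

(** * Regularity of [g] *)

Lemma derivable_on_cvg (R : realType) (D : set R) (phi : R -> R) x :
  derivable_on D phi -> D x ->
  diff_quotient phi x s @[s --> within (D `\ x) (nbhs x)] --> derive_on D phi x.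
Proof. by move=> dphi Dx; exact: dphi. Qed.

Lemma derivable_on_continuous (R : realType) (D : set R) (phi : R -> R) :
  derivable_on D phi -> {within D, continuous phi}.
Proof.
move=> dphi; apply/subspace_continuousP => x Dx.
have /cvgrPdist_lt /(_ 1 ltr01) := derivable_on_cvg dphi Dx.
set l := derive_on D phi x; rewrite near_withinE => q1.
apply/cvgrPdist_lt => e e0; rewrite near_withinE.
have l1 : 0 < `|l| + 1 by rewrite ltr_wpDl.
near=> s => Ds; have [->|sx] := eqVneq s x; first by rewrite subrr normr0.
have q1s : (D `\ x) s -> `|l - diff_quotient phi x s| < 1 by near: s; exact: q1.
have Ql : `|diff_quotient phi x s| <= `|l| + 1.
  have := q1s (conj Ds (elimN eqP sx)).
  have := ler_normB l (l - diff_quotient phi x s); rewrite subKr; lra.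
have xs : `|x - s| < e / (`|l| + 1).
  by near: s; exact: (nbhsx_ballx x _ (divr_gt0 e0 l1)).
have sx0 : s - x != 0 by rewrite subr_eq0.
have -> : phi x - phi s = - (diff_quotient phi x s * (s - x)).
  by rewrite /diff_quotient divfK// opprB.
rewrite normrN normrM -[X in _ * X]distrC (le_lt_trans (ler_wpM2r (normr_ge0 _) Ql))//.
by rewrite mulrC -ltr_pdivlMr.
Unshelve. all: by end_near. Qed.

(** Near an interior point the segment fills a neighbourhood, so the limit within the segment is the
    two-sided one. *)
Lemma derivable_on_is_derive (R : realType) (a b x : R) (phi : R -> R) :
  derivable_on `[a, b] phi -> a < x < b ->
  is_derive x (1 : R) phi (derive_on `[a, b] phi x).
Proof.
move=> dphi xab; have Dx : `[a, b]%classic x.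
  by rewrite /= in_itv/=; case/andP: xab => ? ?; apply/andP; split; exact: ltW.
have xab' : x \in `]a, b[ by rewrite in_itv.
have q := derivable_on_cvg dphi Dx.
have c : h^-1 *: (phi (h *: (1 : R) + x) - phi x) @[h --> 0^'] --> derive_on `[a, b] phi x.
  have s0 : h + x @[h --> 0^'] --> within (`[a, b] `\ x) (nbhs x).
    move=> P; rewrite /within /= => nP.
    have c0 : h + x @[h --> (0 : R)] --> x.
      by rewrite -[X in _ --> X]add0r; apply: cvgD; [exact: cvg_id|exact: cvg_cst].
    have c1 : \forall h \near (0 : R)^', (`[a, b] `\ x)%classic (h + x) -> P (h + x).
      by apply: cvg_within; exact: (c0 _ nP).
    have c2 : \forall h \near (0 : R)^', h + x \in `]a, b[.
      by apply: cvg_within; exact: (c0 _ (near_in_itvoo xab')).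
    change (\forall h \near (0 : R)^', P (h + x)); near=> h.
    have h0 : h != 0 by near: h; exact: nbhs_dnbhs_neq.
    have P1 : (`[a, b] `\ x)%classic (h + x) -> P (h + x).
      by near: h; exact: c1.
    have P2 : (h + x) \in `]a, b[ by near: h; exact: c2.
    apply: P1; split; first exact: subset_itv_oo_cc P2.
    by move=> /eqP; rewrite -subr_eq0 addrK (negbTE h0).
  have c' : diff_quotient phi x (h + x) @[h --> 0^'] --> derive_on `[a, b] phi x.
    exact: (cvg_comp _ _ s0 q).
  apply: cvg_trans c'; apply: near_eq_cvg; near=> h.
  rewrite /= /diff_quotient addrK mulrC; congr (_ * (phi _ - _)).
  by rewrite /GRing.scale/= mulr1.
by split; [apply/cvg_ex; eexists; exact: c|exact: cvg_lim c].
Unshelve. all: by end_near. Qed.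

(** As [alpha'(0) = 0], the mean value theorem from 0 gives [|alpha'(x)| <= K x]; a second use gives
    the quadratic bound on [alpha 0 - alpha x]. These rates compensate the factors [1 / x] and
    [1 / x^2] produced by differentiating against [ln]. *)
Lemma admissible_bounds (R : realType) (T : R) (alpha : R -> R) :
  0 < T -> admissible_exponent T alpha ->
  let a1 := nderive_on `[0, T] 1 alpha in
  let a2 := nderive_on `[0, T] 2 alpha in
  {within `[0, T], continuous alpha} /\
  exists K, [/\ 0 <= K,
    forall x : R, 0 < x < T ->
      is_derive x (1 : R) alpha (a1 x) /\ is_derive x (1 : R) a1 (a2 x),
    forall x, 0 <= x <= T -> `|a1 x| <= K /\ `|a2 x| <= K,
    forall x, 0 <= x <= T -> `|a1 x| <= K * x &
    forall x, 0 <= x <= T -> `|alpha 0 - alpha x| <= K * x ^+ 2].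
Proof.
move=> T0 [_ dalpha [K Kb] a10] a1 a2.
have d0 : derivable_on `[0, T] alpha := dalpha 0%N isT.
have d1 : derivable_on `[0, T] a1 := dalpha 1%N isT.
have c0 := derivable_on_continuous d0; have c1 := derivable_on_continuous d1.
split=> //; exists K.
have ab x : 0 <= x <= T -> `|a1 x| <= K /\ `|a2 x| <= K.
  move=> /Kb h; have {}h : `|a1 x| + `|a2 x| + `|nderive_on `[0, T] 3 alpha x| <= K by exact: h.
  move: h; move: (a1 x) (a2 x) (nderive_on _ 3 _ x) => r1 r2 r3 h.
  have := normr_ge0 r1; have := normr_ge0 r2; have := normr_ge0 r3; split; lra.
have K0 : 0 <= K.
  have T00 : 0 <= (0 : R) <= T by apply/andP; split => //; exact: ltW.
  exact: le_trans (normr_ge0 _) (ab 0 T00).1.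
have der x : 0 < x < T ->
    is_derive x (1 : R) alpha (a1 x) /\ is_derive x (1 : R) a1 (a2 x).
  by move=> xT; split; [exact: (derivable_on_is_derive d0)|exact: (derivable_on_is_derive d1)].
have sub (f : R -> R) x : x <= T -> {within `[0, T], continuous f} -> {within `[0, x], continuous f}.
  move=> xT; apply: continuous_subspaceW => y /=.
  by rewrite !in_itv/= => /andP[? ?]; apply/andP; split; lra.
have b1 x : 0 <= x <= T -> `|a1 x| <= K * x.
  rewrite le_eqVlt => /andP[/predU1P[<-|x0] xT]; first by rewrite /a1 a10 normr0 mulr0.
  have [|c cP e] := MVT x0 _ (sub _ _ xT c1) (df := a2).
    by move=> y; rewrite in_itv/= => /andP[y0 yx]; apply: (der y _).2; rewrite y0; lra.
  move: cP; rewrite in_itv/= => /andP[c0' cx].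
  have -> : a1 x = a2 c * x by rewrite -[LHS]subr0 -[in LHS]a10 e subr0.
  by rewrite normrM (gtr0_norm x0) ler_wpM2r ?(ltW x0)//; apply: (ab c _).2; lra.
split=> // x; rewrite le_eqVlt => /andP[/predU1P[<-|x0] xT].
  by rewrite subrr normr0 expr0n/= mulr0.
have [|c cP e] := MVT x0 _ (sub _ _ xT c0) (df := a1).
  by move=> y; rewrite in_itv/= => /andP[y0 yx]; apply: (der y _).1; rewrite y0; lra.
move: cP; rewrite in_itv/= => /andP[c0' cx].
rewrite distrC e subr0 normrM (gtr0_norm x0) expr2 mulrA ler_wpM2r ?(ltW x0)//.
apply: le_trans (b1 c _) _; first by lra.
by rewrite ler_wpM2l// ltW.
Qed.

(** The continuous [alpha] attains its extrema on the segment, so its values stay at a positive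
    distance from 1 and 2. *)
Lemma admissible_range (R : realType) (T : R) (alpha : R -> R) :
  0 < T -> admissible_exponent T alpha ->
  exists2 d, 0 < d & forall t, 0 <= t <= T -> 1 + d <= alpha t /\ alpha t <= 2 - d.
Proof.
move=> T0 aok; have [cont _] := admissible_bounds T0 aok; case: aok => a12 _ _ _.
have [M MT MP] := EVT_max (ltW T0) cont; have [m mT mP] := EVT_min (ltW T0) cont.
rewrite !in_itv/= in MT mT.
have /andP[M1 M2] := a12 M MT; have /andP[m1 m2] := a12 m mT.
exists (Num.min (alpha m - 1) (2 - alpha M)); first by rewrite lt_min !subr_gt0 m1.
move=> t tT; have t' : t \in `[0, T] by rewrite in_itv.
have := MP t t'; have := mP t t'.
have : Num.min (alpha m - 1) (2 - alpha M) <= alpha m - 1 by rewrite ge_min lexx.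
have : Num.min (alpha m - 1) (2 - alpha M) <= 2 - alpha M by rewrite ge_min lexx orbT.
by move=> *; split; lra.
Qed.

(** [ln x < x] at [x = s] and at [x = s^(-1/2)]. *)
Lemma norm_ln_le (R : realType) (T s : R) : 0 < s <= T ->
  `|ln s| <= T + 2 * s `^ (- 2^-1).
Proof.
move=> /andP[s0 sT]; have p0 : 0 < s `^ (- 2^-1) by exact: powR_gt0.
have l1 := ln_sublinear s0; have l2 := ln_sublinear p0.
rewrite ln_powR in l2; rewrite ler_norml; apply/andP; split; lra.
Qed.

Lemma regular_alpha (R : realType) (T : R) (alpha : R -> R) :
  0 < T -> admissible_exponent T alpha -> exists K, regular T K alpha.
Proof.
move=> T0 aok; have [cont [K [K0 der ab _ _]]] := admissible_bounds T0 aok.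
case: aok => a12 _ _ _; exists (2 + K).
have oo x : 0 < x < T -> 0 <= x <= T by move=> /andP[? ?]; apply/andP; split; lra.
apply: (regular_C2 cont (fun x xT => (der x xT).1) (fun x xT => (der x xT).2)).
- by move=> t /a12 /andP[? ?]; rewrite ger0_norm; lra.
- by move=> t /oo /ab [? _]; lra.
- move=> t tT; have [_ h] := ab _ (oo _ tT); apply: (le_trans h).
  have := powR_ge0 t (- 2^-1); nra.
Qed.

(** In the second derivative the terms [alpha' / s] and [(alpha 0 - alpha) / s^2] are bounded by
    [admissible_bounds]; only [alpha'' * ln s] is singular, and [norm_ln_le] bounds it in terms of
    [s^(-1/2)]. The function itself tends to 0 at 0 because it is [O(s)]. *)
Lemma regular_alpha_ln (R : realType) (T : R) (alpha : R -> R) :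
  0 < T -> admissible_exponent T alpha ->
  exists K, regular T K (fun s => (alpha 0 - alpha s) * ln s).
Proof.
move=> T0 aok; have [cont [K [K0 der ab a1b a0b]]] := admissible_bounds T0 aok.
set a1 := nderive_on _ 1 _ in der ab a1b; set a2 := nderive_on _ 2 _ in der ab.
have oo x : 0 < x < T -> 0 <= x <= T by move=> /andP[? ?]; apply/andP; split; lra.
pose M := T ^+ 2 + 2 * T `^ 2^-1.
have M0 : 0 <= M by rewrite addr_ge0 ?sqr_ge0// mulr_ge0 ?powR_ge0.
have sln s : 0 < s <= T -> s * `|ln s| <= M.
  move=> sT; have /andP[s0 s1] := sT.
  apply: (@le_trans _ _ (s * (T + 2 * s `^ (- 2^-1)))).
    by apply: ler_wpM2l; [exact: ltW|exact: norm_ln_le].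
  have -> : s * (T + 2 * s `^ (- 2^-1)) = s * T + 2 * s `^ 2^-1.
    rewrite mulrDr mulrCA; congr (_ + 2 * _); rewrite -[X in X * _]powRr1 ?(ltW s0)//.
    by rewrite -powRD ?(gt_eqF s0) ?implybT//; congr (_ `^ _); field.
  rewrite /M expr2; apply: lerD; first by rewrite ler_wpM2r// (ltW T0).
  by rewrite ler_wpM2l//; apply: ge0_ler_powR => //; rewrite nnegrE ltW.
pose e s := (alpha 0 - alpha s) * ln s.
pose e' s := - (a1 s * ln s) + (alpha 0 - alpha s) / s.
pose e'' s := - (a2 s * ln s) - 2 * a1 s / s - (alpha 0 - alpha s) / s ^+ 2.
have eM s : 0 < s <= T -> `|e s| <= K * M * s.
  move=> sT; have /andP[s0 s1] := sT; rewrite normrM.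
  apply: (@le_trans _ _ (K * s ^+ 2 * `|ln s|)).
    by rewrite ler_wpM2r// a0b// s1 ltW.
  rewrite (_ : K * s ^+ 2 * `|ln s| = K * s * (s * `|ln s|)); last by ring.
  have := ler_wpM2l (mulr_ge0 K0 (ltW s0)) (sln s sT); lra.
(* One constant above [K M T] for the function, [K M + K T] for its derivative, and the factors
   [K (T + 3)] and [2 K] of 1 and [x^(-1/2)] for its second derivative. *)
exists (K * (M * (T + 1) + T + 3)).
apply: (@regular_C2 R T _ e e' e'').
- apply/continuous_within_itvP => //; split.
  + move=> x; rewrite in_itv/= => xT; apply: cvgM.
      apply: cvgB; first exact: cvg_cst.
      apply/differentiable_continuous/derivable1_diffP.
      by have [[]] := der x xT.
    by apply: continuous_ln; case/andP: xT.
  + change (e x @[x --> (0 : R)^'+] --> e 0).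
    have -> : e 0 = 0 by rewrite /e subrr mul0r.
    apply: norm_cvg0.
    have c0 : K * M * x @[x --> (0 : R)^'+] --> (0 : R).
      rewrite -[X in _ --> X](mulr0 (K * M)); apply: cvg_at_right_filter.
      exact: mulrl_continuous.
    apply: (squeeze_cvgr _ (cvg_cst 0) c0); near=> x.
    rewrite normr_ge0 /=; apply: eM; apply/andP; split; first by near: x; exact: nbhs_right_gt.
    by near: x; exact: nbhs_right_le.
  + apply: cvgM.
      apply: cvgB; first exact: cvg_cst.
      by have /continuous_within_itvP[] := cont.
    by apply: cvg_at_left_filter; exact: continuous_ln.
- move=> x xT; have [d0 d1] := der x xT; have /andP[x0 _] := xT.
  have h := is_deriveM (is_deriveB (is_derive_cst (alpha 0) x (1 : R)) d0) (is_derive1_ln x0).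
  apply: (is_derive_eq h); rewrite /GRing.scale/= /e'.
  change ((cst (alpha 0) - alpha) x) with (alpha 0 - alpha x); ring.
- move=> x xT; have [d0 d1] := der x xT; have /andP[x0 _] := xT.
  have xn : x != 0 by rewrite gt_eqF.
  have h1 := is_deriveN (is_deriveM d1 (is_derive1_ln x0)).
  have h2 := is_deriveB (is_derive_cst (alpha 0) x (1 : R)) d0.
  have h3 := @is_deriveV R id x 1 1 xn (is_derive_id x (1 : R)).
  have h := is_deriveD h1 (is_deriveM h2 h3).
  apply: (is_derive_eq h); rewrite /GRing.scale/= /e''.
  change ((cst (alpha 0) - alpha) x) with (alpha 0 - alpha x).
  by field.
- move=> x /andP[]; rewrite le_eqVlt => /predU1P[<- _|x0 xT].
    rewrite /e subrr mul0r normr0 mulr_ge0//; have : 0 <= M * (T + 1); last by lra.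
    by rewrite mulr_ge0//; lra.
  have xTT : 0 < x <= T by rewrite x0.
  apply: (le_trans (eM x xTT)).
  have KM : 0 <= K * M by rewrite mulr_ge0.
  have := ler_wpM2l KM xT; have : 0 <= K * T by rewrite mulr_ge0// ltW. 
  lra.
- move=> x xT; have /andP[x0 x1] := xT; have xT' := oo x xT.
  have xT'' : 0 < x <= T by rewrite x0 ltW.
  apply: (le_trans (ler_normD _ _)); rewrite normrN !normrM normfV (gtr0_norm x0).
  have h1 : `|a1 x| * `|ln x| <= K * M.
    apply: (@le_trans _ _ (K * x * `|ln x|)); first by rewrite ler_wpM2r// a1b.
    by rewrite -mulrA ler_wpM2l// sln.
  have h2 : `|alpha 0 - alpha x| / x <= K * T.
    rewrite ler_pdivrMr//; apply: (le_trans (a0b x xT')).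
    by rewrite expr2 mulrA ler_wpM2r ?(ltW x0)// ler_wpM2l// ltW.
  have KMT : 0 <= K * M * T by rewrite !mulr_ge0// ltW.
  lra.
- move=> x xT; have /andP[x0 x1] := xT; have xT' := oo x xT.
  have xT'' : 0 < x <= T by rewrite x0 ltW.
  have [_ h] := ab x xT'.
  have h1 : `|a2 x * ln x| <= K * (T + 2 * x `^ (- 2^-1)).
    by rewrite normrM; apply: ler_pM => //; exact: norm_ln_le.
  have h2 : `|2 * a1 x / x| <= 2 * K.
    rewrite !normrM normfV (gtr0_norm x0) ger0_norm// -mulrA ler_wpM2l//.
    by rewrite ler_pdivrMr// a1b.
  have h3 : `|(alpha 0 - alpha x) / x ^+ 2| <= K.
    by rewrite normrM normfV normrX (gtr0_norm x0) ler_pdivrMr ?exprn_gt0// a0b.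
  have n1 := ler_normB (- (a2 x * ln x) - 2 * a1 x / x) ((alpha 0 - alpha x) / x ^+ 2).
  have n2 := ler_normB (- (a2 x * ln x)) (2 * a1 x / x).
  rewrite normrN in n2; have p0 := powR_ge0 x (- 2^-1).
  have KMT : 0 <= K * (M * (T + 1)) by rewrite !mulr_ge0// addr_ge0// ltW.
  have KT : 0 <= K * T by rewrite mulr_ge0// ltW.
  have KMTp : 0 <= K * (M * (T + 1)) * x `^ (- 2^-1) by rewrite mulr_ge0.
  have KTp : 0 <= K * T * x `^ (- 2^-1) by rewrite mulr_ge0.
  have Kp : 0 <= K * x `^ (- 2^-1) by rewrite mulr_ge0.
  rewrite /e''; lra.
Unshelve. all: by end_near. Qed.

(** * Composition with the exponential, the Gamma integral and the inverse *)

Lemma expR_lip (R : realType) (M u v : R) : expR u <= M -> expR v <= M ->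
  `|expR u - expR v| <= M * `|u - v|.
Proof.
wlog uv : u v / v <= u.
  move=> H uM vM; have [vu|uv] := leP v u; first exact: H.
  by rewrite distrC [`|u - v|]distrC; apply: H => //; exact: ltW.
move=> uM vM; have uv0 : 0 <= u - v by rewrite subr_ge0.
have E : expR v = expR u * expR (v - u) by rewrite -expRD; congr expR; ring.
rewrite (ger0_norm uv0) ger0_norm ?subr_ge0 ?ler_expR//.
have := expR_ge1Dx (v - u); have := expR_gt0 u; rewrite E; nra.
Qed.

(** By [1 + x <= exp x] the remainder is nonnegative and at most [(exp u - exp v) (u - v)], to which
    the Lipschitz bound applies. *)
Lemma expR_taylor (R : realType) (M u v : R) : expR u <= M -> expR v <= M ->
  `|expR u - expR v - expR v * (u - v)| <= M * (u - v) ^+ 2.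
Proof.
move=> uM vM; have lip := expR_lip uM vM.
have E1 : expR v = expR u * expR (v - u) by rewrite -expRD; congr expR; ring.
have E2 : expR u = expR v * expR (u - v) by rewrite -expRD; congr expR; ring.
have h1 : expR u * (1 + (v - u)) <= expR v by rewrite E1 ler_wpM2l ?expR_ge0 ?expR_ge1Dx.
have h2 : expR v * (1 + (u - v)) <= expR u by rewrite E2 ler_wpM2l ?expR_ge0 ?expR_ge1Dx.
rewrite ger0_norm; last by lra.
apply: (@le_trans _ _ ((expR u - expR v) * (u - v))); first by lra.
apply: le_trans (ler_norm _) _; rewrite normrM.
apply: le_trans (ler_wpM2r (normr_ge0 _) lip) _.
by rewrite -mulrA -normrM -expr2 ger0_norm ?sqr_ge0.
Qed.

Lemma powR_le_ends (R : realType) (a b c s : R) : 0 < s -> a <= c -> c <= b ->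
  s `^ c <= s `^ a + s `^ b.
Proof.
move=> s0 ac cb; have a0 := powR_ge0 s a; have b0 := powR_ge0 s b.
have [s1|s1] := leP s 1.
  have : s `^ c <= s `^ a by apply: ger_powR => //; rewrite s0.
  lra.
have : s `^ c <= s `^ b by apply: ler_powR => //; exact: ltW.
lra.
Qed.

Lemma norm_ln_le_powR (R : realType) (e s : R) : 0 < e -> 0 < s ->
  `|ln s| <= (s `^ e + s `^ (- e)) / e.
Proof.
move=> e0 s0; have l1 := ln_sublinear (powR_gt0 e s0).
have l2 := ln_sublinear (powR_gt0 (- e) s0); rewrite !ln_powR in l1 l2.
have p1 := powR_ge0 s e; have p2 := powR_ge0 s (- e).
by rewrite ler_pdivlMr// -[X in _ * X <= _](gtr0_norm e0) -normrM ler_norml; apply/andP; split; lra.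
Qed.

(** An integrable majorant of the Gamma integrand times 1, [|ln s|] and [ln s ^+ 2], uniform over
    exponents at distance [d] from the critical ones. Half of the margin [d] pays for the
    logarithms, through [|ln s| <= (s^(d/4) + s^(-d/4)) * 4 / d]; the numerical constant is
    generous. *)
Definition gamma_bound (R : realType) (d s : R) : R :=
  (4 + 256 / d ^+ 2) * (s `^ (-1 + d / 2) + s `^ 1) * expR (- s).

Lemma gamma_bound_ge (R : realType) (d s x : R) : 0 < d -> 0 < s ->
  1 + d <= x -> x <= 2 - d ->
  s `^ (1 - x) * (1 + `|ln s| + ln s ^+ 2) * expR (- s) <= gamma_bound d s.
Proof.
move=> d0 s0 x1 x2; rewrite /gamma_bound ler_wpM2r ?expR_ge0//.
set P := s `^ (-1 + d / 2) + s `^ 1.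
have Ple c : -1 + d / 2 <= c -> c <= 1 -> s `^ c <= P by move=> ? ?; exact: powR_le_ends.
have e0 : 0 < d / 4 by rewrite divr_gt0.
have L := norm_ln_le_powR e0 s0.
set a := s `^ (d / 4) in L; set b := s `^ (- (d / 4)) in L.
have a0 : 0 <= a by exact: powR_ge0. 
have b0 : 0 <= b by exact: powR_ge0.
have y0 := powR_ge0 s (1 - x); set y := s `^ (1 - x) in y0 *.
have sn : (s == 0) = false by rewrite gt_eqF.
have ya : y * a ^+ 2 <= P.
  have -> : y * a ^+ 2 = s `^ (1 - x + d / 2).
    by rewrite expr2 /y /a -!powRD ?sn/= ?implybT//; congr (_ `^ _); field.
  by apply: Ple; lra.
have yb : y * b ^+ 2 <= P.
  have -> : y * b ^+ 2 = s `^ (1 - x - d / 2).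
    by rewrite expr2 /y /b -!powRD ?sn/= ?implybT//; congr (_ `^ _); field.
  by apply: Ple; lra.
have yP : y <= P by rewrite /y; apply: Ple; lra.
have L2 : ln s ^+ 2 <= 32 / d ^+ 2 * (a ^+ 2 + b ^+ 2).
  rewrite -real_normK ?num_real//.
  have h : `|ln s| ^+ 2 <= ((a + b) / (d / 4)) ^+ 2.
    by apply: lerXn2r; rewrite ?nnegrE// divr_ge0 ?addr_ge0// ltW.
  apply: le_trans h _; have -> : ((a + b) / (d / 4)) ^+ 2 = 16 / d ^+ 2 * (a + b) ^+ 2.
    by field; rewrite gt_eqF.
  have -> : 32 / d ^+ 2 * (a ^+ 2 + b ^+ 2) = 16 / d ^+ 2 * (2 * (a ^+ 2 + b ^+ 2)) by ring.
  rewrite ler_wpM2l ?divr_ge0 ?sqr_ge0//; have := sqr_ge0 (a - b); lra.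
have L1 : `|ln s| <= 1 + ln s ^+ 2.
  rewrite -[ln s ^+ 2]real_normK ?num_real//; have := sqr_ge0 (`|ln s| - 1).
  have := normr_ge0 (ln s); nra.
have D0 : 0 <= 32 / d ^+ 2 by rewrite divr_ge0 ?sqr_ge0.
apply: (@le_trans _ _ (y * (2 + 2 * (32 / d ^+ 2 * (a ^+ 2 + b ^+ 2))))).
  by rewrite ler_wpM2l//; lra.
have -> : 256 / d ^+ 2 = 8 * (32 / d ^+ 2) by ring.
have h1 := ler_wpM2l D0 ya; have h2 := ler_wpM2l D0 yb.
have P0 : 0 <= P by rewrite addr_ge0 ?powR_ge0.
have DP : 0 <= 32 / d ^+ 2 * P by rewrite mulr_ge0.
lra.
Qed.

Lemma integrable_gamma_bound (R : realType) (d : R) : 0 < d -> d <= 1 ->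
  (@lebesgue_measure R).-integrable `]0, +oo[ (EFin \o gamma_bound d).
Proof.
move=> d0 d1.
have c1 : -1 < -1 + d / 2 by lra.
have c2 : -1 + d / 2 <= 1 by lra.
have i1 := integrable_gamma c1 c2.
have i2 := @integrable_gamma R 1 ltac:(lra) (lexx _).
have i3 := (fun m => integrableD m i1 i2) (measurable_itv _).
have i4 := (fun m => integrableZl m (4 + 256 / d ^+ 2) i3) (measurable_itv _).
apply: eq_integrable i4 => //.
by move=> s _; rewrite /= -EFinD -EFinM /gamma_bound; congr EFin; ring.
Qed.

(** For fixed [s] the integrand is [x |-> s^(1 - x) exp (-s)] composed with [alpha]. Each derivative
    in [x] brings a factor [ln s], so [gamma_bound d s] is a constant for [regular_comp], and it is
    integrable in [s]. *)
Lemma regular_gamma (R : realType) (T K d : R) (alpha : R -> R) :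
  0 < T -> 0 < d -> (forall t, 0 <= t <= T -> 1 + d <= alpha t /\ alpha t <= 2 - d) ->
  regular T K alpha ->
  exists K', regular T K' (fun t => euler_gamma (2 - alpha t)).
Proof.
move=> T0 d0 ad ralpha.
have T00 : 0 <= (0 : R) <= T by apply/andP; split => //; exact: ltW.
have d1 : d <= 1 by have [] := ad 0 T00; lra.
pose k := 1 + K + 2 * K ^+ 2.
have ib := integrable_gamma_bound d0 d1.
have ik := (fun m => integrableZr m k ib) (measurable_itv _).
have e t : euler_gamma (2 - alpha t)
    = \int[@lebesgue_measure R]_(s in `]0, +oo[) (s `^ (1 - alpha t) * expR (- s)).
  by apply: eq_Rintegral => s _; congr (_ `^ _ * _); ring.
exists (\int[@lebesgue_measure R]_(s in `]0, +oo[) (gamma_bound d s * k)).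
have -> : (fun t => euler_gamma (2 - alpha t)) =
    (fun t => \int[@lebesgue_measure R]_(s in `]0, +oo[) (s `^ (1 - alpha t) * expR (- s))).
  by apply/funext.
apply: (@regular_integral R T _ (fun s => gamma_bound d s * k)
  (fun s t => s `^ (1 - alpha t) * expR (- s))) => //.
- exact: ltW.
- by move=> t _; exact: measurable_powR_expR.
- move=> s; rewrite /= in_itv/= andbT => s0.
  pose F x := s `^ (1 - x) * expR (- s).
  pose c x := - ln s * F x.
  pose w := 1 + `|ln s| + ln s ^+ 2.
  have w0 : 0 < w by rewrite /w -addrA ltr_wpDr// addr_ge0 ?sqr_ge0.
  have es : 0 < expR (- s) by exact: expR_gt0.
  (* Chosen so that [M * expR (- s)] times any of 1, [|ln s|], [ln s ^+ 2] is at most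
     [gamma_bound d s], while [M] still bounds [s^(1 - x)]. *)
  pose M := gamma_bound d s / (w * expR (- s)).
  have Mx x : 1 + d <= x /\ x <= 2 - d -> expR ((1 - x) * ln s) <= M.
    move=> [x1 x2]; rewrite -powR_expR// ler_pdivlMr ?mulr_gt0//.
    by rewrite mulrA; exact: gamma_bound_ge.
  have M0 : 0 <= M by apply: le_trans (Mx _ (ad 0 T00)); exact: expR_ge0.
  have ME : gamma_bound d s = M * expR (- s) * (1 + `|ln s| + ln s ^+ 2).
    by rewrite /M -/w; field; rewrite !gt_eqF.
  have Me : 0 <= M * expR (- s) by rewrite mulr_ge0// ltW.
  have Mel : 0 <= M * expR (- s) * `|ln s| by rewrite mulr_ge0.
  have Mel2 : 0 <= M * expR (- s) * ln s ^+ 2 by rewrite mulr_ge0 ?sqr_ge0.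
  have gb0 : 0 <= gamma_bound d s by rewrite ME; lra.
  have FE x : F x = expR ((1 - x) * ln s) * expR (- s) by rewrite /F powR_expR.
  have FM x : 1 + d <= x /\ x <= 2 - d -> `|F x| <= M * expR (- s).
    move=> xS; rewrite FE ger0_norm ?mulr_ge0 ?expR_ge0//.
    by rewrite ler_wpM2r ?expR_ge0// Mx.
  apply: (@regular_comp R T K (gamma_bound d s) [set x | 1 + d <= x /\ x <= 2 - d]
    F c alpha _ gb0) => //.
  + exact: ltW.
  + by move=> x /= /FM h; rewrite (le_trans h)// ME; lra.
  + move=> x /= /FM h; rewrite /c normrM normrN.
    have := ler_wpM2l (normr_ge0 (ln s)) h; rewrite ME; lra.
  + move=> x y /= /Mx hx /Mx hy; rewrite !FE -mulrBl normrM (ger0_norm (ltW es)).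
    have := ler_wpM2r (ltW es) (expR_lip hx hy).
    have -> : (1 - x) * ln s - (1 - y) * ln s = - (ln s * (x - y)) by ring.
    rewrite normrN normrM => h; rewrite (le_trans h)//.
    have -> : M * (`|ln s| * `|x - y|) * expR (- s)
      = M * expR (- s) * `|ln s| * `|x - y| by ring.
    by rewrite ler_wpM2r// ME; lra.
  + move=> x y /= /Mx hx /Mx hy; rewrite /c !FE.
    have := ler_wpM2r (ltW es) (expR_taylor hx hy).
    have -> : expR ((1 - x) * ln s) * expR (- s) - expR ((1 - y) * ln s) * expR (- s)
      - - ln s * (expR ((1 - y) * ln s) * expR (- s)) * (x - y)
      = (expR ((1 - x) * ln s) - expR ((1 - y) * ln s)
        - expR ((1 - y) * ln s) * ((1 - x) * ln s - (1 - y) * ln s)) * expR (- s) by ring.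
    rewrite normrM (ger0_norm (ltW es)) => h; rewrite (le_trans h)//.
    have -> : (1 - x) * ln s - (1 - y) * ln s = - (ln s * (x - y)) by ring.
    have -> : M * (- (ln s * (x - y))) ^+ 2 * expR (- s)
      = M * expR (- s) * ln s ^+ 2 * (x - y) ^+ 2 by ring.
    by rewrite ler_wpM2r ?sqr_ge0// ME; lra.
Qed.

Lemma regular_inv (R : realType) (T K m : R) (f : R -> R) : 0 <= T -> 0 < m ->
  (forall t, 0 <= t <= T -> m <= f t) -> regular T K f ->
  exists K', regular T K' (fun t => (f t)^-1).
Proof.
(* The three summands bound the inverse, its derivative, and the Taylor coefficient [1 / (x y^2)] in
   the exact remainder. *)
move=> T0 m0 fm rf; pose i := m^-1; pose B := i + i ^+ 2 + i ^+ 3.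
have i0 : 0 < i by rewrite invr_gt0.
have i2 : 0 < i ^+ 2 by rewrite exprn_gt0.
have i3 : 0 < i ^+ 3 by rewrite exprn_gt0.
have iv x : m <= x -> [/\ 0 < x^-1, x^-1 <= i & x != 0].
  move=> mx; have x0 : 0 < x by exact: lt_le_trans mx.
  by rewrite invr_gt0 lef_pV2 ?posrE// gt_eqF.
exists (B * (1 + K + 2 * K ^+ 2)).
apply: (@regular_comp R T K B [set x | m <= x] (fun x => x^-1) (fun x => - x^-1 ^+ 2)) => //=.
- by rewrite /B; lra.
- by move=> x /iv[h1 h2 _]; rewrite gtr0_norm// /B; lra.
- move=> x /iv[h1 h2 _]; rewrite normrN gtr0_norm ?exprn_gt0//.
  have : x^-1 ^+ 2 <= i ^+ 2 by apply: lerXn2r => //; rewrite nnegrE ltW.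
  rewrite /B; lra.
- move=> x y /iv[x1 x2 x3] /iv[y1 y2 y3].
  have -> : x^-1 - y^-1 = - (x^-1 * y^-1 * (x - y)) by field; rewrite ?x3 ?y3.
  rewrite normrN normrM ler_wpM2r// gtr0_norm ?mulr_gt0//.
  have : x^-1 * y^-1 <= i * i by apply: ler_pM => //; exact: ltW.
  rewrite -expr2 /B; lra.
- move=> x y /iv[x1 x2 x3] /iv[y1 y2 y3].
  have -> : x^-1 - y^-1 - - y^-1 ^+ 2 * (x - y) = x^-1 * (y^-1 ^+ 2) * (x - y) ^+ 2.
    by field; rewrite ?x3 ?y3.
  rewrite normrM [`|(x - y) ^+ 2|]ger0_norm ?sqr_ge0// ler_wpM2r ?sqr_ge0//.
  rewrite gtr0_norm ?mulr_gt0 ?exprn_gt0//.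
  have h2 : y^-1 ^+ 2 <= i ^+ 2 by apply: lerXn2r => //; rewrite nnegrE ltW.
  have : x^-1 * y^-1 ^+ 2 <= i * i ^+ 2.
    by apply: ler_pM; rewrite ?(ltW x1) ?exprn_ge0 ?(ltW y1).
  rewrite -exprS /B; lra.
Qed.

Lemma regular_mulr (R : realType) (T K w : R) (f : R -> R) : 0 <= w ->
  regular T K f -> regular T (K * w) (fun t => f t * w).
Proof.
move=> w0 [b l d]; split.
- by move=> t tT; rewrite normrM (ger0_norm w0) ler_wpM2r// b.
- move=> s t sT tT; rewrite -mulrBl normrM (ger0_norm w0) mulrAC.
  by rewrite ler_wpM2r// l.
- move=> t h t0 h0 tT; rewrite (_ : second_diff _ t h = second_diff f t h * w).
    by rewrite normrM (ger0_norm w0) mulrAC ler_wpM2r// d.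
  by rewrite /second_diff; ring.
Qed.

Lemma regular_expR (R : realType) (T K : R) (f : R -> R) : 0 <= T ->
  regular T K f -> exists K', regular T K' (fun t => expR (f t)).
Proof.
move=> T0 rf; exists (expR K * (1 + K + 2 * K ^+ 2)).
have bE x : `|x| <= K -> expR x <= expR K.
  by move=> xK; rewrite ler_expR (le_trans (ler_norm _)).
have bE' x : `|x| <= K -> `|expR x| <= expR K.
  by move=> xK; rewrite ger0_norm ?expR_ge0// bE.
apply: (@regular_comp R T K (expR K) [set x | `|x| <= K] expR expR f) => //=.
- by move=> x y /= /bE hx /bE hy; exact: expR_lip.
- by move=> x y /= /bE hx /bE hy; exact: expR_taylor.
- by case: rf.
Qed.

Lemma regular_measurable01 (R : realType) (T K t : R) (f : R -> R) :
  0 <= t <= T -> regular T K f ->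
  measurable_fun (`]0%R, 1%R[%classic : set R) (fun z => f (t * z)).
Proof.
move=> /andP[t0 tT] rf; have T0 : 0 <= T by exact: le_trans tT.
have K0 := regular_ge0 T0 rf; case: rf => _ lip _.
have tz z : 0 < z < 1 -> 0 <= t * z <= T.
  move=> /andP[z0 z1]; rewrite mulr_ge0 ?(ltW z0)//= (le_trans _ tT)//.
  by rewrite ler_piMr// ltW.
apply: open_continuous_measurable_fun; first exact: interval_open.
move=> z; rewrite inE/= in_itv/= => z01; apply/cvgrPdist_le => e e0.
have q0 : 0 < K * T + 1 by rewrite ltr_wpDl// mulr_ge0.
near=> y.
have y01 : 0 < y < 1.
  have : y \in `]0, 1[ by near: y; apply: near_in_itvoo; rewrite in_itv.
  by rewrite in_itv.
apply: le_trans (lip _ _ (tz z z01) (tz y y01)) _.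
have yz : `|z - y| < e / (K * T + 1).
  by near: y; exact: (nbhsx_ballx z _ (divr_gt0 e0 q0)).
rewrite -mulrBr normrM (ger0_norm t0) mulrA.
apply: (@le_trans _ _ ((K * T + 1) * `|z - y|)).
  by rewrite ler_wpM2r// (le_trans (ler_wpM2l K0 tT))// lerDl.
by rewrite mulrC -ler_pdivlMr// ltW.
Unshelve. all: by end_near. Qed.

(** The integrand of [g] without its singular weight. The power is written with [expR] so that at
    [s = 0] it takes its limit value 1. *)
Definition g_density (R : realType) (alpha : R -> R) (s : R) : R :=
  expR ((alpha 0 - alpha s) * ln s)
    * ((euler_gamma (2 - alpha s))^-1 * (euler_gamma (alpha 0 - 1))^-1).

(** At [t = 0] the density is the constant [1 / (Gamma (2 - alpha 0) Gamma (alpha 0 - 1))], the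
    inverse of the total mass of the weight. The convention [g 0 = 1] thus fits the integral
    formula, and regularity holds up to the end point. *)
Lemma g_kernelE (R : realType) (alpha : R -> R) (t : R) :
  0 < alpha 0 - 1 < 1 -> 0 <= t ->
  g_kernel alpha t = beta_integral (alpha 0 - 1) (fun z => g_density alpha (t * z)).
Proof.
move=> a01; rewrite le_eqVlt => /predU1P[<-|t0]; rewrite /g_kernel.
  rewrite eqxx; have -> : beta_integral (alpha 0 - 1) (fun z => g_density alpha (0 * z))
      = g_density alpha 0 * (euler_gamma (alpha 0 - 1) * euler_gamma (1 - (alpha 0 - 1))).
    have [_ iW _] := is_weight_beta a01.
    transitivity (\int[@lebesgue_measure R]_(z in `]0, 1[)
        (g_density alpha 0 * beta_weight (alpha 0 - 1) z)).
      by apply: eq_Rintegral => z _; rewrite mul0r.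
    by rewrite RintegralZl// (Rintegral_beta_weight a01).
  rewrite /g_density subrr mul0r expR0 mul1r.
  have -> : 1 - (alpha 0 - 1) = 2 - alpha 0 by ring.
  have /andP[a0 a1] := a01.
  have g1 : 0 < euler_gamma (alpha 0 - 1) by apply: euler_gamma_gt0; lra.
  have g2 : 0 < euler_gamma (2 - alpha 0) by apply: euler_gamma_gt0; lra.
  move: (euler_gamma _) (euler_gamma _) g1 g2 => p q p0 q0.
  by field; rewrite !gt_eqF.
rewrite gt_eqF//; apply: eq_Rintegral => z; rewrite inE/= in_itv/= => /andP[z0 z1].
rewrite -mulrA /beta_weight powR_expR ?mulr_gt0// /g_density invfM [X in _ * X * _]mulrC.
by congr (_ * (_ `^ _ * _ `^ _)); ring.
Qed.

Lemma regular_g_kernel (R : realType) (T : R) (alpha : R -> R) :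
  0 < T -> admissible_exponent T alpha -> exists K, regular T K (g_kernel alpha).
Proof.
move=> T0 aok; have T0' := ltW T0.
have T00 : 0 <= (0 : R) <= T by apply/andP; split.
have [Ka ra] := regular_alpha T0 aok.
have [Ke re] := regular_alpha_ln T0 aok.
have [d d0 ad] := admissible_range T0 aok.
have [Kg rg] := regular_gamma T0 d0 ad ra.
have [Kx rx] := regular_expR T0' re.
have m0 : 0 < expR (-1) / 2 :> R by rewrite divr_gt0 ?expR_gt0.
have gm t : 0 <= t <= T -> expR (-1) / 2 <= euler_gamma (2 - alpha t).
  by move=> /ad [? ?]; apply: euler_gamma_ge; lra.
have [Ki ri] := regular_inv T0' m0 gm rg.
have r1 := regular_mul T0' ri (regular_cst T (euler_gamma (alpha 0 - 1))^-1).
have r2 := regular_mul T0' rx r1.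
set K := (X in regular T X _) in r2.
have [ad1 ad2] := ad 0 T00.
have a01 : 0 < alpha 0 - 1 < 1 by apply/andP; split; lra.
have [mD iw w0] := is_weight_beta a01.
have iW := (fun m => integrableZl m K iw) mD.
exists (\int[@lebesgue_measure R]_(z in `]0, 1[) (K * beta_weight (alpha 0 - 1) z)).
have H := @regular_integral R T `]0, 1[ (fun z => K * beta_weight (alpha 0 - 1) z)
  (fun z t => g_density alpha (t * z) * beta_weight (alpha 0 - 1) z)
  (measurable_itv _) T0' iW.
have [b l dd] : regular T (\int[@lebesgue_measure R]_(z in `]0, 1[) (K * beta_weight (alpha 0 - 1) z))
  (fun t => beta_integral (alpha 0 - 1) (fun z => g_density alpha (t * z))).
  apply: H.
  - move=> t tT; apply: measurable_funM; last exact: measurable_beta_weight.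
    exact: regular_measurable01 tT r2.
  - move=> z; rewrite /= in_itv/= => /andP[z0 z1].
    apply: (regular_mulr (beta_weight_ge0 _ _)); apply: regular_scale => //.
    by apply/andP; split; exact: ltW.
split.
- by move=> t tT; rewrite g_kernelE//; [exact: b|case/andP: tT].
- move=> s t sT tT; have /andP[s0 _] := sT; have /andP[t0 _] := tT.
  by rewrite !g_kernelE//; exact: l.
- move=> t h t0 h0 tT; rewrite /second_diff !g_kernelE ?addr_ge0 ?mulr_ge0//.
  exact: dd.
Qed.

(** Needed only for the lower bound on [c0coef]. *)
Lemma g_kernel_ge0 (R : realType) (T : R) (alpha : R -> R) (t : R) :
  admissible_exponent T alpha -> 0 <= t <= T -> 0 <= g_kernel alpha t.
Proof.
move=> [a12 _ _ _] /andP[t0 tT]; rewrite /g_kernel; case: ifP => // _.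
apply: Rintegral_ge0 => z; rewrite /= in_itv/= => /andP[z0 z1].
have /a12/andP[s1 s2] : 0 <= t * z <= T.
  by rewrite mulr_ge0 ?(ltW z0)//= (le_trans _ tT)// ler_piMr// ltW.
have /a12/andP[b1 b2] : 0 <= (0 : R) <= T by rewrite lexx (le_trans t0).
rewrite !mulr_ge0 ?powR_ge0// invr_ge0 mulr_ge0//.
  by apply/ltW/euler_gamma_gt0; lra.
by apply/ltW/euler_gamma_gt0; lra.
Qed.

(** [wtilde 1] telescopes to [(g (2 tau) - g 0) / 2], which the Lipschitz clause bounds by [K tau].
    Each increment of [wtilde] is the average of two consecutive second differences of [g], and
    those sum up by [sum_second_diff_modulus]. *)
Lemma wtilde_bounds (R : realType) (T K tau : R) (alpha : R -> R) N :
  0 < T -> regular T K (g_kernel alpha) -> 0 <= tau -> N%:R * tau <= T ->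
  (1 < N)%N ->
  `|wtilde alpha tau 1|
    + \sum_(1 <= j < N.-1) `|wtilde alpha tau j.+1 - wtilde alpha tau j|
    <= K * (1 + (T + 2 * T `^ 2^-1)) * tau.
Proof.
move=> T0 rg tau0 NT N1; have K0 := regular_ge0 (ltW T0) rg.
case: rg => _ lip dd; case: N N1 NT => // -[//|N] _ NT.
have kT k : (k <= N.+2)%N -> 0 <= k%:R * tau <= T.
  move=> kN; rewrite mulr_ge0//= (le_trans _ NT)// ler_wpM2r// ler_nat//.
pose D k := second_diff (@modulus R) (k%:R * tau) tau.
have D0 k : 0 <= D k.
  by apply: le_trans (sqr_le_second_diff_modulus _ _); rewrite ?sqr_ge0 ?mulr_ge0.
have wD k : (k < N.+1)%N -> `|wcoef alpha tau k.+1 - wcoef alpha tau k| <= K * D k.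
  move=> kN; have -> : wcoef alpha tau k.+1 - wcoef alpha tau k
      = second_diff (g_kernel alpha) (k%:R * tau) tau.
    rewrite /wcoef /second_diff.
    have -> : k%:R * tau + 2 * tau = k.+2%:R * tau by rewrite -!natr1; ring.
    have -> : k%:R * tau + tau = k.+1%:R * tau by rewrite -!natr1; ring.
    move: (g_kernel alpha (k.+2%:R * tau)) (g_kernel alpha (k.+1%:R * tau)).
    by move: (g_kernel alpha _) => p q r; ring.
  apply: dd => //; first by rewrite mulr_ge0.
  have -> : k%:R * tau + 2 * tau = k.+2%:R * tau by rewrite -!natr1; ring.
  by have /andP[] := kT k.+2 kN.
rewrite mulrDr mulr1 mulrDl; apply: lerD.
  have -> : wtilde alpha tau 1 = (g_kernel alpha (2 * tau) - g_kernel alpha (0 * tau)) / 2.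
    rewrite /wtilde /wcoef; move: (g_kernel alpha (2 * tau)).
    by move: (g_kernel alpha (1 * tau)) (g_kernel alpha (0 * tau)) => p q r; ring.
  have := lip _ _ (kT 2 isT) (kT 0 isT); rewrite mul0r subr0 !normrM normfV.
  rewrite [`|2|]ger0_norm// (ger0_norm tau0) => h; rewrite ler_pdivrMr//; lra.
apply: (@le_trans _ _ (K * \sum_(0 <= k < N.+1) D k)); last first.
  rewrite -mulrA ler_wpM2l//; exact: sum_second_diff_modulus.
rewrite /= big_add1 /=.
apply: (@le_trans _ _ (\sum_(0 <= j < N) (K * D j.+1 + K * D j) / 2)).
  rewrite big_nat_cond [leRHS]big_nat_cond; apply: ler_sum => j.
  rewrite andbT => /andP[_ jN]; rewrite /wtilde.
  have -> : (wcoef alpha tau j.+2 + wcoef alpha tau j.+1) / 2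
    - (wcoef alpha tau j.+1 + wcoef alpha tau j) / 2
    = ((wcoef alpha tau j.+2 - wcoef alpha tau j.+1)
      + (wcoef alpha tau j.+1 - wcoef alpha tau j)) / 2.
    move: (wcoef alpha tau j.+2) (wcoef alpha tau j.+1) (wcoef alpha tau j) => p q r.
    by ring.
  rewrite normrM normfV [`|2|]ger0_norm// ler_wpM2r//.
  by apply: le_trans (ler_normD _ _) _; apply: lerD; apply: wD; rewrite ltnS// ltnW.
rewrite -mulr_suml big_split /= -!mulr_sumr.
have h1 : \sum_(0 <= k < N.+1) D k = D 0%N + \sum_(0 <= j < N) D j.+1 by rewrite big_nat_recl.
have h2 : \sum_(0 <= k < N.+1) D k = \sum_(0 <= j < N) D j + D N by rewrite big_nat_recr.
have l1 : K * \sum_(0 <= j < N) D j.+1 <= K * \sum_(0 <= k < N.+1) D k.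
  by rewrite ler_wpM2l// h1 lerDr.
have l2 : K * \sum_(0 <= j < N) D j <= K * \sum_(0 <= k < N.+1) D k.
  by rewrite ler_wpM2l// h2 lerDl.
lra.
Qed.

(** * The bound by the data *)

Definition grid_form (R : realType) (h1 h2 : R) (M1 M2 : nat)
    (u v : nat -> nat -> R^o) : R := h1 * h2 * interior_sum M1 M2 u v.

Lemma grid_form_psd (R : realType) (h1 h2 : R) M1 M2 : 0 <= h1 * h2 ->
  psd_form (@grid_form R h1 h2 M1 M2).
Proof.
move=> h0; apply: psd_form_scale => //; split.
- by move=> c u u' v; rewrite -interior_sumD.
- by move=> u v; apply: eq_bigr => i _; apply: eq_bigr => j _; rewrite mulrC.
- by move=> u; apply: sumr_ge0 => i _; apply: sumr_ge0 => j _; rewrite -expr2 sqr_ge0.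
Qed.

Lemma grid_norm_seminorm (R : realType) (h1 h2 : R) M1 M2 (u : nat -> nat -> R) :
  grid_norm h1 h2 M1 M2 u = seminorm (@grid_form R h1 h2 M1 M2) u.
Proof. exact: grid_normE. Qed.

Lemma eq_grid_norm (R : realType) (h1 h2 : R) M1 M2 (u v : nat -> nat -> R) :
  (forall i j, interior_node M1 M2 i j -> u i j = v i j) ->
  grid_norm h1 h2 M1 M2 u = grid_norm h1 h2 M1 M2 v.
Proof.
move=> uv; rewrite !grid_normE; congr (Num.sqrt (_ * _)).
rewrite (eq_interior_sum _ uv) /interior_sum big_nat_cond [RHS]big_nat_cond.
apply: eq_bigr => i /andP[iM _]; rewrite big_nat_cond [RHS]big_nat_cond.
by apply: eq_bigr => j /andP[jM _]; rewrite uv// /interior_node iM.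
Qed.

Lemma grid_norm_add (R : realType) (h1 h2 : R) M1 M2 (u v : nat -> nat -> R) :
  0 <= h1 * h2 ->
  grid_norm h1 h2 M1 M2 (fun i j => u i j + v i j)
    <= grid_norm h1 h2 M1 M2 u + grid_norm h1 h2 M1 M2 v.
Proof.
by move=> h0; rewrite !grid_norm_seminorm; exact: (seminormD (grid_form_psd M1 M2 h0)).
Qed.

Lemma grid_norm_scale (R : realType) (h1 h2 : R) M1 M2 (c : R) (u : nat -> nat -> R) :
  0 <= h1 * h2 ->
  grid_norm h1 h2 M1 M2 (fun i j => c * u i j) = `|c| * grid_norm h1 h2 M1 M2 u.
Proof.
by move=> h0; rewrite !grid_norm_seminorm; exact: (seminormZ (grid_form_psd M1 M2 h0)).
Qed.

Lemma bounded_measurable_interior_sum (R : realType) (D : set (measurableTypeR R))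
    (M1 M2 : nat) (phi : nat -> nat -> R -> R) (w : nat -> nat -> R) :
  (forall i j, interior_node M1 M2 i j -> bounded_measurable D (phi i j)) ->
  bounded_measurable D (fun s => interior_sum M1 M2 (fun i j => phi i j s) w).
Proof.
move=> bphi; have -> : (fun s => interior_sum M1 M2 (fun i j => phi i j s) w)
   = (fun s => \sum_(i <- index_iota 1 M1) 1 *
       \sum_(j <- index_iota 1 M2) w i j * phi i j s).
  apply/funext => s; apply: eq_bigr => i _; rewrite mul1r.
  by apply: eq_bigr => j _; rewrite mulrC.
apply: (@bounded_measurable_sum _ _ (fun=> 1)
  (fun i s => \sum_(j <- index_iota 1 M2) w i j * phi i j s)) => i iM.
apply: bounded_measurable_sum => j jM; apply: bphi.
by move: iM jM; rewrite !mem_index_iota /interior_node => -> ->.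
Qed.

Lemma weighted_integral_interior_sum (R : realType) (D : set (measurableTypeR R))
    (W : R -> R) (M1 M2 : nat) (phi : nat -> nat -> R -> R) (w : nat -> nat -> R) :
  is_weight D W ->
  (forall i j, interior_node M1 M2 i j -> bounded_measurable D (phi i j)) ->
  interior_sum M1 M2 (fun i j => weighted_integral D W (phi i j)) w
  = weighted_integral D W (fun s => interior_sum M1 M2 (fun i j => phi i j s) w).
Proof.
move=> wW bphi.
have -> : weighted_integral D W (fun s => interior_sum M1 M2 (fun i j => phi i j s) w)
   = weighted_integral D W (fun s => \sum_(i <- index_iota 1 M1) 1 *
       \sum_(j <- index_iota 1 M2) w i j * phi i j s).
  apply: eq_weighted_integral => s _; apply: eq_bigr => i _; rewrite mul1r.
  by apply: eq_bigr => j _; rewrite mulrC.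
have bij i j : i \in index_iota 1 M1 -> j \in index_iota 1 M2 -> bounded_measurable D (phi i j).
  move=> iM jM; apply: bphi.
  by move: iM jM; rewrite !mem_index_iota /interior_node => -> ->.
rewrite (@weighted_integral_sum _ D W (fun=> 1)
  (fun i s => \sum_(j <- index_iota 1 M2) w i j * phi i j s))//; last first.
  by move=> i iM; apply: bounded_measurable_sum => j jM; exact: bij.
apply: eq_big_seq => i iM; rewrite mul1r weighted_integral_sum//; last first.
  by move=> j jM; exact: bij.
by apply: eq_bigr => j _; rewrite mulrC.
Qed.

(* Duality: pair the vector of integrals with itself and apply Cauchy-Schwarz
   under the integral. *)
Lemma grid_norm_weighted_integral (R : realType) (D : set (measurableTypeR R))
    (W : R -> R) (h1 h2 M : R) (M1 M2 : nat) (phi : nat -> nat -> R -> R) :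
  0 <= h1 * h2 -> is_weight D W -> 0 <= M ->
  (forall i j, interior_node M1 M2 i j -> bounded_measurable D (phi i j)) ->
  (forall s, D s -> grid_norm h1 h2 M1 M2 (fun i j => phi i j s) <= M) ->
  grid_norm h1 h2 M1 M2 (fun i j => weighted_integral D W (phi i j))
    <= (\int[@lebesgue_measure R]_(s in D) W s) * M.
Proof.
move=> h0 wW M0 bphi phiM; set w := fun i j => weighted_integral D W (phi i j).
have Gp := grid_form_psd M1 M2 h0.
set n := grid_norm h1 h2 M1 M2 w; have n0 : 0 <= n by exact: sqrtr_ge0.
have I0 : 0 <= \int[@lebesgue_measure R]_(s in D) W s.
  by case: wW => _ _ W0; exact: Rintegral_ge0.
have [->|nn] := eqVneq n 0; first by rewrite mulr_ge0.
have np : 0 < n by rewrite lt_def nn.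
rewrite -(ler_pM2r np) -expr2 {1}/n grid_norm_seminorm (sqr_seminorm Gp) /grid_form.
rewrite weighted_integral_interior_sum//.
have bI := bounded_measurable_interior_sum w bphi.
(* The summand 0 gives the scalar multiple the shape of [weighted_integral_lin]. *)
have -> : h1 * h2 * weighted_integral D W (fun s => interior_sum M1 M2 (fun i j => phi i j s) w)
  = weighted_integral D W (fun s => h1 * h2 * interior_sum M1 M2 (fun i j => phi i j s) w + 0).
  rewrite (weighted_integral_lin _ wW bI (bounded_measurable_cst D 0)).
  rewrite [X in _ = _ + X](_ : _ = 0) ?addr0//.
  by rewrite /weighted_integral /Rintegral integral0_eq// => s _; rewrite mul0r.
have [mI _] := bounded_measurable_lin (h1 * h2) bI (bounded_measurable_cst D 0).
apply: le_trans (ler_norm _) _.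
rewrite -mulrA [leRHS]mulrC; apply: weighted_integral_abs_le => // s Ds.
rewrite addr0; apply: le_trans (psd_form_cauchy Gp (fun i j => phi i j s) w) _.
by rewrite -!grid_norm_seminorm ler_wpM2r// phiM.
Qed.

(** The integrand is the derivative of [F s = t^a - (t - s)^a], which maps []0, t[] onto []0, t^a[];
    substitution in the integral of 1 copes with the singularity at [s = t]. *)
Lemma integral_abel_kernel (R : realType) (a t : R) : 0 < a -> 0 < t ->
  (\int[lebesgue_measure]_(s in `]0%R, t[) (a * (t - s) `^ (a - 1))%:E
   = (t `^ a)%:E)%E.
Proof.
move=> a0 t0; pose F (s : R) := t `^ a - (t - s) `^ a.
have ts s : s \in `]0, t[ -> 0 < t - s by rewrite in_itv/= subr_gt0 => /andP[].
have dB (s : R) : is_derive s (1 : R) (fun s => t - s) (-1).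
  have h := is_deriveB (is_derive_cst t s (1 : R)) (is_derive_id s (1 : R)).
  by apply: (is_derive_eq h); rewrite sub0r.
have cB (s : R) : {for s, continuous (fun s : R => t - s)}.
  by move=> ?; apply: cvgB; [exact: cvg_cst|exact: cvg_id].
have lt_pow (x y : R) : 0 <= x -> 0 <= y -> x < y -> x `^ a < y `^ a.
  by move=> x0 y0; apply: gt0_ltr_powR => //; rewrite nnegrE.
have ta : 0 < t `^ a by exact: powR_gt0.
have E : (\int[lebesgue_measure]_(s in `]0%R, (t `^ a)%R[) 1%:E =
    \int[lebesgue_measure]_(s in `]0%R, t[) (cst 1 (F s) * (a * (t - s) `^ (a - 1)))%:E)%E.
  apply: (@ge0_substitution_oo R F _ (cst 1)).
  - exact: t0.
  - exact: interval_is_interval.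
  - move=> x y xt yt xy; have xt' := ts x xt; have yt' := ts y yt.
    by rewrite ltrD2l ltrN2; apply: lt_pow; [exact: ltW|exact: ltW|lra].
  - move=> x xt; have xt' := ts x xt.
    have h := is_deriveB (is_derive_cst (t `^ a) x (1 : R))
      (@is_derive1_comp R (fun y => y `^ a) (fun s => t - s) x _ _
         (is_derive1_powR a xt') (dB x)).
    by apply: (is_derive_eq h); ring.
  - move=> x xt; have xt' := ts x xt; apply: cvgM; first exact: cvg_cst.
    apply: (@cvg_comp _ _ _ (fun s : R => t - s) (fun y : R => y `^ (a - 1)) _ _ _ (cB x)).
    exact: powR_continuous.
  - move=> x xt; have xt' := ts x xt; rewrite /= in_itv/= subr_gt0.
    move: xt; rewrite in_itv/= => /andP[x0 xt''].
    by rewrite lt_pow ?(ltW xt') ?(ltW t0)//= ?gtrBl ?powR_gt0//; lra.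
  - move=> y; rewrite /= in_itv/= => /andP[y0 yt].
    have p0 : 0 < t `^ a - y by rewrite subr_gt0.
    exists (t - (t `^ a - y) `^ a^-1); last first.
      rewrite /F subKr -powRrM mulVf ?gt_eqF// powRr1 ?(ltW p0)//; ring.
    have e : t = (t `^ a) `^ a^-1 by rewrite -powRrM mulfV ?gt_eqF// powRr1// ltW.
    rewrite in_itv/= gtrBl powR_gt0// andbT subr_gt0 [ltRHS]e.
    by apply: gt0_ltr_powR; rewrite ?invr_gt0 ?nnegrE ?(ltW p0) ?(ltW ta)//; lra.
  - by move=> y _; exact: cvg_cst.
  - by move=> y _.
transitivity (\int[lebesgue_measure]_(s in `]0%R, t[) (cst 1 (F s) * (a * (t - s) `^ (a - 1)))%:E)%E.
  by apply: eq_integral => s _; rewrite /= mul1r.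
rewrite -E integral_cst//= lebesgue_measure_itv /= lte_fin ta.
by rewrite oppr0 adde0 mul1e.
Qed.

Lemma is_weight_abel (R : realType) (a t : R) : 0 < a <= 2 -> 0 < t ->
  is_weight `[0, t] (fun s => beta_kernel a (t - s)) /\
  \int[@lebesgue_measure R]_(s in `[0, t]) beta_kernel a (t - s)
    = t `^ a / (a * euler_gamma a).
Proof.
move=> /andP[a0 a2] t0; have g0 := euler_gamma_gt0 a0 a2.
pose c := a * euler_gamma a; have c0 : 0 < c by rewrite mulr_gt0.
have k0 s : 0 <= beta_kernel a (t - s) by rewrite divr_ge0 ?powR_ge0 ?ltW.
have mk (D : set R) : measurable_fun D (fun s => beta_kernel a (t - s)).
  apply: measurable_funTS; apply: measurable_funM => //.
  have m : measurable_fun [set: R] (fun s : R => t - s) by exact: measurable_funB.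
  exact: (measurableT_comp (measurable_powR (a - 1)) m).
have I : (\int[lebesgue_measure]_(s in `[0%R, t]) (beta_kernel a (t - s))%:E
    = (t `^ a / c)%:E)%E.
  rewrite integral_itv_bndoo; last by apply/measurable_EFinP; exact: mk.
  rewrite [RHS]EFinM muleC -(integral_abel_kernel a0 t0) -ge0_integralZl_EFin//; last 3 first.
  - by move=> s _; rewrite lee_fin mulr_ge0 ?powR_ge0// ltW.
  - apply/measurable_EFinP; apply: measurable_funM => //; apply: measurable_funTS.
    have m : measurable_fun [set: R] (fun s : R => t - s) by exact: measurable_funB.
    exact: (measurableT_comp (measurable_powR (a - 1)) m).
  - by rewrite invr_ge0 ltW.
  apply: eq_integral => s _; rewrite -EFinM; congr EFin.
  by rewrite /beta_kernel /c; field; rewrite !gt_eqF.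
split; last by rewrite /Rintegral I.
split; [exact: measurable_itv| |by move=> s _; exact: k0].
apply/integrableP; split; first by apply/measurable_EFinP; exact: mk.
under eq_integral do rewrite /= ger0_norm ?k0//.
by rewrite I ltry.
Qed.

Lemma continuous_bounded_measurable (R : realType) (T t : R) (f : R -> R) :
  0 <= t -> t <= T -> {within `[0, T], continuous f} -> bounded_measurable `[0, t] f.
Proof.
move=> t0 tT cf; have cft : {within `[0, t], continuous f}.
  apply: continuous_subspaceW cf => x /=.
  by rewrite !in_itv/= => /andP[? ?]; apply/andP; split; lra.
split; first by apply: subspace_continuous_measurable_fun => //; exact: measurable_itv.
have [c1 _ h1] := EVT_max t0 cft; have [c2 _ h2] := EVT_min t0 cft.
exists (`|f c1| + `|f c2|) => s st.
have := h1 s st; have := h2 s st; have := ler_norm (f c1); have := ler_norm (- f c2).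
rewrite normrN => *; have := normr_ge0 (f c1); have := normr_ge0 (f c2) => *.
by rewrite ler_norml; apply/andP; split; lra.
Qed.

(** Ensures that the supremum over time in the final bound is taken over a bounded set and is
    therefore an upper bound. *)
Lemma grid_norm_bounded (R : realType) (h1 h2 : R) (M1 M2 : nat)
    (D : set (measurableTypeR R)) (phi : nat -> nat -> R -> R) : 0 <= h1 * h2 ->
  (forall i j, interior_node M1 M2 i j -> bounded_measurable D (phi i j)) ->
  exists M, forall s, D s -> grid_norm h1 h2 M1 M2 (fun i j => phi i j s) <= M.
Proof.
move=> h0 bphi.
have bphi2 i j : interior_node M1 M2 i j -> bounded_measurable D (fun s => phi i j s ^+ 2).
  move=> /bphi[m [M hM]]; split; first exact: measurable_funX.
  exists (M ^+ 2) => s Ds; have := hM s Ds => h; rewrite normrX.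
  by apply: lerXn2r; rewrite ?nnegrE// (le_trans _ h).
have [_ [M hM]] := bounded_measurable_interior_sum (fun _ _ => 1) bphi2.
exists (Num.sqrt (h1 * h2 * M)) => s Ds; rewrite grid_normE; apply: ler_wsqrtr.
rewrite ler_wpM2l// (le_trans _ (hM s Ds))// (le_trans _ (ler_norm _))//.
rewrite le_eqVlt; apply/orP; left; apply/eqP.
by apply: eq_bigr => i _; apply: eq_bigr => j _; rewrite mulr1 expr2.
Qed.

Lemma grid_norm_convolution (R : realType) (T t a h1 h2 S : R) (M1 M2 : nat)
    (L : nat -> nat -> R) (f : nat -> nat -> R -> R) :
  0 <= h1 * h2 -> 0 < a <= 2 -> 0 <= t -> t <= T -> 0 <= S ->
  (forall i j, interior_node M1 M2 i j -> bounded_measurable `[0, t] (f i j)) ->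
  (forall s, 0 <= s <= t -> grid_norm h1 h2 M1 M2 (fun i j => f i j s) <= S) ->
  grid_norm h1 h2 M1 M2
    (fun i j => convolution (beta_kernel a) (fun s => L i j + f i j s) t)
  <= T `^ a / (a * euler_gamma a) * (grid_norm h1 h2 M1 M2 L + S).
Proof.
move=> h0 a02; have /andP[a0 a2] := a02.
have g0 := euler_gamma_gt0 a0 a2; have c0 : 0 < a * euler_gamma a by rewrite mulr_gt0.
have L0 : 0 <= grid_norm h1 h2 M1 M2 L by exact: sqrtr_ge0.
rewrite le_eqVlt => /predU1P[<-|t0] tT S0 bf fS.
  (* At [t = 0] the convolution is an integral over one point, hence 0. *)
  rewrite (@eq_grid_norm _ _ _ _ _ _ (fun i j => 0 * L i j)); last first.
    by move=> i j _; rewrite mul0r /convolution set_itv1 Rintegral_set1.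
  rewrite grid_norm_scale// normr0 mul0r mulr_ge0// ?addr_ge0//.
  by rewrite divr_ge0 ?powR_ge0// ltW.
have [wW IW] := is_weight_abel a02 t0.
have bLf i j : interior_node M1 M2 i j -> bounded_measurable `[0, t] (fun s => L i j + f i j s).
  move=> ij; have -> : (fun s => L i j + f i j s) = (fun s => 1 * L i j + f i j s).
    by apply/funext => s; rewrite mul1r.
  exact: (bounded_measurable_lin 1 (bounded_measurable_cst _ (L i j)) (bf i j ij)).
have H := @grid_norm_weighted_integral R `[0, t] _ h1 h2 (grid_norm h1 h2 M1 M2 L + S) M1 M2
  (fun i j s => L i j + f i j s) h0 wW (addr_ge0 L0 S0) bLf.
rewrite (@eq_grid_norm _ _ _ _ _ _ (fun i j => weighted_integral `[0, t]
    (fun s => beta_kernel a (t - s)) (fun s => L i j + f i j s))); last first.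
  by move=> i j _; apply: eq_Rintegral => s _; rewrite mulrC.
apply: le_trans (H _) _.
  move=> s; rewrite /= in_itv/= => st; apply: le_trans (grid_norm_add _ _ _ _ h0) _.
  by rewrite lerD2l fS.
rewrite IW; apply: ler_wpM2r; first by rewrite addr_ge0.
apply: ler_wpM2r; first by rewrite invr_ge0 ltW.
by apply: ge0_ler_powR => //; rewrite ?nnegrE; lra.
Qed.

Lemma grid_norm_thalf (R : realType) (h1 h2 : R) M1 M2 (v : nat -> nat -> nat -> R) n :
  0 <= h1 * h2 -> (0 < n)%N ->
  grid_norm h1 h2 M1 M2 (thalf v n)
    <= 2^-1 * grid_norm h1 h2 M1 M2 (v n) + 2^-1 * grid_norm h1 h2 M1 M2 (v n.-1).
Proof.
move=> h0; case: n => // n _.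
have -> : thalf v n.+1 = (fun i j => 2^-1 * v n.+1 i j + 2^-1 * v n i j).
  by apply/funext => i; apply/funext => j; rewrite /thalf mulrC mulrDr.
apply: le_trans (grid_norm_add _ _ _ _ h0) _.
by rewrite !grid_norm_scale// ger0_norm ?invr_ge0.
Qed.

Theorem theorem4p1 (R : realType) (T : R) (alpha : R -> R) (chi : nat -> R)
    (T_gt0 : 0 < T)
    (alpha_ok : admissible_exponent T alpha)
    (chi_ok : is_chi (alpha 0 - 1) chi) :
  exists Q Q' : R, [/\ 0 < Q, 0 < Q' &
    forall (l1 r1 l2 r2 Q1 Q2 : R) (N M1 M2 : nat)
           (u0 ubar0 : R -> R -> R) (f : R -> R -> R -> R)
           (U : nat -> nat -> nat -> R),
    let tau := T / N%:R in
    let h1 := (r1 - l1) / M1%:R in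
    let h2 := (r2 - l2) / M2%:R in
    let t_ := fun n : nat => n%:R * tau in
    let x_ := fun i : nat => l1 + i%:R * h1 in
    let y_ := fun j : nat => l2 + j%:R * h2 in
    let nodes := fun (v : R -> R -> R) (i j : nat) => v (x_ i) (y_ j) in
    let F := fun n i j : nat =>
      calF alpha l1 r1 l2 r2 u0 ubar0 f (x_ i) (y_ j) (t_ n) in
    let norm := grid_norm h1 h2 M1 M2 in
    l1 < r1 -> l2 < r2 ->
    (0 < N)%N -> (0 < M1)%N -> (0 < M2)%N ->
    0 < Q1 -> 0 < Q2 -> Q1 * h1 <= h2 -> h2 <= Q2 * h1 ->
    twice_partially_derivable l1 r1 l2 r2 u0 ->
    (forall x y, l1 <= x <= r1 -> l2 <= y <= r2 ->
       {within `[0, T], continuous (f x y)}) ->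
    (* [norm] does not see the boundary nodes, whereas [Ah] uses the boundary
       values of the source; without this condition the first bound fails. *)
    (forall n i j, (1 <= n <= N)%N -> boundary_node M1 M2 i j ->
       thalf F n i j = 0) ->
    adi_solution alpha chi tau h1 h2 N M1 M2 F U ->
    norm (U N) <= Q * \sum_(1 <= n < N.+1) tau * norm (thalf F n) /\
    Q * \sum_(1 <= n < N.+1) tau * norm (thalf F n)
      <= Q' * (norm (nodes (laplacian l1 r1 l2 r2 u0)) + norm (nodes ubar0)
               + sup [set norm (nodes (fun x y => f x y t))
                     | t in `[0, t_ N]])].
Proof.
have T0 := ltW T_gt0; have T00 : 0 <= (0 : R) <= T by apply/andP; split.
have [a12 _ _ _] := alpha_ok; have /andP[a1 a2] := a12 0 T00.
pose a := alpha 0 - 1.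
have a01 : 0 < a < 1 by rewrite /a; apply/andP; split; lra.
have a02 : 0 < a <= 2 by rewrite /a; apply/andP; split; lra.
have [K rg] := regular_g_kernel T_gt0 alpha_ok.
have K0 := regular_ge0 T0 rg.
pose W := K * (1 + (T + 2 * T `^ 2^-1)).
have W0 : 0 <= W by rewrite mulr_ge0// !addr_ge0// mulr_ge0// powR_ge0.
pose kap := T `^ a / (a * euler_gamma a).
have kap0 : 0 <= kap.
  rewrite divr_ge0 ?powR_ge0// mulr_ge0//; first by case/andP: a02 => /ltW.
  by apply/ltW/euler_gamma_gt0; case/andP: a02.
(* The factor of [adi_stability], with its power bounded uniformly in [N]. *)
pose Q := 6 * expR (4 * W * T).
have Q0 : 0 < Q by rewrite mulr_gt0// expR_gt0.
(* [T] is the sum of the steps, [kap] the bound on the mass of the Abel kernel, [K] the bound on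
   [g]; the 1 ensures positivity. *)
exists Q, (Q * (T * (kap + K + 1))); split=> //.
  have c0 : 0 < kap + K + 1 by lra.
  by apply: mulr_gt0 => //; exact: mulr_gt0.
move=> l1 r1 l2 r2 Q1 Q2 N M1 M2 u0 ubar0 f U tau h1 h2 t_ x_ y_ nodes F norm.
move=> lr1 lr2 N0 M10 M20 _ _ _ _ _ cf Fb Usol.
have tau0 : 0 < tau by rewrite divr_gt0// ltr0n.
have h10 : 0 < h1 by rewrite divr_gt0 ?subr_gt0 ?ltr0n.
have h20 : 0 < h2 by rewrite divr_gt0 ?subr_gt0 ?ltr0n.
have h0 : 0 <= h1 * h2 by rewrite mulr_ge0 ?ltW.
have NT : N%:R * tau = T by rewrite /tau mulrC divfK// pnatr_eq0 -lt0n.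
have tT n : (n <= N)%N -> 0 <= t_ n <= T.
  move=> nN; rewrite /t_ mulr_ge0 ?(ltW tau0)//= -NT ler_wpM2r ?(ltW tau0)//.
  by rewrite ler_nat.
(* [c0 = 1 + (g tau - 1) / 2] with [g tau >= 0]. *)
have c0 : 2^-1 <= c0coef alpha tau.
  rewrite /c0coef /wcoef mul0r {2}/g_kernel eqxx.
  have := g_kernel_ge0 alpha_ok (tT 1%N N0); rewrite /t_.
  by move: (g_kernel _ _) => p p0; lra.
split.
  have chip (V : lmodType R) (B : V -> V -> R) (v : nat -> V) m : psd_form B ->
      0 <= \sum_(0 <= n < m) \sum_(0 <= p < n.+1) chi p * B (v (n - p)%N) (v n).
    by move=> Bp; exact: (chi_psd Bp v m a01 chi_ok).
  have wW : (1 < N)%N -> `|wtilde alpha tau 1|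
      + \sum_(1 <= j < N.-1) `|wtilde alpha tau j.+1 - wtilde alpha tau j| <= W * tau.
    by move=> N1; apply: (wtilde_bounds T_gt0 rg (ltW tau0)); rewrite ?NT.
  have Fz n : (1 <= n <= N)%N -> zero_boundary M1 M2 (thalf F n).
    by move=> nN i j; exact: Fb.
  apply: le_trans (adi_stability tau0 h10 h20 N0 W0 c0 chip wW Fz Usol) _.
  rewrite ler_wpM2r//.
    by apply: sumr_ge0 => n _; rewrite mulr_ge0 ?sqrtr_ge0// ltW.
  rewrite ler_wpM2l//; have -> : 4 * W * T = N%:R * (4 * W * tau) by rewrite -NT; ring.
  have x0 : 0 <= 4 * W * tau by rewrite mulr_ge0 ?(ltW tau0)// mulr_ge0.
  rewrite expRM_natl; apply: lerXn2r; last exact: expR_ge1Dx.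
    by rewrite nnegrE addr_ge0.
  by rewrite nnegrE expR_ge0.
have node_in i j : interior_node M1 M2 i j -> l1 <= x_ i <= r1 /\ l2 <= y_ j <= r2.
  have aux (l r : R) (M k : nat) : l < r -> (0 < M)%N -> (k <= M)%N ->
      l <= l + k%:R * ((r - l) / M%:R) <= r.
    move=> lr M0 kM; have lr0 : 0 <= r - l by rewrite subr_ge0 ltW.
    rewrite lerDl mulr_ge0 ?divr_ge0//= -lerBrDl mulrCA ler_piMr//.
    by rewrite ler_pdivrMr ?ltr0n// mul1r ler_nat.
  move=> /andP[/andP[_ iM] /andP[_ jM]].
  by split; apply: aux => //; exact: ltnW.
have bf t : 0 <= t <= T -> forall i j, interior_node M1 M2 i j ->
    bounded_measurable `[0, t] (fun s => f (x_ i) (y_ j) s).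
  move=> /andP[t0 tT'] i j /node_in[xi yj].
  by apply: (continuous_bounded_measurable t0 tT'); exact: cf.
set E := [set norm _ | _ in _].
have fS s : 0 <= s <= T -> norm (nodes (fun x y => f x y s)) <= sup E.
  have T1 : 0 <= T <= T by rewrite T0 lexx.
  have [M hM] := grid_norm_bounded h0 (bf T T1).
  move=> sT; apply: ub_le_sup; last first.
    by exists s => //; rewrite /= in_itv/= /t_ NT.
  exists M => x [r]; rewrite /= in_itv/= /t_ NT => rT <-.
  by apply: hM; rewrite /= in_itv.
have S0 : 0 <= sup E by apply: le_trans (fS 0 T00); exact: sqrtr_ge0.
set nl := norm (nodes (laplacian _ _ _ _ _)); set nu := norm (nodes ubar0).
have nl0 : 0 <= nl by exact: sqrtr_ge0.
have nu0 : 0 <= nu by exact: sqrtr_ge0.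
have FM n : (n <= N)%N -> norm (F n) <= (kap + K + 1) * (nl + nu + sup E).
  move=> nN; have tn := tT n nN; have /andP[tn0 tnT] := tn.
  apply: le_trans (grid_norm_add M1 M2
    (fun i j => convolution (beta_kernel a) (fun s => laplacian l1 r1 l2 r2 u0 (x_ i) (y_ j)
       + f (x_ i) (y_ j) s) (t_ n))
    (fun i j => g_kernel alpha (t_ n) * nodes ubar0 i j) h0) _.
  rewrite grid_norm_scale//.
  have c1 := @grid_norm_convolution R T (t_ n) a h1 h2 (sup E) M1 M2
    (nodes (laplacian l1 r1 l2 r2 u0)) (fun i j s => f (x_ i) (y_ j) s) h0 a02 tn0 tnT S0 (bf _ tn).
  apply: (@le_trans _ _ (kap * (nl + sup E) + K * nu)).
    apply: lerD.
      apply: c1 => s st; apply: fS; have /andP[s0 s1] := st.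
      by apply/andP; split => //; exact: le_trans tnT.
    by rewrite ler_wpM2r//; case: rg => + _ _; apply.
  (* Nonnegative cross terms, added to reach a common factor for the three data norms. *)
  have p1 : 0 <= kap * nu by rewrite mulr_ge0.
  have p2 : 0 <= K * nl by rewrite mulr_ge0.
  have p3 : 0 <= K * sup E by rewrite mulr_ge0.
  lra.
rewrite -(mulrA Q) -(mulrA T) ler_wpM2l ?(ltW Q0)//.
have -> : T * ((kap + K + 1) * (nl + nu + sup E))
  = \sum_(1 <= n < N.+1) tau * ((kap + K + 1) * (nl + nu + sup E)).
  by rewrite big_const_nat subn1 /= iter_addr_0 -NT -mulr_natl; ring.
rewrite big_nat_cond [leRHS]big_nat_cond; apply: ler_sum => n.
rewrite andbT ltnS => /andP[n1 nN]; rewrite ler_wpM2l ?(ltW tau0)//.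
apply: (le_trans (grid_norm_thalf M1 M2 F h0 n1)).
have half (p q X : R) : p <= X -> q <= X -> 2^-1 * p + 2^-1 * q <= X by lra.
exact: half (FM n nN) (FM n.-1 (leq_trans (leq_pred n) nN)).
Qed.
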